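(* Let $R$ be a normal integral domain with fraction field $K$, and let $A$ be an $R$-algebra that is free of finite rank as an $R$-module, such that $A^K=K\otimes_R A$ is split and such that every non-zero prime ideal of $R$ admits a perfect $A$-gate. Let $\mathfrak{p}\in\operatorname{Spec}(R)$, and let $\mathrm{d}_A^{\mathfrak{p}}:\mathrm{G}_0(A^K)\to\mathrm{G}_0(A(\mathfrak{p}))$ be the decomposition map. Then: (a) A non-zero finite-dimensional $A^K$-module $V$ belongs to a $\mathfrak{p}$-block if and only if $\mathrm{d}_A^{\mathfrak{p}}([V])$ belongs to a block of $A(\mathfrak{p})$. (b) Two non-zero finite-dimensional $A^K$-modules $V$ and $W$ lie in the same $\mathfrak{p}$-block if and only if $\mathrm{d}_A^{\mathfrak{p}}([V])$ and $\mathrm{d}_A^{\mathfrak{p}}([W])$ lie in the same block of $A(\mathfrak{p})$. (c) If $\mathcal{F}$ is a $\mathfrak{p}$-family of $A^K$, then $$\mathrm{d}_A^{\mathfrak{p}}(\mathcal{F}):=\{T\mid T\text{ is a constituent of }\mathrm{d}_A^{\mathfrak{p}}([S])\text{ for some }S\in\mathcal{F}\}$$ is a family of $A(\mathfrak{p})$, and all families of $A(\mathfrak{p})$ are obtained in this way. (d) The Brauer $\mathfrak{p}$-families are equal to the $\mathfrak{p}$-families.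
   Context: A finite-dimensional algebra over a field is split if its simple modules remain simple under every extension of the base field. $A(\mathfrak{p})=\mathrm{k}(\mathfrak{p})\otimes_R A$ with $\mathrm{k}(\mathfrak{p})=\operatorname{Frac}(R/\mathfrak{p})$. $\mathrm{G}_0(B)$ is the Grothendieck group of finitely generated modules of a finite-dimensional algebra $B$. Decomposition maps. For non-zero $\mathfrak{p}$, a perfect $A$-gate in $\mathfrak{p}$ is a discrete valuation ring $\mathscr{O}$ with fraction field $K$ and maximal ideal $\mathfrak{m}$ which dominates $R_{\mathfrak{p}}$ (i.e. $R_{\mathfrak{p}}\subseteq\mathscr{O}$ and $\mathfrak{m}\cap R_{\mathfrak{p}}$ is the maximal ideal of $R_{\mathfrak p}$) and such that the scalar extension map $\mathrm{d}_A^{\mathfrak{p},\mathfrak{m}}:\mathrm{G}_0(A(\mathfrak{p}))\to\mathrm{G}_0(A^{\mathscr{O}}(\mathfrak{m}))$ is an isomorphism; here $A^{\mathscr{O}}=\mathscr{O}\otimes_R A$, $A^{\mathscr{O}}(\mathfrak{m})=A^{\mathscr{O}}/\mathfrak{m}A^{\mathscr{O}}$. The decomposition map sends $[V]$ to $(\mathrm{d}_A^{\mathfrak{p},\mathfrak{m}})^{-1}([\widetilde{V}/\mathfrak{m}\widetilde{V}])$, where $\widetilde{V}$ is any $A^{\mathscr{O}}$-lattice in $V$ ($\mathscr{O}$-free of finite rank, spanning $V$ over $K$). As $R$ is normal, it is independent of $\mathscr{O}$ (Geck–Rouquier) and is denoted $\mathrm{d}_A^{\mathfrak{p}}$. For $\mathfrak{p}=(0)$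 it is the identity. A constituent of a class $[V]$ is a simple module occurring with non-zero multiplicity in it. Blocks and families. Block idempotents of a ring are its centrally-primitive idempotents. A non-zero module $V$ belongs to the block of $c$ if $cV=V$; a class in $\mathrm{G}_0(B)$ of a module belongs to a block of $B$ if all its constituents do. The families of a finite-dimensional algebra are the sets of simple modules belonging to a common block. The $\mathfrak{p}$-blocks of $A^K$ are given by the images in $A^K$ of the block idempotents of $A_{\mathfrak{p}}\subseteq A^K$ (pairwise orthogonal central idempotents of $A^K$ with sum $1$): a non-zero $A^K$-module $V$ belongs to the $\mathfrak{p}$-block $c$ if $cV=V$. The $\mathfrak{p}$-families are the sets of simple $A^K$-modules belonging to a common $\mathfrak{p}$-block. Two modules (or classes) lie in the same block if there is one block to which both belong. Brauer graph. The Brauer $\mathfrak{p}$-graph of $A$ has as vertices the (isomorphism classes of) simple $A^K$-modules, with an edge between $S$ and $T$ iff there are $S'$ in the $A^K$-family of $S$ and $T'$ in the $A^K$-family of $T$ such that $\mathrm{d}_A^{\mathfrak{p}}([S'])$ and $\mathrm{d}_A^{\mathfrak{p}}([T'])$ have a common constituent. The Brauer $\mathfrak{p}$-families are (the vertex sets of) the connected components of this graph. *)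

(* Defs.v *)
From HB Require Import structures.
From Stdlib Require Import Relations.
From mathcomp Require Import all_boot all_algebra.
From mathcomp Require Import boolp classical_sets.
From mathcomp Require Import freeg.

Set Implicit Arguments.
Unset Strict Implicit.
Unset Printing Implicit Defensive.

Import GRing.Theory.

Local Open Scope ring_scope.
Local Open Scope quotient_scope.
Local Open Scope classical_set_scope.

(* [algType R] excludes the zero ring, which is free of rank 0; hence an
   R-algebra is given here by a ring homomorphism from R to the centre of a
   possibly zero ring. *)
Record algebra (R : comNzRingType) := Algebra {
  alg_ring :> pzRingType;
  alg_scalar : {rmorphism R -> alg_ring};
  alg_central : forall r x, alg_scalar r * x = x * alg_scalar r }.

Arguments alg_scalar {R} _.

Record freeAlgebra (R : comNzRingType) := FreeAlgebra {
  free_alg :> algebra R;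
  free_rank : nat;
  free_basis : 'I_free_rank -> free_alg;
  free_coord : free_alg -> 'rV[R]_free_rank;
  free_coordK : forall x,
    \sum_i alg_scalar free_alg (free_coord x 0 i) * free_basis i = x;
  free_combK : forall c : 'rV[R]_free_rank,
    free_coord (\sum_i alg_scalar free_alg (c 0 i) * free_basis i) = c }.

Arguments free_rank {R} _.
Arguments free_basis {R} _.
Arguments free_coord {R} _.

Section ScalarExtension.

Variables (R S : comNzRingType) (A : freeAlgebra R) (phi : {rmorphism R -> S}).
Local Notation n := (free_rank A).
Local Notation e := (free_basis A).
Local Notation coord := (free_coord A).
Local Notation sc := (alg_scalar A).

Lemma free_coordD : {morph coord : x y / x + y}.
Proof.
move=> x y; rewrite -[RHS](@free_combK _ A); congr coord.
rewrite -{1}(@free_coordK _ A x) -{1}(@free_coordK _ A y) -big_split /=.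
by apply: eq_bigr => i _; rewrite mxE rmorphD mulrDl.
Qed.

Lemma free_coordZ r x : coord (sc r * x) = r *: coord x.
Proof.
rewrite -[RHS](@free_combK _ A); congr coord.
rewrite -{1}(@free_coordK _ A x) mulr_sumr.
by apply: eq_bigr => i _; rewrite mxE rmorphM mulrA.
Qed.

Lemma free_coord0 : coord 0 = 0.
Proof. by have := free_coordZ 0 0; rewrite mulr0 scale0r. Qed.

Lemma free_coord_sum (I : Type) (r : seq I) (F : I -> A) :
  coord (\sum_(i <- r) F i) = \sum_(i <- r) coord (F i).
Proof. exact: (big_morph _ free_coordD free_coord0). Qed.

Lemma free_coord_basis i : coord (e i) = delta_mx 0 i.
Proof.
rewrite -[RHS](@free_combK _ A); congr coord.
rewrite (bigD1 i) //= mxE !eqxx rmorph1 mul1r big1 ?addr0 // => j ji.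
by rewrite mxE (negPf ji) andbF rmorph0 mul0r.
Qed.

(* The ring S \otimes_R A, in coordinates with respect to the S-basis
   1 \otimes e_i. *)
Definition scext_car of {rmorphism R -> S} : Type := 'rV[S]_n.
Local Notation E := (scext_car phi).

HB.instance Definition _ := GRing.Lmodule.copy E 'rV[S]_n.

Definition to_scext (a : A) : E := map_mx phi (coord a).

Definition scext_mul (x y : E) : E :=
  \sum_i \sum_j (x 0 i * y 0 j) *: to_scext (e i * e j).

Lemma to_scextD : {morph to_scext : a b / a + b}.
Proof. by move=> a b; rewrite /to_scext free_coordD map_mxD. Qed.

Lemma to_scextZ r a : to_scext (sc r * a) = phi r *: to_scext a.
Proof. by rewrite /to_scext free_coordZ map_mxZ. Qed.

Lemma to_scext0 : to_scext 0 = 0.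
Proof. by rewrite /to_scext free_coord0 map_mx0. Qed.

Lemma to_scext_sum (I : Type) (r : seq I) (F : I -> A) :
  to_scext (\sum_(i <- r) F i) = \sum_(i <- r) to_scext (F i).
Proof. exact: (big_morph _ to_scextD to_scext0). Qed.

Lemma to_scext_basis i : to_scext (e i) = delta_mx 0 i.
Proof. by rewrite /to_scext free_coord_basis map_delta_mx. Qed.

Lemma scextE (x : E) : x = \sum_i x 0 i *: to_scext (e i).
Proof.
under eq_bigr do rewrite to_scext_basis.
exact: (row_sum_delta (x : 'rV[S]_n)).
Qed.

Lemma scext_mulDl : left_distributive scext_mul +%R.
Proof.
move=> x y z; rewrite /scext_mul -big_split; apply: eq_bigr => i _.
rewrite -big_split; apply: eq_bigr => j _.
by rewrite mxE mulrDl scalerDl.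
Qed.

Lemma scext_mulDr : right_distributive scext_mul +%R.
Proof.
move=> x y z; rewrite /scext_mul -big_split; apply: eq_bigr => i _.
rewrite -big_split; apply: eq_bigr => j _.
by rewrite mxE mulrDr scalerDl.
Qed.

Lemma scext_mulZl s x y : scext_mul (s *: x) y = s *: scext_mul x y.
Proof.
rewrite /scext_mul scaler_sumr; apply: eq_bigr => i _.
rewrite scaler_sumr; apply: eq_bigr => j _.
by rewrite mxE scalerA mulrA.
Qed.

Lemma scext_mulZr s x y : scext_mul x (s *: y) = s *: scext_mul x y.
Proof.
rewrite /scext_mul scaler_sumr; apply: eq_bigr => i _.
rewrite scaler_sumr; apply: eq_bigr => j _.
by rewrite mxE scalerA mulrCA.
Qed.

Lemma scext_mul0l y : scext_mul 0 y = 0.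
Proof. by have := scext_mulZl 0 0 y; rewrite !scale0r. Qed.

Lemma scext_mul0r y : scext_mul y 0 = 0.
Proof. by have := scext_mulZr 0 y 0; rewrite !scale0r. Qed.

Lemma scext_mul_suml (I : Type) (r : seq I) (F : I -> E) y :
  scext_mul (\sum_(i <- r) F i) y = \sum_(i <- r) scext_mul (F i) y.
Proof.
apply: (big_morph (scext_mul^~ y)); last exact: scext_mul0l.
by move=> a b; rewrite scext_mulDl.
Qed.

Lemma scext_mul_sumr (I : Type) (r : seq I) (F : I -> E) y :
  scext_mul y (\sum_(i <- r) F i) = \sum_(i <- r) scext_mul y (F i).
Proof.
apply: (big_morph (scext_mul y)); last exact: scext_mul0r.
by move=> a b; rewrite scext_mulDr.
Qed.

Lemma to_scextM a b : to_scext (a * b) = scext_mul (to_scext a) (to_scext b).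
Proof.
rewrite -{1}(@free_coordK _ A a) -{1}(@free_coordK _ A b) mulr_suml.
rewrite to_scext_sum; apply: eq_bigr => i _.
rewrite mulr_sumr to_scext_sum; apply: eq_bigr => j _.
rewrite !mxE -rmorphM -to_scextZ; congr to_scext.
by rewrite rmorphM -!mulrA; congr (_ * _); rewrite !mulrA alg_central.
Qed.

Lemma scext_mulA : associative scext_mul.
Proof.
have A1 x a b : scext_mul x (scext_mul (to_scext a) (to_scext b))
    = scext_mul (scext_mul x (to_scext a)) (to_scext b).
  rewrite (scextE x) (scext_mul_suml _ _ (to_scext a)).
  rewrite !scext_mul_suml; apply: eq_bigr => i _.
  by rewrite !scext_mulZl -!to_scextM mulrA.
have A2 x y b : scext_mul x (scext_mul y (to_scext b))
    = scext_mul (scext_mul x y) (to_scext b).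
  rewrite (scextE y) [X in scext_mul x X]scext_mul_suml.
  rewrite !(scext_mul_sumr _ _ x) scext_mul_suml.
  by apply: eq_bigr => i _; rewrite scext_mulZl !scext_mulZr scext_mulZl A1.
move=> x y z; rewrite (scextE z) [X in scext_mul x X]scext_mul_sumr.
rewrite !scext_mul_sumr.
by apply: eq_bigr => i _; rewrite !scext_mulZr A2.
Qed.

Lemma scext_mul1l : left_id (to_scext 1) scext_mul.
Proof.
move=> x; rewrite {1}(scextE x) scext_mul_sumr [RHS]scextE.
by apply: eq_bigr => i _; rewrite scext_mulZr -to_scextM mul1r.
Qed.

Lemma scext_mul1r : right_id (to_scext 1) scext_mul.
Proof.
move=> x; rewrite {1}(scextE x) scext_mul_suml [RHS]scextE.
by apply: eq_bigr => i _; rewrite scext_mulZl -to_scextM mulr1.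
Qed.

HB.instance Definition _ := GRing.Zmodule_isPzRing.Build E
  scext_mulA scext_mul1l scext_mul1r scext_mulDl scext_mulDr.

Definition scext_scalar (s : S) : E := s *: (1 : E).

Lemma scext_scalar_is_zmod_morphism : zmod_morphism scext_scalar.
Proof. by move=> s t; rewrite /scext_scalar scalerBl. Qed.

Lemma scext_scalarM s (x : E) : scext_scalar s * x = s *: x.
Proof. by rewrite [LHS]scext_mulZl; congr (_ *: _); exact: scext_mul1l. Qed.

Lemma scext_scalar_is_monoid_morphism : monoid_morphism scext_scalar.
Proof.
split=> [|s t]; first by rewrite /scext_scalar scale1r.
by rewrite scext_scalarM /scext_scalar scalerA.
Qed.

HB.instance Definition _ :=
  GRing.isZmodMorphism.Build S E scext_scalar scext_scalar_is_zmod_morphism.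
HB.instance Definition _ :=
  GRing.isMonoidMorphism.Build S E scext_scalar scext_scalar_is_monoid_morphism.

Lemma scext_central s (x : E) : scext_scalar s * x = x * scext_scalar s.
Proof.
rewrite scext_scalarM [RHS]scext_mulZr; congr (_ *: _).
by rewrite scext_mul1r.
Qed.

Definition scext_algebra : algebra S := Algebra scext_central.

Definition scext_basis i : scext_algebra := to_scext (e i).
Definition scext_coord (x : scext_algebra) : 'rV[S]_n := x.

Lemma scext_coordK x :
  \sum_i alg_scalar scext_algebra (scext_coord x 0 i) * scext_basis i = x.
Proof.
by rewrite [RHS]scextE; apply: eq_bigr => i _; exact: scext_scalarM.
Qed.

Lemma scext_combK (c : 'rV[S]_n) :
  scext_coord (\sum_i alg_scalar scext_algebra (c 0 i) * scext_basis i) = c.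
Proof. exact: (scext_coordK (c : E)). Qed.

Definition scext : freeAlgebra S := FreeAlgebra scext_coordK scext_combK.

End ScalarExtension.

Arguments scext {R S} A phi.
Arguments to_scext {R S} A phi _.

(* A left B-module whose underlying F-module is F^d, viewed as column vectors:
   b acts on v as [rep_act b *m v].  Over a field, every finite-dimensional
   B-module is isomorphic to one of these. *)
Record rep (F : comNzRingType) (B : algebra F) := Rep {
  rep_dim : nat;
  rep_act :> {rmorphism B -> 'M[F]_rep_dim};
  rep_scalar : forall a, rep_act (alg_scalar B a) = a%:M }.

Arguments rep_dim {F B} _.

HB.instance Definition _ (F : comNzRingType) (B : algebra F) :=
  gen_eqMixin (rep B).
HB.instance Definition _ (F : comNzRingType) (B : algebra F) :=
  gen_choiceMixin (rep B).

Definition rep_hom (F : comNzRingType) (B : algebra F) (V W : rep B)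
    (f : 'M[F]_(rep_dim W, rep_dim V)) :=
  forall b, f *m V b = W b *m f.

Definition rep_iso (F : comNzRingType) (B : algebra F) (V W : rep B) :=
  exists (f : 'M[F]_(rep_dim W, rep_dim V)) (g : 'M[F]_(rep_dim V, rep_dim W)),
    [/\ rep_hom f, f *m g = 1%:M & g *m f = 1%:M].

Section RepScext.

Variables (R S : comNzRingType) (A : freeAlgebra R) (phi : {rmorphism R -> S}).
Variables (d : nat) (g : 'I_(free_rank A) -> 'M[S]_d).

Definition scext_lift (x : scext A phi) : 'M[S]_d :=
  \sum_i free_coord (scext A phi) x 0 i *: g i.

Hypothesis g1 : scext_lift (to_scext A phi 1) = 1%:M.
Hypothesis gM : forall i j,
  scext_lift (to_scext A phi (free_basis A i * free_basis A j)) = g i *m g j.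

Lemma scext_lift_is_zmod_morphism : zmod_morphism scext_lift.
Proof.
move=> x y; rewrite /scext_lift -sumrB; apply: eq_bigr => i _.
by rewrite !mxE scalerBl.
Qed.

HB.instance Definition _ :=
  GRing.isZmodMorphism.Build (scext A phi) 'M[S]_d scext_lift
    scext_lift_is_zmod_morphism.

Lemma scext_liftZ s (x : scext_car A phi) :
  scext_lift (s *: x) = s *: scext_lift x.
Proof.
rewrite /scext_lift scaler_sumr; apply: eq_bigr => i _.
by rewrite mxE scalerA.
Qed.

Lemma scext_lift_is_monoid_morphism : monoid_morphism scext_lift.
Proof.
split=> [|x y]; first exact: g1.
rewrite [x * y]/(scext_mul _ _) /scext_mul.
have -> : scext_lift x * scext_lift y
    = \sum_i \sum_j ((x : 'rV_ _) 0 i *: g i) *m ((y : 'rV_ _) 0 j *: g j).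
  by rewrite [LHS]mulmx_suml; apply: eq_bigr => i _; rewrite mulmx_sumr.
rewrite (raddf_sum scext_lift); apply: eq_bigr => i _.
rewrite (raddf_sum scext_lift); apply: eq_bigr => j _.
by rewrite [LHS]scext_liftZ gM -scalemxAl -scalemxAr scalerA.
Qed.

HB.instance Definition _ :=
  GRing.isMonoidMorphism.Build (scext A phi) 'M[S]_d scext_lift
    scext_lift_is_monoid_morphism.

Lemma scext_lift_scalar s : scext_lift (alg_scalar (scext A phi) s) = s%:M.
Proof. by rewrite [LHS]scext_liftZ g1 scale_scalar_mx mulr1. Qed.

Definition scext_rep : rep (scext A phi) := Rep scext_lift_scalar.

End RepScext.

Arguments scext_lift {R S A} phi {d} g x.

Lemma rep_comb (S : comNzRingType) (B : algebra S) (V : rep B) n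
    (c : 'I_n -> S) (b : 'I_n -> B) :
  V (\sum_i alg_scalar B (c i) * b i) = \sum_i c i *: V (b i).
Proof.
rewrite rmorph_sum; apply: eq_bigr => i _.
by rewrite rmorphM rep_scalar [LHS]mul_scalar_mx.
Qed.

Section RepExt.

Variables (R S : comNzRingType) (A : freeAlgebra R) (f : {rmorphism R -> S}).
Variable V : rep A.

Definition rep_ext_gen i : 'M[S]_(rep_dim V) :=
  map_mx f (V (free_basis A i)).

Lemma rep_extE a :
  scext_lift f rep_ext_gen (to_scext A f a) = map_mx f (V a).
Proof.
rewrite -{2}(@free_coordK _ A a) rep_comb map_mx_sum.
by apply: eq_bigr => i _; rewrite map_mxZ mxE.
Qed.

Lemma rep_ext1 : scext_lift f rep_ext_gen (to_scext A f 1) = 1%:M.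
Proof. by rewrite rep_extE rmorph1 map_mx1. Qed.

Lemma rep_extM i j :
  scext_lift f rep_ext_gen (to_scext A f (free_basis A i * free_basis A j))
    = rep_ext_gen i *m rep_ext_gen j.
Proof. by rewrite rep_extE rmorphM map_mxM. Qed.

Definition rep_ext : rep (scext A f) := scext_rep rep_ext1 rep_extM.

End RepExt.

(* T \otimes_S V as a (T \otimes_R A)-module, for an (S \otimes_R A)-module V
   that is free of finite rank over S. *)
Section RepChange.

Variables (R S T : comNzRingType) (A : freeAlgebra R).
Variables (phi : {rmorphism R -> S}) (psi : {rmorphism R -> T}).
Variables (f : {rmorphism S -> T}) (f_phi : forall r, f (phi r) = psi r).
Variable V : rep (scext A phi).

Definition rep_change_gen (i : 'I_(free_rank A)) : 'M[T]_(rep_dim V) :=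
  map_mx f (V (free_basis (scext A phi) i)).

Lemma rep_changeE a :
  scext_lift psi rep_change_gen (to_scext A psi a)
    = map_mx f (V (to_scext A phi a)).
Proof.
rewrite -[in RHS](@free_coordK _ (scext A phi) (to_scext A phi a)).
rewrite rep_comb map_mx_sum.
by apply: eq_bigr => i _; rewrite map_mxZ !mxE f_phi.
Qed.

Lemma rep_change1 : scext_lift psi rep_change_gen (to_scext A psi 1) = 1%:M.
Proof. by rewrite rep_changeE rmorph1 map_mx1. Qed.

Lemma rep_changeM i j :
  scext_lift psi rep_change_gen
      (to_scext A psi (free_basis A i * free_basis A j))
    = rep_change_gen i *m rep_change_gen j.
Proof. by rewrite rep_changeE to_scextM rmorphM map_mxM. Qed.

Definition rep_change : rep (scext A psi) := scext_rep rep_change1 rep_changeM.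

End RepChange.

Section Modules.

Variables (F : fieldType) (B : algebra F).

Definition rep_nonzero (V : rep B) : Prop := (0 < rep_dim V)%N.

Definition rep_simple (V : rep B) : Prop :=
  rep_nonzero V /\
  forall U : {vspace 'cV[F]_(rep_dim V)},
    (forall b u, u \in U -> V b *m u \in U) -> U = 0%VS \/ U = fullv.

Definition rep_exact (V' V V'' : rep B) : Prop :=
  exists (i : 'M[F]_(rep_dim V, rep_dim V'))
         (p : 'M[F]_(rep_dim V'', rep_dim V)),
    [/\ rep_hom i, rep_hom p,
        forall v : 'cV_(rep_dim V'), i *m v = 0 -> v = 0,
        forall w : 'cV_(rep_dim V''), exists v : 'cV_(rep_dim V), p *m v = w
      & forall v : 'cV_(rep_dim V),
          p *m v = 0 <-> exists u : 'cV_(rep_dim V'), i *m u = v].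

(* The subgroup of the free abelian group on all B-modules generated by the
   elements V - V' - V'' for 0 -> V' -> V -> V'' -> 0 exact. *)
Definition G0_rel : {pred {freeg (rep B)}} := fun x =>
  `[< forall P : {freeg (rep B)} -> Prop,
        P 0 -> (forall y z, P y -> P z -> P (y - z)) ->
        (forall V' V V'', rep_exact V' V V'' ->
           P (<< V >> - << V' >> - << V'' >>)) ->
        P x >].

Lemma G0_rel_zmod_closed : zmod_closed G0_rel.
Proof.
split=> [|x y]; first by apply/asboolP => P.
move=> /asboolP Px /asboolP Py; apply/asboolP => P P0 PB PE.
exact: (PB _ _ (Px P P0 PB PE) (Py P P0 PB PE)).
Qed.

HB.instance Definition _ :=
  GRing.isZmodClosed.Build {freeg (rep B)} G0_rel G0_rel_zmod_closed.

Definition G0 : zmodType := Quotient.quot (G0_rel : zmodClosed ({freeg (rep B)} : zmodType)).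

Definition G0_class (V : rep B) : G0 := \pi_G0 << V >>.

Definition constituent (S : rep B) (x : G0) : Prop :=
  rep_simple S /\
  exists (c : int) (s : seq (int * rep B)),
    [/\ c != 0,
        forall t, t \in s -> rep_simple t.2 /\ ~ rep_iso t.2 S
      & x = G0_class S *~ c + \sum_(t <- s) G0_class t.2 *~ t.1].

End Modules.

Definition is_split (F : fieldType) (B : freeAlgebra F) : Prop :=
  forall V : rep B, rep_simple V ->
  forall (L : fieldType) (f : {rmorphism F -> L}), rep_simple (rep_ext f V).

Section ExactChange.

Lemma mx_of_cols (F : fieldType) m n k (M : 'M[F]_(m, n)) (N : 'M[F]_(m, k)) :
  (forall j, exists v : 'cV_n, M *m v = col j N) -> exists X, M *m X = N.
Proof.
move=> /choice [v Mv]; exists (\matrix_(i, j) v j i 0).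
apply/matrixP => i j; have /matrixP/(_ i 0) := Mv j; rewrite !mxE => <-.
by apply: eq_bigr => l _; rewrite mxE.
Qed.

Lemma exact_split (F : fieldType) d' d d''
    (i : 'M[F]_(d, d')) (p : 'M[F]_(d'', d)) :
  (forall v : 'cV_d', i *m v = 0 -> v = 0) ->
  (forall w : 'cV_d'', exists v : 'cV_d, p *m v = w) ->
  (forall v : 'cV_d, p *m v = 0 <-> exists u : 'cV_d', i *m u = v) ->
  exists r s,
    [/\ r *m i = 1%:M, p *m s = 1%:M, p *m i = 0 & i *m r + s *m p = 1%:M].
Proof.
move=> i_inj p_surj ex.
have pi0 : p *m i = 0.
  apply/matrixP => a b; have [_ /(_ _)] := ex (col b i).
  have e0 : exists u : 'cV_d', i *m u = col b i.
    by exists (delta_mx b 0); rewrite colE.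
  by move=> /(_ e0) /matrixP/(_ a 0); rewrite colE mulmxA -colE !mxE.
have [r ri] : exists r, r *m i = 1%:M.
  have /row_freeP [r' Hr'] : row_free i^T.
    apply: inj_row_free => v; rewrite -{1}[v]trmxK -trmx_mul => vi.
    by apply: trmx_inj; rewrite trmx0; apply: i_inj; apply: trmx_inj;
      rewrite vi trmx0.
  by exists r'^T; apply: trmx_inj; rewrite trmx_mul trmxK Hr' trmx1.
have [s ps] : exists s, p *m s = 1%:M.
  by apply: mx_of_cols => j; exact: p_surj.
have [u iu] : exists u, i *m u = 1%:M - s *m p.
  apply: mx_of_cols => j; apply/ex.
  by rewrite colE mulmxA mulmxBr mulmx1 mulmxA ps mul1mx subrr mul0mx.
exists r, (s - i *m r *m s); split=> //.
  by rewrite mulmxBr ps !mulmxA pi0 !mul0mx subr0.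
have H : i *m r *m (1%:M - s *m p) = 1%:M - s *m p.
  by rewrite -iu mulmxA -(mulmxA i) ri mulmx1.
rewrite mulmxBl -(mulmxA (i *m r)) addrCA.
by move: H; rewrite mulmxBr mulmx1 => ->; rewrite addrC subrK.
Qed.

Variables (R : comNzRingType) (k l : fieldType) (A : freeAlgebra R).
Variables (phi : {rmorphism R -> k}) (psi : {rmorphism R -> l}).
Variables (f : {rmorphism k -> l}) (f_phi : forall r, f (phi r) = psi r).

Local Notation change := (rep_change f_phi).

Lemma rep_change_hom (V W : rep (scext A phi)) h :
  rep_hom (V := V) (W := W) h ->
  rep_hom (V := change V) (W := change W) (map_mx f h).
Proof.
move=> hH b; rewrite [_ b]/(scext_lift _ _ _) [X in _ = X *m _]/(scext_lift _ _ _).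
rewrite /scext_lift mulmx_sumr mulmx_suml; apply: eq_bigr => i _.
by rewrite -scalemxAr -scalemxAl -!map_mxM hH.
Qed.

Lemma rep_change_exact (V' V V'' : rep (scext A phi)) :
  rep_exact V' V V'' -> rep_exact (change V') (change V) (change V'').
Proof.
move=> [i [p [iH pH i_inj p_surj ex]]].
have [r [s [ri ps pi0 irsp]]] := exact_split i_inj p_surj ex.
exists (map_mx f i), (map_mx f p); split.
- exact: rep_change_hom.
- exact: rep_change_hom.
- move=> v iv; rewrite -[v]mul1mx -(map_mx1 f) -ri map_mxM -mulmxA iv.
  by rewrite mulmx0.
- by move=> w; exists (map_mx f s *m w); rewrite mulmxA -map_mxM ps map_mx1 mul1mx.
- move=> v; split=> [pv|[u <-]]; last first.
    by rewrite mulmxA -map_mxM pi0 map_mx0 mul0mx.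
  exists (map_mx f r *m v); rewrite -[RHS]mul1mx -(map_mx1 f) -irsp map_mxD.
  by rewrite mulmxDl !map_mxM -!mulmxA pv !mulmx0 addr0.
Qed.

Definition freeg_change (x : {freeg (rep (scext A phi))}) :
    {freeg (rep (scext A psi))} :=
  fglift (fun V => << change V >> : {freeg (rep (scext A psi))}) x.

Lemma freeg_changeB : {morph freeg_change : x y / x - y}.
Proof. exact: lift_is_additive. Qed.

Lemma freeg_changeU V : freeg_change << V >> = << change V >>.
Proof. by rewrite /freeg_change liftU scale1r. Qed.

Lemma freeg_change_rel x : x \in @G0_rel _ (scext A phi) ->
  freeg_change x \in @G0_rel _ (scext A psi).
Proof.
move=> /asboolP relx.
apply: (relx (fun x => freeg_change x \in @G0_rel _ (scext A psi))).
- by rewrite -(subrr 0) freeg_changeB subrr rpred0.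
- by move=> y z Hy Hz; rewrite freeg_changeB rpredB.
- move=> V' V V'' /rep_change_exact Hex.
  rewrite !freeg_changeB !freeg_changeU.
  by apply/asboolP => P P0 PB PE; exact: PE.
Qed.

(* The scalar extension map [V] |-> [l \otimes_k V]; see [G0_change_class]. *)
Definition G0_change (x : G0 (scext A phi)) : G0 (scext A psi) :=
  \pi_(G0 (scext A psi)) (freeg_change (repr x)).

Lemma G0_change_pi x :
  G0_change (\pi_(G0 (scext A phi)) x) = \pi_(G0 (scext A psi)) (freeg_change x).
Proof.
apply/eqP; rewrite /G0_change -Quotient.idealrBE -freeg_changeB.
by apply: freeg_change_rel; rewrite Quotient.idealrBE reprK.
Qed.

Lemma G0_change_is_zmod_morphism : zmod_morphism G0_change.
Proof.
move=> x y; rewrite -[x]reprK -[y]reprK -raddfB !G0_change_pi.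
by rewrite freeg_changeB raddfB.
Qed.

HB.instance Definition _ := GRing.isZmodMorphism.Build
  (G0 (scext A phi)) (G0 (scext A psi)) G0_change G0_change_is_zmod_morphism.

Lemma G0_change_class V : G0_change (G0_class V) = G0_class (change V).
Proof. by rewrite /G0_class G0_change_pi freeg_changeU. Qed.

End ExactChange.

Section ResidueField.

Variables (R : comNzRingType) (p : prime_idealr R).

Definition quot_dom : Type := {ideal_quot p}.

HB.instance Definition _ := GRing.ComNzRing.copy quot_dom {ideal_quot p}.

(* The inverse required by [idomainType] does not exist constructively. *)
Definition quot_unit : {pred quot_dom} := fun x => `[< exists y, y * x = 1 >].

Definition quot_inv (x : quot_dom) : quot_dom :=
  if pselect (exists y, y * x = 1) is left yx then projT1 (cid yx) else x.

Lemma quot_mulVx : {in quot_unit, left_inverse 1 quot_inv *%R}.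
Proof.
move=> x /asboolP ux; rewrite /quot_inv; case: pselect => // yx.
exact: (projT2 (cid yx)).
Qed.

Lemma quot_unitPl (x y : quot_dom) : y * x = 1 -> quot_unit x.
Proof. by move=> yx; apply/asboolP; exists y. Qed.

Lemma quot_invr_out : {in [predC quot_unit], quot_inv =1 id}.
Proof. by move=> x /asboolPn ux; rewrite /quot_inv; case: pselect. Qed.

HB.instance Definition _ := GRing.ComNzRing_hasMulInverse.Build quot_dom
  quot_mulVx quot_unitPl quot_invr_out.

HB.instance Definition _ := GRing.ComUnitRing_isIntegral.Build quot_dom
  (@Quotient.rquot_IdomainAxiom R p).

Definition residue_field : fieldType := {fraction quot_dom}.

Definition quot_pi (r : R) : quot_dom := \pi_({ideal_quot p}) r.

Lemma quot_pi_is_zmod_morphism : zmod_morphism quot_pi.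
Proof. exact: pi_is_zmod_morphism. Qed.

Lemma quot_pi_is_monoid_morphism : monoid_morphism quot_pi.
Proof. exact: pi_is_monoid_morphism. Qed.

HB.instance Definition _ :=
  GRing.isZmodMorphism.Build R quot_dom quot_pi quot_pi_is_zmod_morphism.
HB.instance Definition _ :=
  GRing.isMonoidMorphism.Build R quot_dom quot_pi quot_pi_is_monoid_morphism.

Definition residue : {rmorphism R -> residue_field} :=
  (@tofrac quot_dom \o quot_pi).

Lemma quot_pi_eq0 r : (quot_pi r == 0) = (r \in p).
Proof. by rewrite -[in RHS](subr0 r) Quotient.idealrBE -(rmorph0 quot_pi). Qed.

Lemma residue_eq0 r : (residue r == 0) = (r \in p).
Proof. by rewrite /= tofrac_eq0 quot_pi_eq0. Qed.

End ResidueField.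

Local Notation "x %:F" := (tofrac x).

Section FractionLift.

Variables (D : idomainType) (L : fieldType) (g : {rmorphism D -> L}).
Hypothesis g_eq0 : forall x, g x = 0 -> x = 0.

Definition frac_lift (x : {fraction D}) : L := g (\n_(repr x)) / g (\d_(repr x)).

Lemma fracE (x : {fraction D}) : x = (\n_(repr x))%:F / (\d_(repr x))%:F.
Proof.
have dF : (\d_(repr x))%:F != 0 :> {fraction D} by rewrite tofrac_eq0 denom_ratioP.
apply: (mulIf dF); rewrite divfK // -{1}[x]reprK; unlock tofrac.
rewrite -[LHS]FracField.pi_mul; apply/eqmodP.
rewrite /= FracField.equivfE /FracField.mulf /=.
by rewrite !numden_Ratio ?mulf_neq0 ?denom_ratioP ?oner_eq0 // !mulr1 mulrC.
Qed.

Lemma frac_liftE a b : b != 0 -> frac_lift (a%:F / b%:F) = g a / g b.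
Proof.
move=> b0; have g_neq0 c : c != 0 -> g c != 0.
  by apply: contra_neq; exact: g_eq0.
have d0 := denom_ratioP (repr (a%:F / b%:F)).
apply/eqP; rewrite /frac_lift eqr_div ?g_neq0 // -!rmorphM; apply/eqP.
congr (g _); apply/eqP; rewrite -tofrac_eq !tofracM.
by rewrite -eqr_div ?tofrac_eq0 // -fracE.
Qed.

Lemma frac_ind (x : {fraction D}) : exists a b, b != 0 /\ x = a%:F / b%:F.
Proof.
by exists \n_(repr x), \d_(repr x); rewrite denom_ratioP -fracE.
Qed.

Lemma frac_lift_is_zmod_morphism : zmod_morphism frac_lift.
Proof.
have g_neq0 c : c != 0 -> g c != 0 by apply: contra_neq; exact: g_eq0.
move=> x y; have [a [b [b0 ->]]] := frac_ind x.
have [c [d [d0 ->]]] := frac_ind y.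
have -> : a%:F / b%:F - c%:F / d%:F = (a * d - c * b)%:F / (b * d)%:F.
  by rewrite -mulNr addf_div ?tofrac_eq0 // !(tofracM, tofracB) mulNr.
rewrite !frac_liftE ?mulf_neq0 // rmorphB !rmorphM -[in RHS]mulNr.
by rewrite addf_div ?g_neq0 // mulNr.
Qed.

Lemma frac_lift_is_monoid_morphism : monoid_morphism frac_lift.
Proof.
split=> [|x y].
  have -> : 1 = (1 : D)%:F / (1 : D)%:F by rewrite tofrac1 divr1.
  by rewrite frac_liftE ?oner_eq0 // rmorph1 divr1.
have [a [b [b0 ->]]] := frac_ind x; have [c [d [d0 ->]]] := frac_ind y.
by rewrite mulf_div -!tofracM !frac_liftE ?mulf_neq0 // mulf_div !rmorphM.
Qed.

HB.instance Definition _ := GRing.isZmodMorphism.Build {fraction D} L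
  frac_lift frac_lift_is_zmod_morphism.
HB.instance Definition _ := GRing.isMonoidMorphism.Build {fraction D} L
  frac_lift frac_lift_is_monoid_morphism.

Definition frac_lift_morphism : {rmorphism {fraction D} -> L} := frac_lift.

Lemma frac_lift_tofrac a : frac_lift a%:F = g a.
Proof.
by rewrite -[a%:F]divr1 -tofrac1 frac_liftE ?oner_eq0 // rmorph1 divr1.
Qed.

End FractionLift.

Section ResidueLift.

Variables (R : comNzRingType) (p : prime_idealr R) (L : fieldType).
Variables (f : {rmorphism R -> L}) (f_ker : forall r, f r = 0 <-> r \in p).

Definition quot_lift (x : quot_dom p) : L := f (repr (x : {ideal_quot p})).

Lemma quot_lift_pi r : quot_lift (quot_pi p r) = f r.
Proof.
apply/eqP; rewrite -subr_eq0 -rmorphB; apply/eqP/f_ker.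
by rewrite Quotient.idealrBE reprK.
Qed.

Lemma quot_piK x : quot_pi p (repr (x : {ideal_quot p})) = x.
Proof. exact: reprK. Qed.

Lemma quot_lift_is_zmod_morphism : zmod_morphism quot_lift.
Proof.
move=> x y; rewrite -[x]quot_piK -[y]quot_piK -rmorphB !quot_lift_pi.
exact: rmorphB.
Qed.

Lemma quot_lift_is_monoid_morphism : monoid_morphism quot_lift.
Proof.
split=> [|x y]; first by rewrite -(rmorph1 (quot_pi p)) quot_lift_pi rmorph1.
rewrite -[x]quot_piK -[y]quot_piK -rmorphM !quot_lift_pi; exact: rmorphM.
Qed.

HB.instance Definition _ := GRing.isZmodMorphism.Build (quot_dom p) L
  quot_lift quot_lift_is_zmod_morphism.
HB.instance Definition _ := GRing.isMonoidMorphism.Build (quot_dom p) L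
  quot_lift quot_lift_is_monoid_morphism.

Lemma quot_lift_eq0 x : quot_lift x = 0 -> x = 0.
Proof.
rewrite -[x]quot_piK quot_lift_pi => /f_ker xp.
by apply/eqP; rewrite quot_pi_eq0.
Qed.

(* The embedding k(p) -> L induced by f; see [residue_liftE]. *)
Definition residue_lift : {rmorphism residue_field p -> L} :=
  frac_lift_morphism quot_lift_eq0.

Lemma residue_liftE r : residue_lift (residue p r) = f r.
Proof. by rewrite [LHS](frac_lift_tofrac quot_lift_eq0) [LHS]quot_lift_pi. Qed.

End ResidueLift.

Definition toFrac (R : idomainType) : {rmorphism R -> {fraction R}} :=
  @tofrac R.

Definition normal (R : idomainType) : Prop :=
  forall x : {fraction R}, integralOver (toFrac R) x -> exists r, x = r%:F.

Section Localization.

Variables (R : idomainType) (p : prime_idealr R).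

(* R_p and its maximal ideal, as subsets of the fraction field of R. *)
Definition localization : set {fraction R} :=
  [set x | exists a s, s \notin p /\ x = a%:F / s%:F].

Definition localization_max : set {fraction R} :=
  [set x | exists a s, [/\ a \in p, s \notin p & x = a%:F / s%:F]].

Lemma tofrac_localization r : localization r%:F.
Proof. by exists r, 1; rewrite idealr1 tofrac1 divr1. Qed.

Lemma tofrac_localization_max r : localization_max r%:F <-> r \in p.
Proof.
split=> [[a [s [ap sp rE]]]|rp]; last first.
  by exists r, 1; rewrite idealr1 tofrac1 divr1.
have s0 : s != 0 by apply: contraNneq sp => ->; exact: idealr0.
have : r * s \in p.
  suff -> : r * s = a by [].
  by apply/eqP; rewrite -tofrac_eq tofracM rE divfK ?tofrac_eq0.
by rewrite prime_idealrM (negPf sp) orbF.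
Qed.

End Localization.

Definition zero_ideal (R : idomainType) (p : prime_idealr R) : Prop :=
  forall r, r \in p -> r = 0.

(* A local principal ideal domain with maximal ideal m that is not a field. *)
Definition is_dvr (O : idomainType) (m : prime_idealr O) : Prop :=
  [/\ forall I : idealr O, exists g : O, forall x,
        x \in I <-> exists y, x = y * g,
      forall x, x \in m <-> x \isn't a GRing.unit
    & ~ zero_ideal m].

(* A discrete valuation ring O with fraction field K = {fraction R}, given by
   its embedding in K, whose maximal ideal m lies over that of R_p. *)
Record dvr_over (R : idomainType) (p : prime_idealr R) := DvrOver {
  dvr_ring : idomainType;
  dvr_max : prime_idealr dvr_ring;
  dvrP : is_dvr dvr_max;
  dvr_frac : {rmorphism dvr_ring -> {fraction R}};
  dvr_frac_inj : injective dvr_frac;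
  dvr_frac_field : forall x : {fraction R},
    exists a b, b != 0 /\ x = dvr_frac a / dvr_frac b;
  dvr_incl : {rmorphism R -> dvr_ring};
  dvr_inclE : forall r, dvr_frac (dvr_incl r) = toFrac R r;
  dvr_local : forall x, localization p x -> exists y, dvr_frac y = x;
  dvr_dominates : forall y, localization p (dvr_frac y) ->
    (y \in dvr_max <-> localization_max p (dvr_frac y)) }.

Section DvrResidue.

Variables (R : idomainType) (p : prime_idealr R) (O : dvr_over p).

Definition dvr_residue : {rmorphism dvr_ring O -> residue_field (dvr_max O)} :=
  residue (dvr_max O).

Definition residue_dvr : {rmorphism R -> residue_field (dvr_max O)} :=
  dvr_residue \o dvr_incl O.

Lemma residue_dvr_ker r : residue_dvr r = 0 <-> r \in p.
Proof.
rewrite -(tofrac_localization_max p) -[r%:F](dvr_inclE O) -dvr_dominates.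
  by rewrite -residue_eq0; split=> /eqP.
rewrite dvr_inclE; exact: tofrac_localization.
Qed.

(* k(p) -> k(m) *)
Definition residue_ext :
    {rmorphism residue_field p -> residue_field (dvr_max O)} :=
  residue_lift residue_dvr_ker.

Lemma residue_extE r : residue_ext (residue p r) = residue_dvr r.
Proof. exact: residue_liftE. Qed.

Lemma dvr_residueE r : dvr_residue (dvr_incl O r) = residue_dvr r.
Proof. by []. Qed.

End DvrResidue.

Lemma zero_ideal_ker (R : idomainType) (p : prime_idealr R) :
  zero_ideal p -> forall r, toFrac R r = 0 <-> r \in p.
Proof.
move=> p0 r; split=> [/eqP|/p0 ->]; last exact: rmorph0.
by rewrite tofrac_eq0 => /eqP ->; exact: idealr0.
Qed.

(* k((0)) -> K *)
Definition residue_zero (R : idomainType) (p : prime_idealr R)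
    (p0 : zero_ideal p) : {rmorphism residue_field p -> {fraction R}} :=
  residue_lift (zero_ideal_ker p0).

Lemma residue_zeroE (R : idomainType) (p : prime_idealr R)
  (p0 : zero_ideal p) r : residue_zero p0 (residue p r) = toFrac R r.
Proof. exact: residue_liftE. Qed.

Section Decomposition.

Variables (R : idomainType) (A : freeAlgebra R).

Definition AK : freeAlgebra {fraction R} := scext A (toFrac R).

Variable p : prime_idealr R.

Definition Ares : freeAlgebra (residue_field p) := scext A (residue p).

Definition AO (O : dvr_over p) : freeAlgebra (dvr_ring O) :=
  scext A (dvr_incl O).

Definition AOres (O : dvr_over p) :
    freeAlgebra (residue_field (dvr_max O)) :=
  scext A (residue_dvr O).

Definition dvr_scalar_ext (O : dvr_over p) : G0 Ares -> G0 (AOres O) :=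
  G0_change (@residue_extE _ _ O).

Definition perfect_gate (O : dvr_over p) : Prop :=
  bijective (dvr_scalar_ext O).

(* L is an O-free module with K \otimes_O L isomorphic to V. *)
Definition is_lattice (O : dvr_over p) (L : rep (AO O)) (V : rep AK) : Prop :=
  rep_iso (rep_change (@dvr_inclE _ _ O) L) V.

(* L / m L: the field O / m is its own fraction field, hence equal to
   [residue_field (dvr_max O)]. *)
Definition lattice_reduction (O : dvr_over p) (L : rep (AO O)) :
    rep (AOres O) :=
  rep_change (@dvr_residueE _ _ O) L.

(* For p = 0, d is the identity up to the isomorphism of k(0) with K. *)
Definition is_decomposition_map (d : {additive G0 AK -> G0 Ares}) : Prop :=
  (exists p0 : zero_ideal p, forall V : rep AK,
     G0_change (residue_zeroE p0) (d (G0_class V)) = G0_class V)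
  \/
  (~ zero_ideal p /\ exists2 O : dvr_over p, perfect_gate O &
     forall (V : rep AK) (L : rep (AO O)), is_lattice L V ->
       dvr_scalar_ext O (d (G0_class V)) = G0_class (lattice_reduction L)).

Definition A_loc : set AK :=
  [set x | exists a s, s \notin p /\
     x = alg_scalar AK (s%:F)^-1 * to_scext A (toFrac R) a].

End Decomposition.

Arguments A_loc {R} A p.

Section Blocks.

Variables (B : pzRingType) (P : set B).

(* P is a subring of B; the ring B itself is obtained for P = setT. *)
Definition central_idempotent (c : B) : Prop :=
  [/\ P c, c * c = c & forall x, P x -> c * x = x * c].

Definition block_idempotent (c : B) : Prop :=
  [/\ central_idempotent c, c <> 0
    & forall c1 c2, central_idempotent c1 -> central_idempotent c2 ->
        c1 * c2 = 0 -> c = c1 + c2 -> c1 = 0 \/ c2 = 0].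

End Blocks.

Section Families.

Variables (F : fieldType) (B : algebra F).

Definition rep_belongs (V : rep B) (c : B) : Prop :=
  forall v : 'cV_(rep_dim V), exists w, V c *m w = v.

Definition class_belongs (x : G0 B) (c : B) : Prop :=
  forall S, constituent S x -> rep_belongs S c.

(* For P = setT these are the families of B, for P = A_p the p-families. *)
Definition is_family (P : set B) (X : set (rep B)) : Prop :=
  exists2 c, block_idempotent P c &
    X = [set S | rep_simple S /\ rep_belongs S c].

End Families.

Section BrauerGraph.

Variables (R : idomainType) (A : freeAlgebra R) (p : prime_idealr R).
Variable d : {additive G0 (AK A) -> G0 (Ares A p)}.

Definition decomposition_family (X : set (rep (AK A))) : set (rep (Ares A p)) :=
  [set T | exists2 S, X S & constituent T (d (G0_class S))].

Definition same_family (S T : rep (AK A)) : Prop :=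
  exists X, [/\ is_family setT X, X S & X T].

Definition brauer_edge (S T : rep (AK A)) : Prop :=
  exists S' T' U,
    [/\ same_family S S', same_family T T',
        constituent U (d (G0_class S')) & constituent U (d (G0_class T'))].

(* Vertices are isomorphism classes, so isomorphic modules are identified. *)
Definition brauer_connected : rep (AK A) -> rep (AK A) -> Prop :=
  clos_refl_trans _ (fun S T => rep_iso S T \/ brauer_edge S T).

Definition is_brauer_family (X : set (rep (AK A))) : Prop :=
  exists2 S, rep_simple S &
    X = [set T | rep_simple T /\ brauer_connected S T].

End BrauerGraph.

(* Main.v *)
(* Let O be the valuation ring of the gate (or O = K if p = 0), with residue
   field k. For an element b of an algebra, the number of nonzero eigenvalues of
   b on a module is additive on Grothendieck groups, is preserved by scalar
   extension, and detects constituents. As d(V) and the reduction L/mL of a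
   lattice L of V agree after extending scalars to k, all information on d that
   is needed can be read off from L/mL.

   The crucial criterion for an idempotent c of A^K to lie in A_p is the
   following. Let V0 and V1 be jointly faithful modules on which c acts as 0 and
   1, and suppose that some a in A acts nilpotently on the reduction of V0 and
   that s - a does so on the reduction of V1, where s is not in p. As R is
   normal, the characteristic polynomials of a on V0 and V1 have coefficients in
   R. They are coprime modulo p, hence their resultant r is not in p, and a
   Bezout relation writes r c as a polynomial in a. No henselization is needed.

   Central idempotents w of A(p) lift to A_p: Newton iteration lifts w to
   elements of A^O that are idempotent and central modulo any power of m, and
   the Artin-Rees argument for the commutator map gives a central z in A^O with
   z = w modulo m. As A^K is split, z acts on simple modules by scalars, which
   lie in O and are 0 or 1 modulo m; grouping these scalars gives a central
   idempotent c of A^K, and the criterion, applied with a/s lifting w, shows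
   that c lies in A_p. So the blocks of A_p and of A(p) correspond to each
   other, which gives (a), (b) and (c).

   For (d), a union of Brauer families is cut out by a central idempotent c of
   A^K. The constituents of its reduction are disjoint from those of the
   complement, so an element of A(p) acts as 1 on the former and as 0 on the
   latter. By the criterion, c lies in A_p. *)

From HB Require Import structures.
From Stdlib Require Import Relations.
Require Import Defs.
From mathcomp Require Import all_boot all_algebra.
From mathcomp Require Import boolp classical_sets.
From mathcomp Require Import fieldext ring freeg.

Set Implicit Arguments.
Unset Strict Implicit.
Unset Printing Implicit Defensive.

Import GRing.Theory.

Local Open Scope ring_scope.
Local Open Scope quotient_scope.

(** * Identities for idempotents and scalars *)

Lemma idem_exp (R : pzRingType) (e : R) n : e * e = e -> e ^+ n.+1 = e.
Proof. by move=> ee; elim: n => [|n IH]; rewrite ?expr1 // exprS IH. Qed.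

Lemma idem_compl (S : pzRingType) (e : S) : e * e = e ->
  (1 - e) * (1 - e) = 1 - e.
Proof. by move=> ee; rewrite mulrBl mul1r mulrBr mulr1 ee subrr subr0. Qed.

Lemma idemM (S : pzRingType) (e e' : S) : e * e = e -> e' * e' = e' ->
  e' * e = e * e' ->
  (e * e') * (e * e') = e * e'.
Proof. by move=> ee ee' eC;
  rewrite -mulrA [e' * _]mulrA eC -mulrA ee' mulrA ee. Qed.

Lemma central_compl (B : pzRingType) (e : B) :
  (forall x, e * x = x * e) -> forall x, (1 - e) * x = x * (1 - e).
Proof. by move=> eC x; rewrite mulrBl mulrBr eC mul1r mulr1. Qed.

Lemma alg_scalar_mulA (S : comNzRingType) (B : algebra S) s t (x : B) :
  alg_scalar B (s * t) * x = alg_scalar B s * (alg_scalar B t * x).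
Proof. by rewrite rmorphM mulrA. Qed.

Lemma alg_scalar_mulACA (S : comNzRingType) (B : algebra S) s t (x y : B) :
  alg_scalar B (s * t) * (x * y) = (alg_scalar B s * x) * (alg_scalar B t * y).
Proof.
by rewrite rmorphM -!mulrA; congr (_ * _); rewrite mulrA alg_central -mulrA.
Qed.

Lemma alg_scalar_commutator (S : comNzRingType) (B : algebra S) s (x y : B) :
  alg_scalar B s * x * y - y * (alg_scalar B s * x) =
    alg_scalar B s * (x * y - y * x).
Proof. by rewrite mulrBr !mulrA (alg_central s y). Qed.

(** * Additive invariants of modules *)

Section CoreRank.
Variable F : fieldType.

(* The rank of M^k for large k. Unlike the rank of M, it is additive on
   extensions, hence defined on Grothendieck groups. *)
Definition core_rank n (M : 'M[F]_n) : nat := (n - mup 0 (char_poly M))%N.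

Lemma char_poly_neq0 n (M : 'M[F]_n) : char_poly M != 0.
Proof. exact: monic_neq0 (char_poly_monic M). Qed.

Lemma mup_char_poly_le n (M : 'M[F]_n) : (mup 0 (char_poly M) <= n)%N.
Proof.
have : (mup 0 (char_poly M) <= mup 0 (char_poly M))%N by [].
rewrite mup_geq ?char_poly_neq0 // => /(dvdp_leq (char_poly_neq0 M)).
by rewrite size_exp_XsubC size_char_poly.
Qed.

(** A power of X divides the characteristic polynomial, and both are monic of degree n. *)
Lemma core_rank0_char_poly n (M : 'M[F]_n) :
  core_rank M = 0%N -> char_poly M = 'X^n.
Proof.
move=> /eqP; rewrite subn_eq0 mup_geq ?char_poly_neq0 // subr0 => dv.
apply/esym/eqP; rewrite -eqp_monic ?monicXn ?char_poly_monic //.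
by rewrite -(dvdp_size_eqp dv) size_polyXn size_char_poly.
Qed.

Lemma core_rank_0 n : core_rank (0 : 'M[F]_n) = 0%N.
Proof.
apply/eqP; rewrite subn_eq0 mup_geq ?char_poly_neq0 // subr0.
have -> : char_poly (0 : 'M[F]_n) = 'X^n; last exact: dvdpp.
by rewrite /char_poly /char_poly_mx map_mx0 subr0 det_scalar.
Qed.

(** Written as an explicit sum so that matrices of size 0, which come from zero modules, are
    included. *)
Lemma Cayley_Hamilton_sum (R : comNzRingType) n (M : 'M[R]_n) :
  \sum_(i < size (char_poly M)) (char_poly M)`_i *: M ^+ i = 0.
Proof.
case: n M => [|n] M; first by apply/matrixP => [[]].
rewrite -[RHS](Cayley_Hamilton M) -[char_poly M in RHS]coefK poly_def.
rewrite rmorph_sum; apply: eq_bigr => i _.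
by rewrite -mul_polyC rmorphM rmorphXn /= horner_mx_X horner_mx_C
  -mul_scalar_mx.
Qed.

Lemma core_rank0_nilp n (M : 'M[F]_n) : core_rank M = 0%N -> M ^+ n = 0.
Proof.
move=> /core_rank0_char_poly chM; rewrite -[RHS](Cayley_Hamilton_sum M) chM.
rewrite size_polyXn big_ord_recr /= big1 => [|i _].
  by rewrite coefXn eqxx scale1r add0r.
by rewrite coefXn ltn_eqF ?scale0r.
Qed.

Lemma core_rank_block m n (A : 'M[F]_m) (B : 'M_(m, n)) (D : 'M_n) :
  core_rank (block_mx A B 0 D) = (core_rank A + core_rank D)%N.
Proof.
have -> : core_rank (block_mx A B 0 D) =
    (m + n - (mup 0 (char_poly A) + mup 0 (char_poly D)))%N.
  rewrite /core_rank -mupM ?char_poly_neq0 //; congr (_ - mup _ _)%N.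
  rewrite /char_poly -(det_ublock _ (map_mx polyC (- B))); congr (\det _).
  rewrite /char_poly_mx map_block_mx scalar_mx_block opp_block_mx add_block_mx.
  by rewrite map_mx0 subr0 add0r map_mxN.
(* The subtraction is truncated, so the multiplicities have to be bounded by the sizes. *)
rewrite /core_rank; have := mup_char_poly_le A; have := mup_char_poly_le D.
by move=> le1 le2; rewrite addnBA // addnBAC // subnDA.
Qed.

Lemma char_poly_sim n (M N P Q : 'M[F]_n) :
  P *m Q = 1%:M -> M *m P = P *m N -> char_poly M = char_poly N.
Proof.
move=> PQ MP; pose C := map_mx (@polyC F).
have E : char_poly_mx M *m C _ _ P = C _ _ P *m char_poly_mx N.
  by rewrite mulmxBl mulmxBr -!map_mxM MP scalar_mxC.
have PQd : \det (C _ _ P) * \det (C _ _ Q) = 1.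
  by rewrite -det_mulmx -map_mxM PQ map_mx1 det1.
rewrite /char_poly -[LHS]mulr1 -PQd mulrA -det_mulmx E det_mulmx.
by rewrite mulrAC PQd mul1r.
Qed.

Lemma char_poly_iso m n (M : 'M[F]_m) (N : 'M_n) P Q :
  P *m Q = 1%:M -> Q *m P = 1%:M -> M *m P = P *m N ->
    char_poly M = char_poly N.
Proof.
move=> PQ QP; have mn : m = n.
  by apply/eqP; rewrite eqn_leq (mulmx1_min PQ) (mulmx1_min QP).
by subst n; exact: char_poly_sim PQ.
Qed.

(** In the basis formed by [i] and the section [s], the matrix [M] is block upper triangular with
    diagonal blocks [M'] and [M'']. *)
Lemma core_rank_exact d d' d'' (M : 'M[F]_d) (M' : 'M_d') (M'' : 'M_d'')
    i p r s :
  r *m i = 1%:M -> p *m s = 1%:M -> p *m i = 0 -> i *m r + s *m p = 1%:M ->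
  M *m i = i *m M' -> p *m M = M'' *m p ->
  core_rank M = (core_rank M' + core_rank M'')%N.
Proof.
move=> ri ps pi0 irsp Mi pM.
have rs0 : r *m s = 0.
  have : (i *m r + s *m p) *m s = s by rewrite irsp mul1mx.
  rewrite mulmxDl -(mulmxA s) ps mulmx1 => /(congr1 (fun X => r *m (X - s))).
  by rewrite addrK subrr mulmx0 !mulmxA ri mul1mx.
have PQ : row_mx i s *m col_mx r p = 1%:M by rewrite mul_row_col.
have QP : col_mx r p *m row_mx i s = 1%:M.
  by rewrite mul_col_row ri ps pi0 rs0 -scalar_mx_block.
have dE : d = (d' + d'')%N.
  by apply/eqP; rewrite eqn_leq (mulmx1_min PQ) (mulmx1_min QP).
subst d; rewrite -(core_rank_block M' (r *m M *m s)) /core_rank.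
rewrite (char_poly_sim PQ (N := block_mx M' (r *m M *m s) 0 M'')) //.
rewrite mul_mx_row mul_row_block mulmx0 addr0 Mi -[M *m s]mul1mx -irsp.
by rewrite mulmxDl !mulmxA -(mulmxA s p) pM -!mulmxA ps mulmx1.
Qed.

End CoreRank.

(** The multiplicity of the root 0 is determined by divisibility by powers of X, which is
    insensitive to field extensions. *)
Lemma core_rank_map (F L : fieldType) (f : {rmorphism F -> L}) n (M : 'M[F]_n) :
  core_rank (map_mx f M) = core_rank M.
Proof.
rewrite /core_rank -map_char_poly; congr (_ - _)%N.
have fE k : ('X - 0%:P) ^+ k = map_poly f (('X - 0%:P) ^+ k).
  by rewrite rmorphXn /= map_polyXsubC !rmorph0.
have fn0 : map_poly f (char_poly M) != 0 by rewrite map_poly_eq0 char_poly_neq0.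
apply/eqP; rewrite eqn_leq mup_geq ?char_poly_neq0 // -(dvdp_map f) -fE.
rewrite -mup_geq // leqnn /= mup_geq // fE dvdp_map.
by rewrite -mup_geq ?char_poly_neq0.
Qed.

Section Modules.
Variables (F : fieldType) (B : algebra F).
Implicit Types (V W S T : rep B) (b : B) (x y : G0 B).

Lemma G0_exact V' V V'' : rep_exact V' V V'' ->
  G0_class V = G0_class V' + G0_class V'' :> G0 B.
Proof.
move=> ex; apply/eqP; rewrite -subr_eq0 opprD addrA -!raddfB /=.
rewrite -(raddf0 (\pi_(G0 B))) -Quotient.idealrBE subr0.
by apply/asboolP => P P0 PB PE; exact: PE.
Qed.

Lemma G0_class_sum (D : {freeg (rep B)}) :
  \pi_(G0 B) D = \sum_(V <- dom D) G0_class V *~ coeff V D.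
Proof.
rewrite -{1}(freeg_sumE D) raddf_sum; apply: eq_bigr => V _.
by rewrite -raddfMz /= freegU_mulz intz.
Qed.

Lemma G0_ind (P : G0 B -> Prop) :
  P 0 -> (forall x y, P x -> P y -> P (x - y)) ->
  (forall V, P (G0_class V)) -> forall x, P x.
Proof.
move=> P0 PB PC x; rewrite -[x]reprK.
have PN y : P y -> P (- y) by move=> Py; rewrite -sub0r; exact: PB.
have PD y z : P y -> P z -> P (y + z).
  by move=> Py Pz; rewrite -[z]opprK; apply: PB => //; exact: PN.
have PM y (n : int) : P y -> P (y *~ n).
  move=> Py; have PMn (m : nat) : P (y *+ m).
    by elim: m => [|m IH]; rewrite ?mulr0n // mulrS; exact: PD.
  by case: n => m; rewrite ?NegzE ?mulrNz; [exact: PMn | apply: PN; exact: PMn].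
rewrite G0_class_sum; elim: (dom _) => [|V s IH]; rewrite ?big_nil //.
by rewrite big_cons; apply: PD => //; exact: PM.
Qed.

Lemma rep_exact_core_rank V' V V'' b : rep_exact V' V V'' ->
  core_rank (V b) = (core_rank (V' b) + core_rank (V'' b))%N.
Proof.
move=> [i [p [iH pH i_inj p_surj ex]]].
have [r [s [ri ps pi0 irsp]]] := exact_split i_inj p_surj ex.
by apply: (core_rank_exact ri ps pi0 irsp).
Qed.

(** Computed on a chosen representative in the free group; [G0_core_rank_pi] shows that the choice
    does not matter. The values are integers because classes may be virtual. *)
Definition G0_core_rank b x : int :=
  fglift (fun V => (core_rank (V b))%:Z : int^o) (repr x).

Lemma G0_core_rank_rel b (D : {freeg (rep B)}) : D \in @G0_rel _ B ->
  fglift (fun V => (core_rank (V b))%:Z : int^o) D = 0.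
Proof.
pose g V : int^o := (core_rank (V b))%:Z; move=> /asboolP/(_ (fun D =>
  fglift g D = 0)); apply.
- by rewrite -(subrr 0) lift_is_additive subrr.
- by move=> y z Hy Hz; rewrite lift_is_additive Hy Hz subrr.
- move=> V' V V'' /rep_exact_core_rank ex.
  rewrite !(lift_is_additive g) !liftU !scale1r /g ex PoszD.
  exact: (etrans (esym (addrA _ _ _)) (etrans (congr1 _ (esym (opprD _ _)))
    (subrr _))).
Qed.

Lemma G0_core_rank_pi b (D : {freeg (rep B)}) :
  G0_core_rank b (\pi_(G0 B) D) =
    fglift (fun V => (core_rank (V b))%:Z : int^o) D.
Proof.
pose g V : int^o := (core_rank (V b))%:Z.
apply/eqP; rewrite -subr_eq0 -(lift_is_additive g).
by apply/eqP/G0_core_rank_rel; rewrite Quotient.idealrBE reprK.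
Qed.

Lemma G0_core_rank_is_zmod_morphism b : zmod_morphism (G0_core_rank b).
Proof.
move=> x y; rewrite -[x]reprK -[y]reprK -raddfB !G0_core_rank_pi.
exact: (lift_is_additive (fun V => (core_rank (V b))%:Z : int^o)).
Qed.

HB.instance Definition _ b := GRing.isZmodMorphism.Build (G0 B) int
  (G0_core_rank b) (G0_core_rank_is_zmod_morphism b).

Lemma G0_core_rank_add b x y :
  G0_core_rank b (x + y) = G0_core_rank b x + G0_core_rank b y.
Proof. exact: raddfD. Qed.

Lemma G0_core_rank_sum b (I : Type) (r : seq I) (f : I -> G0 B) :
  G0_core_rank b (\sum_(i <- r) f i) = \sum_(i <- r) G0_core_rank b (f i).
Proof. exact: raddf_sum. Qed.

Lemma G0_core_rank_class b V :
  G0_core_rank b (G0_class V) = (core_rank (V b))%:Z.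
Proof. by rewrite /G0_class G0_core_rank_pi liftU scale1r. Qed.

Lemma rep_iso_sym V W : rep_iso V W -> rep_iso W V.
Proof.
move=> [f [g [fH fg gf]]]; exists g, f; split=> // b.
by rewrite -[W b]mulmx1 -fg (mulmxA (W b)) -fH !mulmxA gf mul1mx.
Qed.

Lemma rep_iso_trans U V W : rep_iso U V -> rep_iso V W -> rep_iso U W.
Proof.
move=> [f [g [fH fg gf]]] [f' [g' [fH' fg' gf']]].
exists (f' *m f), (g *m g'); split.
- by move=> b; rewrite -mulmxA fH !mulmxA fH'.
- by rewrite mulmxA -(mulmxA f') fg mulmx1.
- by rewrite mulmxA -(mulmxA g) gf' mulmx1.
Qed.

(* The zero module is an extension of itself by itself. *)
Lemma G0_class_dim0 V : rep_dim V = 0%N -> G0_class V = 0 :> G0 B.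
Proof.
move=> V0; have colE (u v : 'cV[F]_(rep_dim V)) : u = v.
  by apply/matrixP => -[j jV]; exfalso; move: jV; rewrite V0.
suff /G0_exact /eqP : rep_exact V V V
  by rewrite -subr_eq0 opprD addNKr oppr_eq0 => /eqP.
exists 0, 0; split=> //.
- by move=> b; rewrite mulmx0 mul0mx.
- by move=> b; rewrite mulmx0 mul0mx.
- by move=> w; exists w; exact: colE.
- by move=> v; split=> // _; exists v; exact: colE.
Qed.

Definition zero_act (b : B) : 'M[F]_0 := 0.

Lemma zero_act_is_zmod_morphism : zmod_morphism zero_act.
Proof. by move=> x y; rewrite /zero_act subrr. Qed.

Lemma zero_act_is_monoid_morphism : monoid_morphism zero_act.
Proof. by split=> [|x y]; apply/matrixP => -[]. Qed.

HB.instance Definition _ := GRing.isZmodMorphism.Build B 'M[F]_0 zero_act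
  zero_act_is_zmod_morphism.
HB.instance Definition _ := GRing.isMonoidMorphism.Build B 'M[F]_0 zero_act
  zero_act_is_monoid_morphism.

Lemma zero_act_scalar a : zero_act (alg_scalar B a) = a%:M.
Proof. by apply/matrixP => -[]. Qed.

Definition zero_rep : rep B := Rep zero_act_scalar.

(** An isomorphism is an exact sequence whose third term is the zero module, and the class of that
    module vanishes. *)
Lemma G0_class_iso V W : rep_iso V W -> G0_class V = G0_class W :> G0 B.
Proof.
move=> [f [g [fH fg gf]]].
suff /G0_exact -> : rep_exact V W zero_rep.
  by rewrite [G0_class zero_rep]G0_class_dim0 // addr0.
have colE (u v : 'cV[F]_0) : u = v by apply/matrixP => -[].
exists f, 0; split=> //.
- by move=> b; rewrite mul0mx mulmx0.
- by move=> v fv0; rewrite -[v]mul1mx -gf -mulmxA fv0 mulmx0.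
- by move=> w; exists 0; exact: colE.
- move=> v; split=> [_|_]; last exact: colE.
  by exists (g *m v); rewrite mulmxA fg mul1mx.
Qed.

(** A subspace of maximal dimension inside [Q] exhausts [Q], since otherwise a further line could be
    added to it. *)
Lemma subspace_vspace (vT : vectType F) (Q : vT -> Prop) :
  Q 0 -> (forall a u v, Q u -> Q v -> Q (a *: u + v)) ->
  exists U : {vspace vT}, forall u, u \in U <-> Q u.
Proof.
move=> Q0 QD.
pose sub (U : {vspace vT}) := forall u, u \in U -> Q u.
pose dims n := `[< exists2 U, sub U & \dim U = n >].
have ex : exists n, dims n.
  exists 0%N; apply/asboolP; exists 0%VS; last exact: dimv0.
  by move=> u; rewrite memv0 => /eqP ->.
have ub n : dims n -> (n <= \dim {:vT})%N.
  by move=> /asboolP [U _ <-]; exact/dimvS/subvf.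
have [n /asboolP [U subU dimU] maxU] := ex_maxnP ex ub.
exists U => u; split=> [/subU //|Qu]; apply: contrapT => /negP uU.
have := maxU (\dim (<[u]> + U)%VS); rewrite -dimU.
have /negP : ~~ (\dim (<[u]> + U) <= \dim U)%N.
  apply: contra uU => le; have /eqP E : (U == <[u]> + U)%VS.
    by rewrite eqEdim addvSr.
  by rewrite E; apply: subvP (addvSl _ _) _ (memv_line u).
move=> nle H; apply: nle; apply: H; apply/asboolP; exists (<[u]> + U)%VS => //.
by move=> w /memv_addP [_ /vlineP [a ->] [v /subU Qv ->]]; exact: QD.
Qed.

Lemma simple_stable V (Q : 'cV[F]_(rep_dim V) -> Prop) : rep_simple V ->
  Q 0 -> (forall a u v, Q u -> Q v -> Q (a *: u + v)) ->
  (forall b u, Q u -> Q (V b *m u)) ->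
  (forall u, Q u -> u = 0) \/ (forall u, Q u).
Proof.
move=> [_ sV] Q0 QD QS; have [U UQ] := subspace_vspace Q0 QD.
have [|E|E] := sV U; first by move=> b u /UQ Qu; apply/UQ/QS.
- by left=> u /UQ; rewrite E memv0 => /eqP.
- by right=> u; apply/UQ; rewrite E memvf.
Qed.

Lemma vspace_row_mx d (U : {vspace 'cV[F]_d}) :
  exists N : 'M[F]_(\dim U, d), forall v, (v \in U) = (v^T <= N)%MS.
Proof.
exists (\matrix_j ((vbasis U)`_j)^T) => v.
apply/idP/submxP => [vU|[D vD]].
  exists (\row_j coord (vbasis U) j v); rewrite {1}(coord_vbasis vU).
  rewrite raddf_sum mulmx_sum_row; apply: eq_bigr => j _.
  by rewrite rowK mxE; apply/matrixP => x y; rewrite !mxE.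
have -> : v = \sum_j D 0 j *: (vbasis U)`_j.
  apply: trmx_inj; rewrite vD mulmx_sum_row raddf_sum; apply: eq_bigr => j _.
  by rewrite rowK; apply/matrixP => x y; rewrite !mxE.
by apply: memv_suml => j _; apply/memvZ/vbasis_mem/mem_nth; rewrite size_tuple.
Qed.

Section Compression.
Variables (V : rep B) (k : nat).
Variables (i : 'M[F]_(rep_dim V, k)) (r : 'M[F]_(k, rep_dim V)).
Hypothesis ri : r *m i = 1%:M.
Hypothesis cM : forall b c,
  r *m V b *m i *m (r *m V c *m i) = r *m V (b * c) *m i.

(** The induced action on a submodule with inclusion [i] and linear retraction [r], or on a quotient
    with projection [r] and linear section [i]. In both cases [cM] follows from stability. *)
Definition compress_act (b : B) : 'M[F]_k := r *m V b *m i.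

Lemma compress_act_is_zmod_morphism : zmod_morphism compress_act.
Proof. by move=> x y; rewrite /compress_act raddfB mulmxBr mulmxBl. Qed.

Lemma compress_act_is_monoid_morphism : monoid_morphism compress_act.
Proof.
by split=> [|x y]; [rewrite /compress_act rmorph1 mulmx1|rewrite [RHS]cM].
Qed.

HB.instance Definition _ := GRing.isZmodMorphism.Build B 'M[F]_k compress_act
  compress_act_is_zmod_morphism.
HB.instance Definition _ := GRing.isMonoidMorphism.Build B 'M[F]_k compress_act
  compress_act_is_monoid_morphism.

Lemma compress_act_scalar a : compress_act (alg_scalar B a) = a%:M.
Proof. by rewrite /compress_act rep_scalar scalar_mxC -mulmxA ri mulmx1. Qed.

Definition compress_rep : rep B := Rep compress_act_scalar.

End Compression.

(** A basis of [U] gives the inclusion [i], and the cokernel of its matrix gives the projection [p].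
    A linear splitting of the resulting sequence carries the action over to both ends. *)
Lemma stable_exact V (U : {vspace 'cV[F]_(rep_dim V)}) :
  (forall b u, u \in U -> V b *m u \in U) ->
  exists V' V'' (i : 'M_(rep_dim V, rep_dim V')) (p : 'M_(rep_dim V'',
    rep_dim V)),
    [/\ rep_exact V' V V'' /\ (rep_hom i /\ rep_hom p),
        forall v : 'cV_(rep_dim V'), i *m v = 0 -> v = 0,
        forall w : 'cV_(rep_dim V''), exists v : 'cV_(rep_dim V), p *m v = w,
        forall v : 'cV_(rep_dim V), v \in U <-> p *m v = 0
      & forall v : 'cV_(rep_dim V),
          v \in U <-> exists u : 'cV_(rep_dim V'), i *m u = v].
Proof.
move=> stabU; have [N UN] := vspace_row_mx U.
pose i := (row_base N)^T; pose p := (col_base (cokermx N))^T.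
have Ui v : v \in U <-> exists u : 'cV_(\rank N), i *m u = v.
  rewrite UN -(eq_row_base N); split=> [/submxP [D vD]|[u <-]].
    by exists D^T; apply: trmx_inj; rewrite trmx_mul !trmxK.
  by rewrite trmx_mul trmxK submxMl.
have Up (v : 'cV_(rep_dim V)) : v \in U <-> p *m v = 0.
  rewrite UN submxE -{1}(mulmx_base (cokermx N)) mulmxA.
  have -> : v^T *m col_base (cokermx N) = (p *m v)^T.
    by rewrite trmx_mul trmxK.
  split=> [/eqP E|->]; last by rewrite trmx0 mul0mx.
  apply: trmx_inj; rewrite trmx0.
  by apply: (row_free_inj (row_base_free (cokermx N))); rewrite E mul0mx.
have i_inj (v : 'cV_(\rank N)) : i *m v = 0 -> v = 0.
  move=> iv; apply: trmx_inj; rewrite trmx0.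
  apply: (row_free_inj (row_base_free N)).
  by rewrite mul0mx; apply: trmx_inj; rewrite trmx_mul trmxK trmx0.
have p_surj (w : 'cV_(\rank (cokermx N))) : exists v, p *m v = w.
  exists ((w^T *m pinvmx (col_base (cokermx N)))^T).
  apply: trmx_inj; rewrite trmx_mul !trmxK mulmxKpV //.
  by rewrite submx_full ?col_base_full.
have ex (v : 'cV_(rep_dim V)) :
    p *m v = 0 <-> exists u : 'cV_(\rank N), i *m u = v.
  by split=> [pv|iu]; [apply/Ui/Up | apply/Up/Ui].
have [r [s [ri ps pi0 irsp]]] := exact_split i_inj p_surj ex.
have Vi b : V b *m i = i *m (r *m V b *m i).
  suff pVi : p *m (V b *m i) = 0.
    by rewrite -[LHS]mul1mx -irsp mulmxDl -(mulmxA s) pVi mulmx0 addr0 !mulmxA.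
  apply/matrixP => j l.
  have /Up/matrixP/(_ j 0) : V b *m col l i \in U.
    by apply/stabU/Ui; exists (delta_mx l 0); rewrite colE.
  by rewrite colE !mulmxA -colE mxE => ->; rewrite !mxE.
have pV b : p *m V b = p *m V b *m s *m p.
  rewrite -[LHS]mulmx1 -irsp mulmxDr !mulmxA -(mulmxA p (V b)) Vi.
  by rewrite !mulmxA pi0 !mul0mx add0r.
have ciM b c : r *m V b *m i *m (r *m V c *m i) = r *m V (b * c) *m i.
  by rewrite -(mulmxA _ i) -Vi rmorphM !mulmxA.
have cpM b c : p *m V b *m s *m (p *m V c *m s) = p *m V (b * c) *m s.
  by rewrite !mulmxA -pV rmorphM !mulmxA.
have iH : rep_hom (V := compress_rep ri ciM) (W := V) i.
  by move=> b; rewrite Vi.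
have pH : rep_hom (V := V) (W := compress_rep ps cpM) p.
  by move=> b; rewrite pV.
exists (compress_rep ri ciM), (compress_rep ps cpM), i, p.
by split=> //; split=> //; exists i, p; split.
Qed.

End Modules.

Lemma core_rank1 (F : fieldType) n : core_rank (1%:M : 'M[F]_n) = n.
Proof.
rewrite /core_rank; case: n => [|n]; first by rewrite sub0n.
rewrite mupNroot ?subn0 // -eigenvalue_root_char; apply/eigenvalueP => -[v].
by rewrite mulmx1 scale0r => ->; rewrite eqxx.
Qed.

Lemma eigenvector_exp (F : fieldType) n (M : 'M[F]_n) (v : 'cV_n) k :
  M *m v = v -> (M ^+ k : 'M_n) *m v = v.
Proof.
move=> Mv; elim: k => [|k IH]; first by rewrite expr0 mul1mx.
by rewrite exprS -[_ * _]/(_ *m _) -mulmxA IH.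
Qed.

Lemma core_rank_eigen (F : fieldType) n (M : 'M[F]_n) (v : 'cV_n) :
  M *m v = v -> v != 0 -> core_rank M != 0%N.
Proof.
move=> Mv; apply: contra_neq => /core_rank0_nilp Mn.
by rewrite -(eigenvector_exp n Mv) Mn mul0mx.
Qed.

Lemma core_rank0_idem (F : fieldType) n (M : 'M[F]_n) :
  M *m M = M -> core_rank M = 0%N -> M = 0.
Proof.
case: n M => [|n] M MM /core_rank0_nilp; first by move=> _; apply/matrixP =>
  -[].
by rewrite idem_exp.
Qed.

(** * Simple modules and constituents *)

Section RepAct.
Variables (R : comNzRingType) (B : algebra R).
Implicit Types (V : rep B) (b c : B).

Lemma rep_act1 V : V 1 = 1%:M. Proof. exact: rmorph1. Qed.
Lemma rep_actM V b c : V (b * c) = V b *m V c. Proof. exact: rmorphM. Qed.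
Lemma rep_actD V b c : V (b + c) = V b + V c. Proof. exact: rmorphD. Qed.
Lemma rep_actB V b c : V (b - c) = V b - V c. Proof. exact: rmorphB. Qed.
Lemma rep_act0 V : V 0 = 0. Proof. exact: rmorph0. Qed.

End RepAct.

Section Simple.
Variables (F : fieldType) (B : algebra F).
Implicit Types (V W S T : rep B) (b : B) (x y : G0 B).

Lemma rep_exact_dim V' V V'' : rep_exact V' V V'' ->
  rep_dim V = (rep_dim V' + rep_dim V'')%N.
Proof. by move=> /(rep_exact_core_rank 1); rewrite !rep_act1 !core_rank1. Qed.

Lemma not_simple V : rep_nonzero V -> ~ rep_simple V ->
  exists V' V'', [/\ rep_exact V' V V'', rep_nonzero V', rep_nonzero V'',
    forall b, V b = 0 -> V' b = 0 & forall b, V b = 0 -> V'' b = 0].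
Proof.
move=> nV; rewrite /rep_simple =>
  /not_andP [//|] /existsNP [U] /not_implyP [stU].
move=> /not_orP [U0 U1].
have [V' [V'' [i [p [[ex [iH pH]] i_inj p_surj pU iU]]]]] := stable_exact stU.
have cV0E n (u v : 'cV[F]_n) : n = 0%N -> u = v.
  by move=> n0; apply/matrixP => -[j jV]; exfalso; move: jV; rewrite n0.
exists V', V''; split=> //.
- rewrite /rep_nonzero lt0n; apply: contra_notN U0 => /eqP V0.
  apply/eqP; rewrite -subv0; apply/subvP => u /iU [w <-].
  by rewrite (cV0E _ w 0 V0) mulmx0 mem0v.
- rewrite /rep_nonzero lt0n; apply: contra_notN U1 => /eqP V0.
  apply/eqP; rewrite eqEsubv subvf /=; apply/subvP => u _.
  by apply/pU; exact: cV0E.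
- move=> b Vb; apply/matrixP => j l.
  have := i_inj (V' b *m delta_mx l 0).
  rewrite mulmxA iH Vb !mul0mx -colE => /(_ erefl)/matrixP/(_ j 0).
  by rewrite !mxE.
- move=> b Vb; apply/matrixP => j l.
  have [v pv] := p_surj (delta_mx l 0).
  have : V'' b *m delta_mx l 0 = 0 :> 'cV_(rep_dim V'')
    by rewrite -pv mulmxA -pH Vb mulmx0 mul0mx.
  by rewrite -colE => /matrixP/(_ j 0); rewrite !mxE.
Qed.

(** Induction on the dimension: a proper non-zero submodule is killed by everything that kills
    [V]. *)
Lemma simple_below V : rep_nonzero V ->
  exists2 S, rep_simple S & forall b, V b = 0 -> S b = 0.
Proof.
have [n] := ubnP (rep_dim V); elim: n V => // n IH V; rewrite ltnS => Vn nV.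
have [sV|/(not_simple nV)] := pselect (rep_simple V); first by exists V.
move=> [V' [V'' [/rep_exact_dim dE nV' nV'' V0 _]]].
have [|//|S sS S0] := IH V'.
  by apply: leq_trans Vn; rewrite dE -addn1 leq_add2l.
by exists S => // b /V0/S0.
Qed.

Lemma G0_class_simples V : exists2 s : seq (rep B),
  (forall S, S \in s -> rep_simple S) & G0_class V = \sum_(S <- s) G0_class S.
Proof.
have [n] := ubnP (rep_dim V); elim: n V => // n IH V; rewrite ltnS => Vn.
have [nV|] := boolP (0 < rep_dim V)%N; last first.
  rewrite lt0n negbK => /eqP V0; exists [::] => //.
  by rewrite big_nil G0_class_dim0.
have [sV|/(not_simple nV)] := pselect (rep_simple V).
  exists [:: V]; last by rewrite big_seq1.
  by move=> S; rewrite inE => /eqP ->.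
move=> [V' [V'' [ex nV' nV'' _ _]]]; have dE := rep_exact_dim ex.
have [|s' s's E'] := IH V'.
  by apply: leq_trans Vn; rewrite dE -addn1 leq_add2l.
have [|s'' s''s E] := IH V''.
  by apply: leq_trans Vn; rewrite dE -add1n leq_add2r.
exists (s' ++ s'') => [S|]; last by rewrite big_cat -E -E' (G0_exact ex).
by rewrite mem_cat => /orP [/s's|/s''s].
Qed.

Lemma simple_cyclic S (v w : 'cV_(rep_dim S)) : rep_simple S -> v != 0 ->
  exists b, S b *m v = w.
Proof.
move=> sS v0; pose Q w := exists b, S b *m v = w.
have [||||] := @simple_stable _ _ S Q sS.
- by exists 0; rewrite rep_act0 mul0mx.
- move=> a _ _ [b <-] [c <-]; exists (alg_scalar B a * b + c).
  by rewrite rep_actD rep_actM rep_scalar mul_scalar_mx mulmxDl scalemxAl.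
- by move=> c _ [b <-]; exists (c * b); rewrite rep_actM mulmxA.
- move=> /(_ v); rewrite /Q => Qv; move: v0; rewrite Qv ?eqxx //.
  by exists 1; rewrite rep_act1 mul1mx.
- exact.
Qed.

Lemma Schur S T (f : 'M[F]_(rep_dim T, rep_dim S)) :
  rep_simple S -> rep_simple T -> rep_hom f -> f != 0 -> rep_iso S T.
Proof.
move=> sS sT fH f0.
have [||b u fu|f_inj|f00] := @simple_stable _ _ S (fun u => f *m u = 0) sS.
- by rewrite mulmx0.
- by move=> a u v fu fv; rewrite mulmxDr -scalemxAr fu fv scaler0 addr0.
- by rewrite mulmxA fH -mulmxA fu mulmx0.
- pose Q w := exists u : 'cV_(rep_dim S), f *m u = w.
  have [||b _ [u <-]|Q0|Q1] := @simple_stable _ _ T Q sT.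
  + by exists 0; rewrite mulmx0.
  + move=> a _ _ [u <-] [v <-]; exists (a *: u + v).
    by rewrite mulmxDr -scalemxAr.
  + by exists (S b *m u); rewrite mulmxA fH mulmxA.
  + case/eqP: f0; apply/matrixP => j l.
    have /matrixP/(_ j 0) := Q0 _ (ex_intro _ (delta_mx l 0) erefl).
    by rewrite -colE !mxE.
  + have [g fg] : exists g, f *m g = 1%:M.
      by apply: mx_of_cols => j; exact: Q1.
    exists f, g; split=> //; apply/eqP; rewrite -subr_eq0; apply/eqP/matrixP =>
      j l.
    have /matrixP/(_ j 0) : (g *m f - 1%:M) *m delta_mx l 0 = 0 :> 'cV_(rep_dim
      S).
      by apply: f_inj; rewrite mulmxA mulmxBr mulmxA fg mul1mx mulmx1 subrr
        mul0mx.
    by rewrite -colE !mxE.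
- case/eqP: f0; apply/matrixP => j l.
  by have /matrixP/(_ j 0) := f00 (delta_mx l 0); rewrite -colE !mxE.
Qed.

(* T is a quotient of B, and, as soon as ann(T) is contained in ann(S), of the
   submodule of S^n generated by the basis (e_j) of S. Filtering by the left
   ideals [J k] annihilating e_0, ..., e_(k-1) realizes T as a quotient of S. *)
Lemma simple_ann_iso S T : rep_simple S -> rep_simple T ->
  (forall b, S b = 0 -> T b = 0) -> rep_iso S T.
Proof.
move=> sS sT annST.
have [v v0] : exists v : 'cV[F]_(rep_dim T), v != 0.
  case: sT; case: T {annST} => -[|n] act sc //= _ _.
  exists (const_mx 1); apply/eqP => /matrixP/(_ 0 0); rewrite !mxE.
  by move/eqP; rewrite oner_eq0.
pose J k b := forall j : 'I_(rep_dim S), (j < k)%N ->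
  S b *m delta_mx j 0 = 0 :> 'cV_(rep_dim S).
pose P k := exists2 b, J k b & T b *m v != 0.
have P0 : P 0%N by exists 1 => //; rewrite rep_act1 mul1mx.
have PN k : (rep_dim S <= k)%N -> ~ P k.
  move=> le [b Jb]; rewrite annST ?mul0mx ?eqxx //.
  apply/matrixP => j l; have /matrixP/(_ j 0) :=
    Jb l (leq_trans (ltn_ord l) le).
  by rewrite -colE !mxE.
(* The last stage of the filtration at which some element of [J k] does not kill [v]. *)
have [k [kS Pk PSk]] : exists k, [/\ (k < rep_dim S)%N, P k & ~ P k.+1].
  apply: contrapT => H; apply: (PN (rep_dim S)) => //.
  elim: {-2}(rep_dim S) (leqnn (rep_dim S)) => // k IH kS.
  by apply: contrapT => PSk; apply: H; exists k; split=> //; exact/IH/ltnW.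
pose e := delta_mx (Ordinal kS) 0 : 'cV[F]_(rep_dim S).
have key b : J k b -> S b *m e = 0 -> T b *m v = 0.
  move=> Jb Sbe; apply: contrapT => /eqP Tbv; apply: PSk; exists b => // j.
  rewrite ltnS leq_eqVlt => /orP [/eqP jk|/Jb //].
  by rewrite (_ : j = Ordinal kS) //; exact: val_inj.
have JD a b c : J k b -> J k c -> J k (alg_scalar B a * b + c).
  move=> Jb Jc j jk; rewrite rep_actD rep_actM rep_scalar mul_scalar_mx mulmxDl.
  by rewrite -scalemxAl Jb // Jc // scaler0 addr0.
have JM c b : J k b -> J k (c * b).
  by move=> Jb j jk; rewrite rep_actM -mulmxA Jb // mulmx0.
have J0 : J k 0 by move=> j jk; rewrite rep_act0 mul0mx.
have [||c u [b Jb <-]|Q0|Q1] :=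
    @simple_stable _ _ S (fun u => exists2 b, J k b & S b *m e = u) sS.
- by exists 0 => //; rewrite rep_act0 mul0mx.
- move=> a _ _ [b Jb <-] [c Jc <-]; exists (alg_scalar B a * b + c);
    first exact: JD.
  by rewrite rep_actD rep_actM rep_scalar mul_scalar_mx mulmxDl scalemxAl.
- by exists (c * b); [exact: JM | rewrite rep_actM mulmxA].
- case: Pk => b Jb /eqP []; apply: key => //; apply: Q0; by exists b.
have /choice [bb bbP] : forall l : 'I_(rep_dim S), exists b,
    J k b /\ S b *m e = delta_mx l 0.
  by move=> l; have [b Jb E] := Q1 (delta_mx l 0); exists b.
(* By [key], for b in [J k] the vector [T b *m v] depends only on [S b *m e]. The resulting map is
   [f], given through preimages [bb l] of the unit vectors. *)
pose f := \matrix_(a, l) (T (bb l) *m v) a 0.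
have fE b : J k b -> f *m (S b *m e) = T b *m v.
  move=> Jb; set u := S b *m e.
  pose b' := \sum_l alg_scalar B (u l 0) * bb l.
  have Jb' : J k b'.
    rewrite /b'; elim/big_rec: _ => // l c _ Jc; apply: JD => //.
    by case: (bbP l).
  have Sb' : S b' *m e = u.
    rewrite rep_comb mulmx_suml; apply/matrixP => a c; rewrite ord1 summxE.
    have tE l : (u l 0 *: S (bb l) *m e) a 0 = u l 0 * (a == l)%:R.
      by rewrite -scalemxAl (bbP l).2 !mxE andbT.
    under eq_bigr do rewrite tE.
    rewrite (bigD1 a) //= eqxx mulr1 big1 ?addr0 // => l la.
    by rewrite eq_sym (negPf la) mulr0.
  have -> : T b *m v = T b' *m v.
    apply/eqP; rewrite -subr_eq0 -mulmxBl -rep_actB; apply/eqP/key.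
      rewrite addrC -mulN1r -(rmorph1 (alg_scalar B)) -rmorphN.
      exact: JD.
    by rewrite rep_actB mulmxBl Sb' subrr.
  rewrite rep_comb mulmx_suml; apply/matrixP => a c; rewrite ord1 summxE !mxE.
  by apply: eq_bigr => l _; rewrite -scalemxAl !mxE mulrC.
apply: (@Schur _ _ f) => //; last first.
  case: Pk => b Jb; rewrite -fE //; apply: contra_neq => ->; exact: mul0mx.
move=> c; apply/matrixP => a l.
have [b Jb E] := Q1 (delta_mx l 0).
have : f *m S c *m delta_mx l 0 = T c *m f *m delta_mx l 0 :> 'cV_(rep_dim T).
  rewrite -E -!mulmxA (mulmxA (S c)) -rep_actM !fE //; last exact: JM.
  by rewrite rep_actM mulmxA.
by rewrite -!colE => /matrixP/(_ a 0); rewrite !mxE.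
Qed.

End Simple.

Section Constituents.
Variables (F : fieldType) (B : algebra F).
Implicit Types (V W S T : rep B) (b : B) (x y : G0 B).

Lemma rep_simple_iso S T : rep_iso S T -> rep_simple S -> rep_simple T.
Proof.
move=> [f [g [fH fg gf]]] [S0 sS]; split.
  have dE : rep_dim S = rep_dim T.
    by apply/eqP; rewrite eqn_leq (mulmx1_min gf) (mulmx1_min fg).
  by rewrite /rep_nonzero -dE.
move=> U stU.
pose Q (u : 'cV_(rep_dim S)) := f *m u \in U.
have [||b u|Q0|Q1] := @simple_stable _ _ S Q (conj S0 sS); rewrite /Q.
- by rewrite mulmx0 mem0v.
- by move=> a u v uU vU; rewrite mulmxDr -scalemxAr memvD ?memvZ.
- by rewrite mulmxA fH -mulmxA; exact: stU.
- left; apply/eqP; rewrite -subv0; apply/subvP => u uU.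
  have : g *m u = 0 by apply: Q0; rewrite /Q mulmxA fg mul1mx.
  move=> /(congr1 (mulmx f)); rewrite mulmxA fg mul1mx mulmx0 => ->.
  exact: mem0v.
- right; apply/eqP; rewrite eqEsubv subvf; apply/subvP => u _.
  by have := Q1 (g *m u); rewrite /Q mulmxA fg mul1mx.
Qed.

Lemma simple_central_idem S e : rep_simple S -> e * e = e ->
  (forall b, e * b = b * e) -> S e = 0 \/ S e = 1%:M.
Proof.
move=> sS ee eC; have SeC b : S e *m S b = S b *m S e by rewrite -!rep_actM eC.
have [||b u eu|Q0|Q1] := @simple_stable _ _ S (fun u => S e *m u = 0) sS.
- by rewrite mulmx0.
- by move=> a u v eu ev; rewrite mulmxDr -scalemxAr eu ev scaler0 addr0.
- by rewrite mulmxA SeC -mulmxA eu mulmx0.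
- right; apply/eqP; rewrite -subr_eq0; apply/eqP/matrixP => j l.
  have /matrixP/(_ j 0) : (S e - 1%:M) *m delta_mx l 0 = 0 :> 'cV_(rep_dim S).
    by apply: Q0; rewrite mulmxA mulmxBr mulmx1 -rep_actM ee subrr mul0mx.
  by rewrite -colE !mxE.
- left; apply/matrixP => j l.
  by have /matrixP/(_ j 0) := Q1 (delta_mx l 0); rewrite -colE !mxE.
Qed.

Lemma mx_neq0_col m n (M : 'M[F]_(m, n)) : M <> 0 -> exists v : 'cV_n,
  M *m v != 0.
Proof.
move=> M0; apply: contrapT => /forallNP H; apply: M0; apply/matrixP => j l.
have /negP/negPn/eqP/matrixP/(_ j 0) := H (delta_mx l 0).
by rewrite -colE !mxE.
Qed.

(** By [simple_ann_iso], each T in the list is killed by an element that does not kill [S]. Such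
    elements are multiplied with intermediate factors from [simple_cyclic], which keep the product
    non-zero on [S]; a last factor produces the fixed vector. *)
Lemma simple_sep S (s : seq (rep B)) : rep_simple S ->
  (forall T, T \in s -> rep_simple T /\ ~ rep_iso T S) ->
  exists b (v : 'cV_(rep_dim S)),
    [/\ forall T, T \in s -> T b = 0, S b *m v = v & v != 0].
Proof.
move=> sS sN.
have [b b0 Sb0] : exists2 b, forall T, T \in s -> T b = 0 & S b <> 0.
  elim: s sN => [|T s IH] sN.
    exists 1 => // S1; have := core_rank1 F (rep_dim S).
    rewrite -rep_act1 S1 core_rank_0 => S0.
    by case: sS => [+ _]; rewrite /rep_nonzero -S0.
  have [|b1 b1s Sb1] := IH.
    by move=> T' T's; apply: sN; rewrite inE T's orbT.
  have [sT isoN] := sN T (mem_head _ _).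
  have [b2 Tb2 Sb2] : exists2 b, T b = 0 & S b <> 0.
    apply: contrapT => H; apply: isoN; apply: simple_ann_iso => // b Tb.
    by apply: contrapT => Sb; apply: H; exists b.
  have [v2 Sv2] := mx_neq0_col Sb2; have [v1 Sv1] := mx_neq0_col Sb1.
  have [c cE] := simple_cyclic v1 sS Sv2.
  exists (b1 * c * b2).
    move=> T'; rewrite inE => /orP [/eqP ->|/b1s b1T]; rewrite !rep_actM.
      by rewrite Tb2 mulmx0.
    by rewrite b1T !mul0mx.
  move=> /(congr1 (mulmx^~ v2)) /eqP.
  by rewrite !rep_actM -!mulmxA cE mul0mx (negPf Sv1).
have [v Sv] := mx_neq0_col Sb0.
have [c cE] := simple_cyclic v sS Sv.
exists (c * b), v; split=> [T Ts||].
- by rewrite rep_actM b0 // mulmx0.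
- by rewrite rep_actM -mulmxA cE.
- by apply: contraNneq Sv => ->; rewrite mulmx0.
Qed.

Lemma constituent_iso S T x : rep_iso S T -> constituent S x -> constituent T x.
Proof.
move=> ST [sS [c [s [c0 sP ->]]]]; split; first exact: rep_simple_iso sS.
exists c, s; split=> //; last by rewrite (G0_class_iso ST).
move=> t /sP [st tS]; split=> // tT; apply: tS.
exact: rep_iso_trans tT (rep_iso_sym ST).
Qed.

(** In a shortest expression of [x] by simple classes, no coefficient is zero and no two modules are
    isomorphic, since otherwise a term could be dropped or two terms merged. Hence every module in
    it is a constituent. *)
Lemma constituents_sum x : exists2 s : seq (int * rep B),
  (forall t, t \in s -> constituent t.2 x) &
  x = \sum_(t <- s) G0_class t.2 *~ t.1.
Proof.
pose good (s : seq (int * rep B)) :=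
  (forall t, t \in s -> rep_simple t.2) /\
    x = \sum_(t <- s) G0_class t.2 *~ t.1.
have [s0 gs0] : exists s, good s.
  rewrite /good; elim/G0_ind: x {good} => [|x y [sx [sxP ->]] [sy [syP ->]]|V].
  - by exists [::]; rewrite big_nil.
  - exists (sx ++ [seq (- t.1, t.2) | t <- sy]); split=> [t|].
      by rewrite mem_cat => /orP [/sxP //|/mapP [u /syP] ? ->].
    rewrite big_cat big_map /= -sumrN; congr (_ + _).
    by apply: eq_bigr => t _; rewrite mulrNz.
  - have [s sP ->] := G0_class_simples V.
    exists [seq (1 : int, T) | T <- s]; split=> [t /mapP [T /sP] ? ->//|].
    by rewrite big_map.
pose P n := `[< exists2 s, good s & size s = n >].
have [n /asboolP [s [sP xE] sn] min] :=
  ex_minnP (ex_intro P (size s0) (asboolT (ex_intro2 _ _ s0 gs0 erefl))).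
have smin s' : good s' -> (size s <= size s')%N.
  by move=> gs'; rewrite sn; apply: min; apply/asboolP; exists s'.
exists s => // t ts; split; first exact: sP.
have ps := perm_to_rem ts.
have szr : (size (rem t s) < size s)%N by rewrite (perm_size ps).
have xE' : x = G0_class t.2 *~ t.1 + \sum_(u <- rem t s) G0_class u.2 *~ u.1.
  by rewrite xE (perm_big _ ps) big_cons.
exists t.1, (rem t s); split=> //.
- apply/eqP => t0; have := smin (rem t s); rewrite leqNgt szr => H; apply: notF;
    apply: H.
  split; first by move=> u /mem_rem; exact: sP.
  by rewrite xE' t0 mulr0z add0r.
- move=> u us; split; first by apply: sP; exact: mem_rem us.
  move=> /G0_class_iso ut; have ps' := perm_to_rem us.
  have := smin ((t.1 + u.1, t.2) :: rem u (rem t s)).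
  rewrite leqNgt /= -[X in (X <= _)%N]/(size (u :: rem u (rem t s))).+1.
  rewrite -(perm_size ps') szr => H; apply: notF; apply: H; split.
    move=> w; rewrite inE => /orP [/eqP -> /=|/mem_rem/mem_rem]; last exact: sP.
    exact: sP.
  by rewrite xE' big_cons (perm_big _ ps') big_cons /= mulrzDr ut addrA.
Qed.

Lemma constituent_core_rank b x : G0_core_rank b x <> 0 ->
  exists2 S, constituent S x & core_rank (S b) <> 0%N.
Proof.
have [s sP xE] := constituents_sum x.
move=> nz; apply: contrapT => H; apply: nz; rewrite {1}xE raddf_sum big_seq.
rewrite big1 // => t ts; rewrite raddfMz /= G0_core_rank_class.
suff -> : core_rank (t.2 b) = 0%N by rewrite mul0rz.
by apply: contrapT => nz; apply: H; exists t.2 => //; exact: sP.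
Qed.

(** The element from [simple_sep] kills the other terms of [x], so only the multiple of the class of
    [S] contributes. The factor [c] leaves room for an idempotent acting as the identity on [S]. *)
Lemma constituent_core_rank_sep S x : constituent S x ->
  exists2 b, core_rank (S b) <> 0%N & forall c, S c = 1%:M ->
    G0_core_rank (c * b) x <> 0.
Proof.
move=> [sS [k [s [k0 sP ->]]]].
have [|b [v [bs Sv v0]]] := @simple_sep S [seq t.2 | t <- s] sS.
  by move=> T /mapP [t /sP ? ->].
have cr := core_rank_eigen Sv v0.
exists b => [|c Sc]; first exact/eqP.
rewrite raddfD raddf_sum big_seq big1 ?addr0.
  rewrite raddfMz /= G0_core_rank_class rep_actM Sc mul1mx => /eqP.
  by rewrite mulrz_eq0 (negPf k0) eqz_nat (negPf cr).
move=> t ts; rewrite raddfMz /= G0_core_rank_class rep_actM bs ?map_f //.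
by rewrite mulmx0 core_rank_0 mul0rz.
Qed.

End Constituents.

(** * Regular modules and central idempotents *)

Section Regular.
Variables (S : comNzRingType) (B : freeAlgebra S).
Local Notation n := (free_rank B).
Local Notation coord := (free_coord B).

Definition regular_act (b : B) : 'M[S]_n :=
  \matrix_(i, j) coord (b * free_basis B j) 0 i.

Lemma regular_actE b x : regular_act b *m (coord x)^T = (coord (b * x))^T.
Proof.
rewrite -[x in RHS]free_coordK mulr_sumr free_coord_sum raddf_sum.
apply/matrixP => i j; rewrite ord1 summxE !mxE; apply: eq_bigr => l _.
by rewrite !mxE mulrA -alg_central -mulrA free_coordZ mxE mulrC.
Qed.

Lemma coord_surj (u : 'cV[S]_n) : exists x, u = (coord x)^T.
Proof.
exists (\sum_i alg_scalar B (u^T 0 i) * free_basis B i).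
by rewrite free_combK trmxK.
Qed.

Lemma coord_inj : injective (coord : B -> _).
Proof. by move=> x y E; rewrite -(free_coordK x) -(free_coordK y) E. Qed.

Lemma regular_mxP m (M N : 'M[S]_(m, n)) :
  (forall x, M *m (coord x)^T = N *m (coord x)^T) -> M = N.
Proof.
move=> MN; apply/matrixP => i j; have [x xE] := coord_surj (delta_mx j 0).
have /matrixP/(_ i 0) := MN x; rewrite -xE.
by rewrite -!colE !mxE.
Qed.

Lemma regular_act_is_zmod_morphism : zmod_morphism regular_act.
Proof.
move=> x y; apply: regular_mxP => z;
  rewrite mulmxBl !regular_actE -raddfB mulrBl.
by congr trmx; rewrite -[- (y * z)]mulN1r -(rmorph1 (alg_scalar B)) -rmorphN
  free_coordD free_coordZ scaleN1r.
Qed.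

Lemma regular_act_is_monoid_morphism : monoid_morphism regular_act.
Proof.
split=> [|x y]; apply: regular_mxP => z; first
  by rewrite regular_actE mul1r mul1mx.
by rewrite -mulmxA !regular_actE mulrA.
Qed.

HB.instance Definition _ := GRing.isZmodMorphism.Build B 'M[S]_n regular_act
  regular_act_is_zmod_morphism.
HB.instance Definition _ := GRing.isMonoidMorphism.Build B 'M[S]_n regular_act
  regular_act_is_monoid_morphism.

Lemma regular_act_scalar a : regular_act (alg_scalar B a) = a%:M.
Proof.
apply: regular_mxP => z; rewrite regular_actE free_coordZ mul_scalar_mx.
by apply/matrixP => i j; rewrite !mxE.
Qed.

Definition regular_rep : rep B := Rep regular_act_scalar.

Lemma regular_rep_inj b : regular_rep b = 0 -> b = 0.
Proof.
move=> b0; apply: coord_inj; apply: trmx_inj.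
by rewrite -[b]mulr1 -regular_actE [regular_act b]b0 mul0mx free_coord0 trmx0.
Qed.

End Regular.

(** Chinese remainder argument: if the annihilators of the two lists had a proper sum, a simple
    module below the quotient by it would be killed by both, hence be isomorphic to a member of each
    list by [simple_sep]. *)
Lemma comaximal_constituents (F : fieldType) (B : freeAlgebra F) (s t :
  seq (rep B)) :
  (forall S, S \in s -> rep_simple S) -> (forall T, T \in t -> rep_simple T) ->
  (forall S T, S \in s -> T \in t -> ~ rep_iso S T) ->
  exists x : B, (forall S, S \in s -> S x = 1%:M) /\ (forall T, T \in t ->
    T x = 0).
Proof.
move=> ss st stN; pose R := regular_rep B.
pose ann (s : seq (rep B)) b := forall S, S \in s -> S b = 0.
have annD s' a b c : ann s' b -> ann s' c -> ann s' (alg_scalar B a * b + c).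
  by move=> sb sc S Ss; rewrite rep_actD rep_actM sb // sc // mulmx0 addr0.
have annM s' c b d : ann s' b -> ann s' (c * b * d).
  by move=> sb S Ss; rewrite !rep_actM sb // mulmx0 mul0mx.
pose Q (u : 'cV[F]_(rep_dim R)) := exists b c,
  [/\ ann s b, ann t c & u = (free_coord B (b + c))^T].
have ann0 s' : ann s' 0 by move=> S _; rewrite rep_act0.
have Q0 : Q 0 by exists 0, 0; split; rewrite // addr0 free_coord0 trmx0.
have [|U UQ] := subspace_vspace Q0.
  move=> a _ _ [b [c [bs ct ->]]] [b' [c' [bs' ct' ->]]].
  exists (alg_scalar B a * b + b'), (alg_scalar B a * c + c'); split.
  - exact: annD.
  - exact: annD.
  - rewrite [in RHS]addrACA -[in RHS]mulrDr [in RHS]free_coordD [in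
      RHS]free_coordZ.
    by apply/matrixP => i j; rewrite !mxE.
have stU b u : u \in U -> R b *m u \in U.
  move=> /UQ [c [d [cs dt ->]]]; apply/UQ; exists (b * c), (b * d); split.
  - by rewrite -[b * c]mulr1; exact: annM.
  - by rewrite -[b * d]mulr1; exact: annM.
  - by rewrite regular_actE mulrDr.
have [/UQ [b [c [bs ct E]]]|U1] := boolP ((free_coord B 1)^T \in U).
  have bc : b + c = 1 by apply: (@coord_inj _ B); apply: trmx_inj; rewrite -E.
  exists c; split=> // S Ss.
  by rewrite -rep_act1 -bc rep_actD bs // add0r.
have [V' [V'' [i [p [[_ [_ pH]] _ p_surj Up _]]]]] := stable_exact stU.
have nV : rep_nonzero V''.
  rewrite /rep_nonzero lt0n; apply: contra U1 => /eqP V0; apply/Up.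
  by apply/matrixP => -[j jV]; exfalso; move: jV; rewrite V0.
have V''0 b : ann s b \/ ann t b -> V'' b = 0.
  move=> annb; apply: contrapT => /mx_neq0_col [w /eqP]; apply.
  have [v <-] := p_surj w; rewrite mulmxA -pH -mulmxA; apply/Up/UQ.
  have [x ->] := coord_surj v; case: annb => annb.
  - exists (b * x), 0; split=> //; last by rewrite regular_actE addr0.
    by rewrite -[b]mul1r; exact: annM.
  - exists 0, (b * x); split=> //; last by rewrite regular_actE add0r.
    by rewrite -[b]mul1r; exact: annM.
have [W sW W0] := simple_below nV.
have isoW s' : (forall S, S \in s' -> rep_simple S) ->
    (forall b, ann s' b -> V'' b = 0) -> exists2 S, S \in s' & rep_iso S W.
  move=> ss' s'V; apply: contrapT => H.
  have [S Ss|b [v [bs Wb v0]]] := @simple_sep _ _ W s' sW.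
    by split; [exact: ss' | move=> SW; apply: H; exists S].
  by move: v0; rewrite -Wb W0 ?mul0mx ?eqxx //; apply: s'V.
have [b sb|S Ss SW] := isoW s ss; first by apply: V''0; left.
have [b tb|T Tt TW] := isoW t st; first by apply: V''0; right.
by case: (stN S T Ss Tt); exact: rep_iso_trans SW (rep_iso_sym TW).
Qed.

(** [V1] is the submodule cB of the regular module and [V0] the quotient by it. If b kills both,
    then bc = 0 and cb = b, so b = 0 as c is central. *)
Lemma central_idem_split (F : fieldType) (B : freeAlgebra F) (c : B) :
  c * c = c -> (forall b, c * b = b * c) ->
  exists V0 V1 : rep B, [/\ V0 c = 0, V1 c = 1%:M,
    forall b, V0 b = 0 -> V1 b = 0 -> b = 0
    & G0_class (regular_rep B) = G0_class V1 + G0_class V0].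
Proof.
move=> cc cC; pose R := regular_rep B.
have [||U UE] := @subspace_vspace F _ (fun u : 'cV[F]_(rep_dim R) =>
  R c *m u = u).
- by rewrite mulmx0.
- by move=> a u v uc vc; rewrite mulmxDr -scalemxAr uc vc.
have [|V1 [V0 [i [p [[ex [iH pH]] i_inj p_surj Up Ui]]]]] :=
  @stable_exact _ _ R U.
  by move=> b u /UE uc; apply/UE;
    rewrite mulmxA -rep_actM cC rep_actM -mulmxA uc.
exists V0, V1; split.
- apply: contrapT => /mx_neq0_col [w /eqP]; apply; have [v <-] := p_surj w.
  rewrite mulmxA -pH -mulmxA; apply/Up/UE.
  by rewrite mulmxA -rep_actM cc.
- apply/eqP; rewrite -subr_eq0; apply/eqP; apply: contrapT =>
    /mx_neq0_col [w /eqP]; apply.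
  apply: i_inj; rewrite mulmxA mulmxBr mulmx1 iH mulmxBl.
  have /UE E : i *m w \in U by apply/Ui; exists w.
  by rewrite -mulmxA E subrr.
- move=> b V0b V1b.
  have bc : b * c = 0.
    apply: regular_rep_inj; apply: regular_mxP => x;
      rewrite mul0mx rep_actM -mulmxA.
    have /Ui [w <-] : R c *m (free_coord B x)^T \in U.
      by apply/UE; rewrite mulmxA -rep_actM cc.
    by rewrite mulmxA -iH V1b mulmx0 mul0mx.
  rewrite -bc -cC; apply/eqP; rewrite eq_sym -subr_eq0; apply/eqP.
  apply: regular_rep_inj; apply: regular_mxP => x;
    rewrite mul0mx rep_actB mulmxBl.
  have /UE E : R b *m (free_coord B x)^T \in U.
    by apply/Up; rewrite mulmxA pH V0b !mul0mx.
  by rewrite rep_actM -mulmxA E subrr.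
- exact: G0_exact ex.
Qed.

Lemma rep_belongs_idem (F : fieldType) (B : algebra F) (V : rep B) c :
  c * c = c ->
  rep_belongs V c <-> V c = 1%:M.
Proof.
move=> cc; split=> [Vc|Vc v]; last by exists v; rewrite Vc mul1mx.
apply/matrixP => i j; have [v vE] := Vc (delta_mx j 0).
have : V c *m delta_mx j 0 = delta_mx j 0 :> 'cV_(rep_dim V).
  by rewrite -vE mulmxA -rep_actM cc.
by rewrite -colE => /matrixP/(_ i 0); rewrite !mxE andbT.
Qed.

Lemma setT_center (F : fieldType) (B : algebra F) (c : B) :
  (forall x, [set: B]%classic x -> c * x = x * c) -> forall x, c * x = x * c.
Proof. by move=> cC x; exact: cC. Qed.

(** The element c is the sum of the orthogonal central idempotents ce and c(1 - e), and primitivity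
    applies. *)
Lemma block_prim (F : fieldType) (B : algebra F) (Q : set B) c e :
  block_idempotent Q c -> e * e = e -> (forall x, e * x = x * e) ->
  (forall x, Q x -> Q (c * e) /\ Q (c * (1 - e))) ->
  c * e = 0 \/ c * e = c.
Proof.
move=> [[Qc cc cC] _ prim] ee eC QM; have [Qce Qce'] := QM c Qc.
have ci h : h * h = h -> (forall x, h * x = x * h) -> Q (c * h) ->
  central_idempotent Q (c * h).
  move=> hh hC Qch; split=> // [|x Qx]; first by apply: idemM.
  by rewrite -mulrA hC !mulrA cC.
have [||ce|ce] := prim (c * e) (c * (1 - e)) (ci e ee eC Qce)
    (ci _ (idem_compl ee) (central_compl eC) Qce').
- by rewrite mulrA -(mulrA c) eC -!mulrA mulrBr mulr1 ee subrr !mulr0.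
- by rewrite -mulrDr addrC subrK mulr1.
- by left.
- by right; apply/esym/eqP; rewrite -subr_eq0 -{1}[c]mulr1 -mulrBr ce.
Qed.

Section BlockExistence.
Variables (F : fieldType) (B : freeAlgebra F) (P : set B).
(** Satisfied by the full ring and also by A_p, which contains a K-basis of A^K. *)
Hypothesis P_center : forall c, (forall x, P x -> c * x = x * c) -> forall x,
  c * x = x * c.

(* By the bound on the ranks, e' has the same row space as e, so it factors
   through e, which kills b. *)
Lemma rank_orthogonal (e e' b : B) : e * e' = e -> e' * b = b -> e * b = 0 ->
  (\rank (regular_rep B e') <= \rank (regular_rep B e))%N -> b = 0.
Proof.
move=> ee' e'b eb le.
have sub : (regular_rep B e <= regular_rep B e')%MS.
  by rewrite -{1}ee' rep_actM submxMl.
have : (regular_rep B e' <= regular_rep B e)%MS.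
  by rewrite -(mxrank_leqif_sup sub).2 eqn_leq le mxrankS.
move=> /submxP [D DE]; apply: regular_rep_inj.
by rewrite -e'b rep_actM DE -mulmxA -rep_actM eb rep_act0 mulmx0.
Qed.

Lemma simple_idem_neq (S : rep B) : rep_simple S -> (0 :
  'M[F]_(rep_dim S)) <> 1%:M.
Proof.
move=> [S0 _] E; have := core_rank1 F (rep_dim S); rewrite -E core_rank_0 =>
  S00.
by move: S0; rewrite /rep_nonzero -S00.
Qed.

(** Among the central idempotents in [P] acting as the identity on [S], one of minimal rank on the
    regular module is primitive: in an orthogonal decomposition one summand acts as the identity on
    [S], and minimality makes the other vanish. *)
Lemma block_of_simple (S : rep B) : rep_simple S -> P 1 ->
  exists2 c, block_idempotent P c & S c = 1%:M.
Proof.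
move=> sS P1.
pose Q m := `[< exists c, [/\ central_idempotent P c, S c = 1%:M
  & \rank (regular_rep B c) = m] >].
have exQ : exists m, Q m.
  exists (\rank (regular_rep B 1)); apply/asboolP; exists 1; split=> //.
    by split=> [//||x _]; rewrite mulr1 ?mul1r.
  exact: rep_act1.
have [m /asboolP [c [[Pc cc cC] Sc <-]] min] := ex_minnP exQ.
exists c => //; split=> //.
  by move=> c0; apply: (simple_idem_neq sS); rewrite -Sc c0 rep_act0.
have key c1 c2 : central_idempotent P c1 -> central_idempotent P c2 ->
    c1 * c2 = 0 -> c = c1 + c2 -> S c1 = 1%:M -> c2 = 0.
  move=> [Pc1 cc1 cC1] [Pc2 cc2 cC2] c12 cE Sc1.
  apply: (@rank_orthogonal c1 c c2) => //.
  - by rewrite cE mulrDr cc1 c12 addr0.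
  - by rewrite cE mulrDl cc2 c12 add0r.
  - by apply: min; apply/asboolP; exists c1.
move=> c1 c2 ci1 ci2 c12 cE.
have [Pc1 cc1 /P_center cC1] := ci1.
have [Sc1|Sc1] := simple_central_idem sS cc1 cC1.
  left; apply: (key c2 c1) => //; rewrite -?cC1 // 1?addrC //.
  by move: Sc; rewrite cE rep_actD Sc1 add0r.
by right; exact: key Sc1.
Qed.

(** Otherwise c would be zero on all composition factors of the regular module, hence have core rank
    0 there. *)
Lemma simple_of_idem c : c * c = c -> (forall x, c * x = x * c) -> c <> 0 ->
  exists2 S : rep B, rep_simple S & S c = 1%:M.
Proof.
move=> cc cC c0; have [s sS sE] := G0_class_simples (regular_rep B).
apply: contrapT => H; apply: c0; apply: regular_rep_inj; apply: core_rank0_idem.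
  by rewrite -rep_actM cc.
have := congr1 (G0_core_rank c) sE.
rewrite G0_core_rank_class G0_core_rank_sum big_seq big1 => [[]//|S Ss].
rewrite G0_core_rank_class; have [->|Sc] := simple_central_idem (sS S Ss) cc cC.
  by rewrite core_rank_0.
by case: H; exists S; first exact: sS.
Qed.

End BlockExistence.

(** Core ranks of modules are non-negative, so a vanishing sum forces each of them to vanish, and an
    idempotent of core rank 0 is zero. *)
Lemma G0_sum_act0 (F : fieldType) (B : algebra F) (V : rep B) (s :
  seq (rep B)) e :
  G0_class V = \sum_(S <- s) G0_class S -> e * e = e -> V e = 0 ->
  forall S, S \in s -> S e = 0.
Proof.
move=> sE ee Ve S Ss; apply: core_rank0_idem; first by rewrite -rep_actM ee.
have := congr1 (G0_core_rank e) sE.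
rewrite G0_core_rank_class G0_core_rank_sum Ve core_rank_0 (big_rem S Ss) /=.
rewrite G0_core_rank_class.
under eq_bigr do rewrite G0_core_rank_class.
rewrite -(big_morph Posz PoszD (erefl _)) -PoszD => -[] /esym/eqP.
by rewrite addn_eq0 => /andP [/eqP].
Qed.

(** * Scalar extension and polynomials in an element *)

Section ToScext.
Variables (R S : comNzRingType) (A : freeAlgebra R) (phi : {rmorphism R -> S}).

Lemma to_scext_is_zmod_morphism : zmod_morphism (to_scext A phi).
Proof.
move=> x y; apply/eqP; rewrite eq_sym subr_eq -to_scextD subrK; exact/eqP.
Qed.

Lemma to_scext_is_monoid_morphism : monoid_morphism (to_scext A phi).
Proof. by split=> // x y; exact: to_scextM. Qed.

HB.instance Definition _ := GRing.isZmodMorphism.Build A (scext_car A phi)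
  (to_scext A phi) to_scext_is_zmod_morphism.
HB.instance Definition _ := GRing.isMonoidMorphism.Build A (scext_car A phi)
  (to_scext A phi) to_scext_is_monoid_morphism.

Lemma scext_scaleE s (x : scext_car A phi) :
  alg_scalar (scext A phi) s * x = s *: x.
Proof. exact: scext_scalarM. Qed.

Lemma to_scext_scalar r :
  to_scext A phi (alg_scalar A r) = alg_scalar (scext A phi) (phi r).
Proof. rewrite -[alg_scalar A r]mulr1; exact: to_scextZ. Qed.

Lemma scext_mulE (x y : scext_car A phi) : x * y = scext_mul x y.
Proof. by []. Qed.
End ToScext.

Section ScextMap.
Variables (R S T : comNzRingType) (A : freeAlgebra R).
Variables (phi : {rmorphism R -> S}) (psi : {rmorphism R -> T}).
Variables (f : {rmorphism S -> T}) (f_phi : forall r, f (phi r) = psi r).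

Definition scext_map of (forall r, f (phi r) = psi r) :=
  fun x : scext A phi => map_mx f x : scext A psi.
Local Notation smap := (scext_map f_phi).

Lemma scext_map_to_scext a : smap (to_scext A phi a) = to_scext A psi a.
Proof. by apply/matrixP => i j; rewrite !mxE f_phi. Qed.

Lemma scext_map_is_zmod_morphism : zmod_morphism smap.
Proof. by move=> x y; exact: map_mxB. Qed.

Lemma scext_map_is_monoid_morphism : monoid_morphism smap.
Proof.
split=> [|x y]; first exact: scext_map_to_scext.
rewrite !scext_mulE /scext_mul /scext_map map_mx_sum; apply: eq_bigr => i _.
rewrite map_mx_sum; apply: eq_bigr => j _.
by rewrite map_mxZ rmorphM !mxE -scext_map_to_scext.
Qed.

HB.instance Definition _ :=
  GRing.isZmodMorphism.Build (scext A phi) (scext A psi)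
  smap scext_map_is_zmod_morphism.
HB.instance Definition _ :=
  GRing.isMonoidMorphism.Build (scext A phi) (scext A psi)
  smap scext_map_is_monoid_morphism.

Lemma scext_map_scalar s :
  smap (alg_scalar (scext A phi) s) = alg_scalar (scext A psi) (f s).
Proof.
rewrite [alg_scalar _ s]/(s *: _) /scext_map map_mxZ.
by rewrite -[map_mx f _]/(smap (to_scext A phi 1)) scext_map_to_scext.
Qed.

Lemma scext_mapM x y : smap (x * y) = smap x * smap y.
Proof. exact: rmorphM. Qed.

Lemma scext_mapB x y : smap (x - y) = smap x - smap y.
Proof. exact: rmorphB. Qed.

Lemma scext_map1 : smap 1 = 1.
Proof. exact: rmorph1. Qed.

Lemma scext_map_scale s x :
  smap (alg_scalar (scext A phi) s * x) = alg_scalar (scext A psi) (f s) * smap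
  x.
Proof. by rewrite -scext_map_scalar [LHS]rmorphM. Qed.

Lemma rep_change_map (V : rep (scext A phi)) x :
  rep_change f_phi V (smap x) = map_mx f (V x).
Proof.
rewrite -[x in RHS](@free_coordK _ (scext A phi)) rep_comb map_mx_sum.
by apply: eq_bigr => i _; rewrite map_mxZ !mxE.
Qed.

End ScextMap.
Arguments scext_map {R S T} A {phi psi f}.

Section PolyEval.
Variables (R : comNzRingType) (B : algebra R).
Implicit Types (x : B) (p q : {poly R}).
Local Notation sc := (alg_scalar B).

(** Evaluation through [alg_scalar], which makes sense in a zero algebra too, in particular for
    matrices of size 0. *)
Definition peval x p : B := \sum_(i < size p) sc p`_i * x ^+ i.

Lemma peval_wide x p m : (size p <= m)%N ->
  peval x p = \sum_(i < m) sc p`_i * x ^+ i.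
Proof.
move=> pm; rewrite /peval (big_ord_widen _ (fun i =>
  sc p`_i * x ^+ i) pm) big_mkcond.
apply: eq_bigr => i _; case: ifPn => //.
by rewrite -leqNgt => /leq_sizeP -> //; rewrite rmorph0 mul0r.
Qed.

Lemma pevalD x p q : peval x (p + q) = peval x p + peval x q.
Proof.
pose m := maxn (size p) (size q).
rewrite !(@peval_wide x _ m) ?leq_maxl ?leq_maxr ?size_polyD // -big_split.
by apply: eq_bigr => i _; rewrite coefD rmorphD mulrDl.
Qed.

Lemma pevalC x c : peval x c%:P = sc c.
Proof.
by rewrite (@peval_wide x _ 1) ?size_polyC_leq1 // big_ord1 coefC eqxx expr0
  mulr1.
Qed.

Lemma pevalMX x p : peval x (p * 'X) = peval x p * x.
Proof.
rewrite (@peval_wide x _ (size p).+1); last first.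
  by rewrite (leq_trans (size_polyMleq _ _)) // size_polyX addn2.
rewrite big_ord_recl coefMX rmorph0 mul0r add0r mulr_suml.
by apply: eq_bigr => i _; rewrite coefMX /= exprSr mulrA.
Qed.

Lemma pevalCM x c p : peval x (c%:P * p) = sc c * peval x p.
Proof.
rewrite (@peval_wide x _ (size p)); last first.
  by rewrite mul_polyC size_scale_leq.
rewrite mulr_sumr; apply: eq_bigr => i _.
by rewrite coefCM rmorphM mulrA.
Qed.

Lemma peval0 x : peval x 0 = 0.
Proof. by rewrite -polyC0 pevalC rmorph0. Qed.

Lemma pevalX x : peval x 'X = x.
Proof. by rewrite -['X]mul1r pevalMX -polyC1 pevalC rmorph1 mul1r. Qed.

Lemma pevalM x p q : peval x (p * q) = peval x p * peval x q.
Proof.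
elim/poly_ind: p q => [|p c IH] q; first by rewrite mul0r peval0 mul0r.
have xq : x * peval x q = peval x q * x.
  rewrite /peval mulr_sumr mulr_suml; apply: eq_bigr => i _.
  by rewrite mulrA -alg_central -!mulrA -exprS -exprSr.
rewrite mulrDl pevalD pevalD pevalMX pevalC pevalCM mulrDl; congr (_ + _).
by rewrite -mulrA (mulrC 'X) mulrA pevalMX IH -!mulrA xq.
Qed.

Lemma pevalN x p : peval x (- p) = - peval x p.
Proof. by apply/eqP; rewrite -addr_eq0 -pevalD addNr peval0. Qed.

Lemma pevalB x p q : peval x (p - q) = peval x p - peval x q.
Proof. by rewrite pevalD pevalN. Qed.

Lemma peval1 x : peval x 1 = 1.
Proof. by rewrite -polyC1 pevalC rmorph1. Qed.

Lemma peval_exp x p n : peval x (p ^+ n) = peval x p ^+ n.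
Proof. by elim: n => [|n IH]; rewrite ?peval1 // !exprS pevalM IH. Qed.

Lemma peval_comm x y p : y * x = x * y -> y * peval x p = peval x p * y.
Proof.
move=> xy; rewrite /peval mulr_sumr mulr_suml; apply: eq_bigr => i _.
rewrite mulrA -alg_central -!mulrA; congr (_ * _).
exact: (commrX i (xy : GRing.comm y x)).
Qed.

End PolyEval.

Lemma peval_morph (R S : comNzRingType) (B : algebra R) (C : algebra S)
    (f : {rmorphism R -> S}) (g : {rmorphism B -> C}) x p :
  (forall r, g (alg_scalar B r) = alg_scalar C (f r)) ->
  g (peval x p) = peval (g x) (map_poly f p).
Proof.
move=> gsc; rewrite [in RHS](@peval_wide _ _ _ _ (size p)) ?size_poly //.
rewrite rmorph_sum; apply: eq_bigr => i _.
by rewrite rmorphM rmorphXn gsc coef_map.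
Qed.

Lemma scalar_mx_central (R : comNzRingType) d (r : R) (M : 'M[R]_d) :
  r%:M * M = M * r%:M.
Proof. exact: esym (scalar_mxC _ _). Qed.

Definition mx_algebra (R : comNzRingType) d : algebra R :=
  @Algebra R 'M[R]_d (@scalar_mx R d) (@scalar_mx_central R d).

Lemma rep_peval (R : comNzRingType) (B : algebra R) (V : rep B) x p :
  V (peval x p) = peval (V x : mx_algebra R (rep_dim V)) p.
Proof.
rewrite (peval_morph (C := mx_algebra R (rep_dim V)) (f := idfun)).
  by rewrite map_poly_id.
exact: rep_scalar.
Qed.

Lemma peval_char_poly (R : comNzRingType) d (M : mx_algebra R d) :
  peval M (char_poly M) = 0.
Proof.
rewrite -[RHS](Cayley_Hamilton_sum M); apply: eq_bigr => i _.
exact: mul_scalar_mx.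
Qed.

Lemma mx_idem_nilp (F : fieldType) m (M : mx_algebra F m) n :
  M * M = M -> M ^+ n = 0 -> M = 0.
Proof.
case: n => [|n] MM; last by rewrite idem_exp.
by rewrite expr0 => M1; rewrite -[M]mulr1 M1 mulr0.
Qed.

(** Induction on the degree, adjoining a root of an irreducible factor at each step. *)
Lemma monic_splits (F : fieldType) (p : {poly F}) : p \is monic ->
  exists (L : fieldType) (f : {rmorphism F -> L}) (s : seq L),
    map_poly f p = \prod_(z <- s) ('X - z%:P).
Proof.
have [n] := ubnP (size p); elim: n F p => // n IH F p; rewrite ltnS => pn mp.
have [p1|p1] := leqP (size p) 1.
  exists F, idfun, [::]; rewrite big_nil map_poly_id //.
  by move: mp; rewrite (size1_polyC p1) monicE lead_coefC => /eqP ->.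
have [q q_irr qp] : exists2 q, irreducible_poly q & q %| p.
  pose P m := `[< exists2 q, q %| p & (size q != 1) && (size q == m) >].
  have exP : exists m, P m.
    by exists (size p); apply/asboolP; exists p; rewrite // eqxx andbT gtn_eqF.
  have [m /asboolP [q qp /andP [q1 /eqP qm]] min] := ex_minnP exP.
  have q0 : q != 0 by apply: dvdpN0 qp (monic_neq0 mp).
  exists q => //; split=> [|r r1 rq].
    by rewrite ltn_neqAle eq_sym q1 lt0n size_poly_eq0.
  rewrite -dvdp_size_eqp // eqn_leq dvdp_leq //= qm; apply: min; apply/asboolP.
  by exists r; rewrite ?(dvdp_trans rq) // r1 eqxx.
have [L _ [z pz _]] := irredp_FAdjoin q_irr.
have : root (map_poly (GRing.in_alg L) p) z.
  by move: qp => /dvdpP [r ->]; rewrite rmorphM rootM pz orbT.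
move=> /factor_theorem [r rE].
have mr : r \is monic.
  by move: (map_monic (GRing.in_alg L) p); rewrite mp rE monicMr ?monicXsubC.
have [|L' [f [s sE]]] := IH L r _ mr.
  have := size_map_poly (GRing.in_alg L) p;
    rewrite rE size_Mmonic ?monic_neq0 ?monicXsubC //.
  by rewrite size_XsubC addn2 /= => E; rewrite E.
exists L', (f \o GRing.in_alg L), (f z :: s).
rewrite map_poly_comp rE rmorphM /= map_polyXsubC big_cons mulrC.
by congr (_ * _).
Qed.

Lemma tofrac_inj (R : idomainType) : injective (toFrac R).
Proof. by move=> x y /eqP; rewrite /= tofrac_eq => /eqP. Qed.

Lemma eigenvector_peval (F L : fieldType) (f : {rmorphism F -> L}) d (M :
  mx_algebra F d) p
    (v : 'rV_d) z :
  v *m map_mx f M = z *: v -> v *m map_mx f (peval M p) = (map_poly f p).[z] *: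
    v.
Proof.
move=> vM; have vMi i : v *m map_mx f (M ^+ i : 'M_d) = z ^+ i *: v.
  elim: i => [|i IH]; first by rewrite !expr0 map_mx1 mulmx1 scale1r.
  by rewrite exprSr map_mxM mulmxA IH -scalemxAl vM scalerA exprSr.
rewrite /peval map_mx_sum mulmx_sumr horner_poly scaler_suml.
apply: eq_bigr => i _; rewrite map_mxM map_scalar_mx mulmxA mul_mx_scalar.
by rewrite -scalemxAl vMi scalerA.
Qed.

(* Gauss' lemma: the roots of the characteristic polynomial are roots of [h],
   so its coefficients are integral over R. *)
Lemma normal_char_poly (R : idomainType) d (M : mx_algebra {fraction R} d) (h :
  {poly R}) :
  normal R -> h \is monic -> peval M (map_poly (toFrac R) h) = 0 ->
  exists2 q : {poly R}, q \is monic & map_poly (toFrac R) q = char_poly M.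
Proof.
move=> nR mh hM.
have [L [f [s sE]]] := monic_splits (char_poly_monic M).
have int_s z : z \in s -> integralOver (f \o toFrac R) z.
  move=> zs; exists h => //; rewrite map_poly_comp.
  have : eigenvalue (map_mx f M) z.
    rewrite eigenvalue_root_char -map_char_poly sE.
    by rewrite root_prod_XsubC.
  move=> /eigenvalueP [v vM v0].
  have := eigenvector_peval (map_poly (toFrac R) h) vM.
  rewrite hM map_mx0 mulmx0 => /esym/eqP; rewrite scaler_eq0 (negPf v0) orbF.
  by move=> /eqP hz; apply/eqP.
have int_c i : integralOver (f \o toFrac R) (\prod_(z <- s) ('X - z%:P))`_i.
  elim: s int_s {sE} i => [|z s IH] int_s i.
    by rewrite big_nil coef1 ; exact: integral_nat.
  rewrite big_cons mulrBl coefB coefXM coefCM.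
  have ints j : integralOver (f \o toFrac R) (\prod_(z <- s) ('X - z%:P))`_j.
    by apply: IH => w ws; apply: int_s; rewrite inE ws orbT.
  apply: integral_sub; last by apply: integral_mul => //; apply: int_s;
    rewrite inE eqxx.
  by case: eqP => // _; exact: integral0.
(* These coefficients come from K, so integrality in [L] descends along the embedding and normality
   applies. *)
have /choice [c cE] i : exists r, (char_poly M)`_i = toFrac R r.
  apply: nR; have := int_c i; rewrite -sE coef_map => -[q mq].
  by rewrite map_poly_comp fmorph_root; exists q.
pose q := \poly_(i < size (char_poly M)) c i.
have E : map_poly (toFrac R) q = char_poly M.
  apply/polyP => i; rewrite coef_map coef_poly; case: ltnP => [_|le].
    by rewrite cE.
  by rewrite nth_default //; exact: rmorph0.
exists q => //; clearbody q; have := char_poly_monic M.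
rewrite -E !monicE lead_coef_map_inj ?rmorph0 //; last exact: tofrac_inj.
by move=> /eqP q1; apply/eqP/tofrac_inj; rewrite [RHS]rmorph1.
Qed.

(** Over an extension containing an eigenvalue of z, the eigenspace is a non-zero submodule of the
    extended module, which is still simple. So z is a scalar there, and a diagonal entry shows that
    the scalar lies in [F]. *)
Lemma central_scalar (F : fieldType) (B : freeAlgebra F) (S : rep B) (z : B) :
  is_split B -> rep_simple S -> (forall b, z * b = b * z) ->
  exists a : F, S z = a%:M.
Proof.
move=> spB sS zC.
(* The transpose appears because [eigenvalue] refers to row vectors, whereas modules consist of
   columns. *)
have [L [f [s sE]]] := monic_splits (char_poly_monic (S z)^T).
have [a aE] : exists a, a \in s.
  case: s sE => [|a s] sE; last by exists a; rewrite mem_head.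
  move: sE; rewrite big_nil => /(congr1 (fun p : {poly L} => size p)).
  rewrite size_map_poly size_char_poly size_poly1 => -[S0].
  by case: sS => + _; rewrite /rep_nonzero S0.
have /eigenvalueP [v vM v0] : eigenvalue (map_mx f (S z)^T) a.
  by rewrite eigenvalue_root_char -map_char_poly sE root_prod_XsubC.
pose Q (u : 'cV[L]_(rep_dim (rep_ext f S))) := map_mx f (S z) *m u = a *: u.
have [||b u Qu|Q0|Q1] := @simple_stable _ _ (rep_ext f S) Q (spB S sS L f).
- by rewrite /Q mulmx0 scaler0.
- move=> c u w Qu Qw; rewrite /Q mulmxDr -scalemxAr Qu Qw scalerDr.
  by rewrite !scalerA mulrC.
- rewrite -[b](@free_coordK _ (scext B f)) rep_comb mulmx_suml.
  elim/big_rec: _ => [|i w _ Qw]; first by rewrite /Q mulmx0 scaler0.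
  rewrite /Q mulmxDr Qw scalerDr; congr (_ + _).
  rewrite -scalemxAl -scalemxAr scalerA mulrC -scalerA; congr (_ *: _).
  rewrite [rep_ext f S _]rep_extE mulmxA -map_mxM -rep_actM zC rep_actM map_mxM.
  by rewrite -mulmxA Qu scalemxAr.
- case/eqP: v0; apply: trmx_inj; rewrite trmx0; apply: Q0.
  rewrite /Q; apply: trmx_inj; rewrite trmx_mul trmxK map_trmx vM.
  by apply/matrixP => i j; rewrite !mxE.
have Sza : map_mx f (S z) = a%:M.
  apply/matrixP => i j; have /matrixP/(_ i 0) := Q1 (delta_mx j 0).
  by rewrite -colE !mxE eqxx andbT mulr_natr.
have [i] : exists i : 'I_(rep_dim S), true by case: sS => S0 _;
  exists (Ordinal S0).
move=> _; exists (S z i i); apply/matrixP => j l; apply: (fmorph_inj f).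
have /matrixP/(_ j l) := Sza; have /matrixP/(_ i i) := Sza.
by rewrite !mxE eqxx mulr1n rmorphMn => -> ->.
Qed.

(** * Places and lattices *)

Lemma rep_hom_basis (R S : comNzRingType) (A : freeAlgebra R) (phi :
  {rmorphism R -> S})
    (V W : rep (scext A phi)) (h : 'M[S]_(rep_dim W, rep_dim V)) :
  (forall i, h *m V (to_scext A phi (free_basis A i)) = W (to_scext A phi
    (free_basis A i)) *m h) ->
  rep_hom h.
Proof.
move=> hb b; rewrite -[b](@free_coordK _ (scext A phi)) !rep_comb.
rewrite mulmx_sumr mulmx_suml; apply: eq_bigr => i _.
by rewrite -scalemxAr -scalemxAl hb.
Qed.

(* This covers the valuation ring of a gate in p as well as, for p = 0, the
   field K itself, with place_pi = 0. *)
Record place (R : idomainType) (k : fieldType) (psi : {rmorphism R -> k}) :=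
  Place {
  place_ring : idomainType;
  place_frac : {rmorphism place_ring -> {fraction R}};
  place_incl : {rmorphism R -> place_ring};
  place_res : {rmorphism place_ring -> k};
  place_pi : place_ring;
  place_inclE : forall r, place_frac (place_incl r) = toFrac R r;
  place_resE : forall r, place_res (place_incl r) = psi r;
  place_frac_inj : injective place_frac;
  place_fracP : forall x : {fraction R},
    exists a b, b != 0 /\ x = place_frac a / place_frac b;
  place_res_pi : forall x, place_res x = 0 <-> exists y, x = place_pi * y;
  place_unit : forall x, place_res x <> 0 -> exists y, x * y = 1;
  place_pow : forall x, x <> 0 -> exists n y, place_pi ^+ n = x * y;
  place_total : forall x y : place_ring, (exists z, x = z * y) \/ (exists z,
    y = z * x) }.

Section Lattice.
Variables (R : idomainType) (A : freeAlgebra R) (k : fieldType).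
Variables (psi : {rmorphism R -> k}) (P : place psi).
Local Notation K := {fraction R}.
Local Notation O := (place_ring P).
Local Notation iota := (place_frac P).
Local Notation incl := (place_incl P).
Local Notation AK := (AK A).
Local Notation AO := (scext A incl).

Lemma place_frac_total (x y : K) :
  (exists z, x = iota z * y) \/ (exists z, y = iota z * x).
Proof.
have [a [b [b0 ->]]] := place_fracP P x; have [c [d [d0 ->]]] :=
  place_fracP P y.
have iota0 u : u != 0 -> iota u != 0.
  by rewrite -(rmorph0 iota) (inj_eq (@place_frac_inj _ _ _ P)).
have [[z E]|[z E]] := place_total (a * d) (c * b); [left|right]; exists z;
  apply/eqP; rewrite mulrA eqr_div ?iota0 // -!rmorphM E; apply/eqP;
  by congr (iota _); rewrite mulrA.
Qed.

Lemma place_frac_max (T : finType) (F : T -> K) (t0 : T) :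
  exists t, forall t', exists z, F t' = iota z * F t.
Proof.
have H (s : seq T) : exists t, forall t', t' \in t0 :: s -> exists z,
  F t' = iota z * F t.
  elim: s => [|u s [t tP]].
    by exists t0 => t'; rewrite inE => /eqP ->; exists 1; rewrite rmorph1 mul1r.
  have [[z E]|[z E]] := place_frac_total (F u) (F t).
    exists t => t'; rewrite !inE orbCA => /orP [/eqP ->|t's]; first by exists z.
    by apply: tP; rewrite inE.
  exists u => t'; rewrite !inE orbCA => /orP [/eqP ->|t's].
    by exists 1; rewrite rmorph1 mul1r.
  have [|w ->] := tP t'; first by rewrite inE.
  by exists (w * z); rewrite E rmorphM mulrA.
have [t tP] := H (enum T); exists t => t'; apply: tP.
by rewrite inE mem_enum orbT.
Qed.

(* Cramer's rule: the rows of a minor of maximal value span the same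
   O-module as all rows. *)
Lemma place_row_basis m d (W : 'M[K]_(m, d)) : row_full W ->
  exists (t : 'I_d -> 'I_m) (X : 'M[place_ring P]_(m, d)),
    rowsub t W \in unitmx /\ W = map_mx iota X *m rowsub t W.
Proof.
move=> fW.
have [t tP] := place_frac_max (fun t : {ffun 'I_d -> 'I_m} =>
  \det (rowsub t W)) (fullrankfun fW).
have tU : rowsub t W \in unitmx.
  rewrite unitmxE unitfE; have [z E] := tP (fullrankfun fW).
  have : \det (rowsub (fullrankfun fW) W) != 0.
    by rewrite -unitfE -unitmxE; exact: fullrowsub_unit.
  by rewrite E mulf_eq0 => /norP [].
pose g := rowsub t W; have dg : \det g != 0 by rewrite -unitfE -unitmxE.
have XP r c : exists z, (W *m invmx g) r c = iota z.
  (* The entry is the quotient of the minor with its row [c] replaced by row [r] of [W] by the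
     chosen minor. *)
  pose t' := [ffun i => if i == c then r else t i].
  have [z E] := tP t'; exists z.
  rewrite /invmx tU -scalemxAr mxE; apply: (mulfI dg);
    rewrite mulrA divff // mul1r.
  rewrite mulrC -E (expand_det_row _ c) !mxE; apply: eq_bigr => l _.
  rewrite !mxE ffunE eqxx; congr (_ * (_ * \det _)).
  apply/matrixP => i j; rewrite !mxE ffunE.
  by rewrite eq_sym (negPf (neq_lift _ _)).
have /choice [X XE] : forall rc : 'I_m * 'I_d, exists z,
  (W *m invmx g) rc.1 rc.2 = iota z.
  by move=> [r c]; exact: XP.
exists t, (\matrix_(i, j) X (i, j)); split=> //.
rewrite -[LHS]mulmx1 -(mulVmx tU) mulmxA; congr (_ *m _).
by apply/matrixP => i j; rewrite [RHS]mxE mxE -XE.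
Qed.

(** The lattice is the O-span of all e_i v_j, with e_i the basis of A and v_j the standard basis of
    [V]. It is stable under A and spans [V], and [place_row_basis] selects an O-basis from these
    generators. *)
Lemma lattice_exists (V : rep AK) :
  exists L : rep AO, rep_iso (rep_change (@place_inclE _ _ _ P) L) V.
Proof.
pose d := rep_dim V; pose n := free_rank A; pose e := free_basis A.
pose I := ('I_n * 'I_d)%type.
pose b i := to_scext A (toFrac R) (e i).
pose W : 'M[K]_(#|{: I}|, d) :=
  \matrix_(r, c) V (b (enum_val r).1) c (enum_val r).2.
have fW : row_full W.
  rewrite -sub1mx; apply/row_subP => j.
  have -> : row j 1%:M = \sum_i toFrac R (free_coord A 1 0 i) *:
    row (enum_rank (i, j)) W.
    apply/matrixP => x c; rewrite ord1 summxE !mxE.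
    transitivity (V 1 c j); first by rewrite rep_act1 mxE eq_sym.
    rewrite -[1](@free_coordK _ AK) rep_comb summxE; apply: eq_bigr => i _.
    by rewrite !mxE enum_rankK.
  by apply: summx_sub => i _; exact/scalemx_sub/row_sub.
have [t [X [gU WE]]] := place_row_basis fW.
set g := (rowsub t W)^T.
pose p c := enum_val (t c).
(* The matrix of e_i on the chosen basis: the product of e_i with a basis element of A is expanded
   in A, and [X] rewrites the result in the lattice basis. *)
pose G i : 'M[O]_d := \matrix_(r, c)
  \sum_l incl (free_coord A (e i * e (p c).1) 0 l) * X (enum_rank (l,
    (p c).2)) r.
have gG i : V (b i) *m g = g *m map_mx iota (G i).
  apply/matrixP => r c.
  have -> : (V (b i) *m g) r c = (V (b i) *m V (b (p c).1)) r (p c).2.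
    by rewrite !mxE; apply: eq_bigr => l _; rewrite !mxE.
  rewrite -rep_actM (_ : b i * _ = to_scext A (toFrac R) (e i * e (p c).1));
    last first.
    by rewrite to_scextM.
  rewrite -[to_scext _ _ (_ * _)](@free_coordK _ AK) rep_comb summxE.
  have -> : (g *m map_mx iota (G i)) r c = \sum_l
      toFrac R (free_coord A (e i * e (p c).1) 0 l) * W (enum_rank (l,
        (p c).2)) r.
    transitivity (\sum_s \sum_l g r s * iota (incl (free_coord A (e i * e (p
      c).1) 0 l)
        * X (enum_rank (l, (p c).2)) s)).
      rewrite mxE; apply: eq_bigr => s _.
      by rewrite !mxE rmorph_sum mulr_sumr.
    rewrite exchange_big; apply: eq_bigr => l _;
      rewrite [in RHS]WE mxE mulr_sumr.
    apply: eq_bigr => s _.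
    by rewrite !mxE rmorphM place_inclE mulrCA; congr (_ * _); rewrite mulrC.
  by apply: eq_bigr => l _; rewrite !mxE enum_rankK.
have gU' : g \in unitmx by rewrite unitmx_tr.
have iotaM_inj : injective (map_mx iota : 'M_d -> 'M_d).
  move=> M N /matrixP E; apply/matrixP => i j.
  by apply: (@place_frac_inj _ _ _ P); have := E i j; rewrite !mxE.
have liftE a : V (to_scext A (toFrac R) a) *m g =
    g *m map_mx iota (scext_lift incl G (to_scext A incl a)).
  rewrite -[in LHS](@free_coordK _ AK (to_scext _ _ a)) rep_comb mulmx_suml.
  rewrite /scext_lift map_mx_sum mulmx_sumr; apply: eq_bigr => i _.
  by rewrite map_mxZ -scalemxAl -scalemxAr gG !mxE place_inclE.
have gI (M N : 'M[O]_d) : g *m map_mx iota M = g *m map_mx iota N -> M = N.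
  by move=> /(congr1 (mulmx (invmx g))); rewrite !mulKmx // => /iotaM_inj.
have G1 : scext_lift incl G (to_scext A incl 1) = 1%:M.
  by apply: gI; rewrite -liftE map_mx1 mulmx1 [V _]rep_act1 mul1mx.
have GM i j : scext_lift incl G (to_scext A incl (e i * e j)) = G i *m G j.
  apply: gI; rewrite -liftE map_mxM mulmxA -gG -mulmxA -gG mulmxA.
  by rewrite to_scextM [V _]rep_actM.
exists (scext_rep G1 GM), g, (invmx g); split; rewrite ?mulmxV ?mulVmx //.
apply: rep_hom_basis => i; rewrite gG; congr (_ *m _).
rewrite [LHS](rep_changeE (@place_inclE _ _ _ P) (scext_rep G1 GM)).
congr map_mx; apply: gI.
by rewrite [_ (to_scext _ _ _)]/(scext_lift _ _ _) -liftE gG.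
Qed.
End Lattice.

Lemma G0_core_rank_change (R : comNzRingType) (k l : fieldType) (A :
  freeAlgebra R)
    (phi : {rmorphism R -> k}) (psi : {rmorphism R -> l}) (f : {rmorphism k ->
      l})
    (f_phi : forall r, f (phi r) = psi r) w x :
  G0_core_rank (scext_map A f_phi w) (G0_change f_phi x) = G0_core_rank w x.
Proof.
elim/G0_ind: x => [|x y IHx IHy|V]; first
  by rewrite (raddf0 (G0_change f_phi)) !(raddf0 (G0_core_rank _)).
  rewrite (G0_change_is_zmod_morphism f_phi) !G0_core_rank_is_zmod_morphism.
  by rewrite IHx IHy.
by rewrite G0_change_class !G0_core_rank_class rep_change_map core_rank_map.
Qed.

(** Monic polynomials keep their degrees under [f], so the Sylvester matrix keeps its shape. *)
Lemma map_resultant_monic (R : comNzRingType) (F : fieldType) (f :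
  {rmorphism R -> F}) p q :
  p \is monic -> q \is monic ->
  f (resultant p q) = resultant (map_poly f p) (map_poly f q).
Proof.
move=> /monicP p1 /monicP q1.
rewrite /resultant /Sylvester_mx !size_map_poly_id0 ?p1 ?q1 ?rmorph1 ?oner_eq0
  //.
rewrite -det_map_mx /= map_col_mx; congr (\det (col_mx _ _));
  by apply: map_lin1_mx => v; rewrite map_poly_rV rmorphM /= map_rVpoly.
Qed.

(** * The decomposition map and the reduction from A_p to A(p) *)

Section Decomposition.
Variables (R : idomainType) (A : freeAlgebra R) (p : prime_idealr R).
Variables (k : fieldType) (psi : {rmorphism R -> k}) (P : place psi).
Variables (f : {rmorphism residue_field p -> k}).
Hypothesis f_res : forall r, f (residue p r) = psi r.
Local Notation K := {fraction R}.
Local Notation O := (place_ring P).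
Local Notation iota := (place_frac P).
Local Notation incl := (place_incl P).
Local Notation res := (place_res P).
Local Notation AK := (AK A).
Local Notation Ap := (Ares A p).
Local Notation AO := (scext A incl).
Local Notation toK := (to_scext A (toFrac R) : A -> AK).
Local Notation toO := (to_scext A incl : A -> AO).
Local Notation tok := (to_scext A psi : A -> (scext A psi)).
Local Notation top := (to_scext A (residue p) : A -> Ap).
(** Base change of elements: [sK] and [sk] lead from A^O to A^K and to the algebra over [k], and
    [sf] leads from A(p) to the latter. On lattices, [generic] and [special] extend scalars from O
    to K and to [k]. *)
Local Notation sK := (scext_map A (@place_inclE _ _ _ P)).
Local Notation sk := (scext_map A (@place_resE _ _ _ P)).
Local Notation sf := (scext_map A f_res).
Local Notation generic L := (rep_change (@place_inclE _ _ _ P) L).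
Local Notation special L := (rep_change (@place_resE _ _ _ P) L).

Variable d : {additive G0 AK -> G0 Ap}.
(** This is how the decomposition map enters: after extension of scalars to [k], it is given by the
    reduction of any lattice. *)
Hypothesis d_special : forall (V : rep AK) (L : rep AO),
  rep_iso (generic L) V ->
  G0_change f_res (d (G0_class V)) = G0_class (special L).

Lemma psi_eq0 r : (psi r == 0) = (r \in p).
Proof. by rewrite -f_res fmorph_eq0 residue_eq0. Qed.

Lemma core_rank_special (V : rep AK) (L : rep AO) w : rep_iso (generic L) V ->
  G0_core_rank w (d (G0_class V)) = (core_rank (special L (sf w)))%:Z.
Proof.
by move=> LV; rewrite -(G0_core_rank_change f_res) (d_special LV)
  G0_core_rank_class.
Qed.

Lemma lattice_act0 (V : rep AK) (L : rep AO) x : rep_iso (generic L) V ->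
  V (sK x) = 0 <-> L x = 0.
Proof.
move=> [g [h [gH gh hg]]].
have E : g *m map_mx iota (L x) = V (sK x) *m g by rewrite -rep_change_map gH.
split=> [Vx|Lx]; last first.
  by rewrite -[LHS]mulmx1 -gh mulmxA -E Lx map_mx0 mulmx0 mul0mx.
have : map_mx iota (L x) = 0
  by rewrite -[LHS]mul1mx -hg -mulmxA E Vx mul0mx mulmx0.
move=> /matrixP H; apply/matrixP => i j; apply: (@place_frac_inj _ _ _ P).
by have := H i j; rewrite !mxE rmorph0.
Qed.

Lemma special_char_poly (V : rep AK) (L : rep AO) x (q : {poly O}) :
  rep_iso (generic L) V -> map_poly iota q = char_poly (V (sK x)) ->
  map_poly res q = char_poly (special L (sk x)).
Proof.
move=> [g [h [gH gh hg]]] qE.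
have E : V (sK x) *m g = g *m map_mx iota (L x) by rewrite -rep_change_map gH.
rewrite rep_change_map -map_char_poly; congr map_poly.
apply: (map_inj_poly (@place_frac_inj _ _ _ P)); first exact: rmorph0.
by rewrite qE map_char_poly (char_poly_iso gh hg E).
Qed.

Lemma rep_to_scext_peval (V : rep AK) a q :
  V (toK (peval a q)) = peval (V (toK a) :
    mx_algebra K _) (map_poly (toFrac R) q).
Proof.
rewrite -rep_peval; congr (V _).
apply: (@peval_morph _ _ _ AK (toFrac R) (to_scext A (toFrac R))) .
exact: to_scext_scalar.
Qed.

(* w is the image in A(p) of the element b of A_p. *)
Definition reduces (b : AK) (w : Ap) : Prop := exists a s,
  [/\ s \notin p, alg_scalar AK (toFrac R s) * b = toK a
    & alg_scalar Ap (residue p s) * w = top a].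

Lemma toFrac_notin s : s \notin p -> toFrac R s != 0.
Proof. by rewrite tofrac_eq0; apply: contraNneq => ->; exact: idealr0. Qed.

Lemma toFrac_VK s (x : AK) : s \notin p ->
  alg_scalar AK (toFrac R s)^-1 * (alg_scalar AK (toFrac R s) * x) = x.
Proof.
by move=> sp; rewrite mulrA -rmorphM mulVf ?toFrac_notin // rmorph1 mul1r.
Qed.

Lemma residue_VK s (x : Ap) : s \notin p ->
  alg_scalar Ap (residue p s)^-1 * (alg_scalar Ap (residue p s) * x) = x.
Proof.
by move=> sp; rewrite mulrA -rmorphM mulVf ?residue_eq0 // rmorph1 mul1r.
Qed.

Lemma reduces_A_loc b w : reduces b w -> A_loc A p b.
Proof. by move=> [a [s [sp sb _]]]; exists a, s; rewrite -sb toFrac_VK. Qed.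

Lemma A_loc_reduces b : A_loc A p b -> exists w, reduces b w.
Proof.
move=> [a [s [sp ->]]]; exists (alg_scalar Ap (residue p s)^-1 * top a), a, s.
split=> //; rewrite mulrA -rmorphM divff ?residue_eq0 ?toFrac_notin //;
  by rewrite rmorph1 mul1r.
Qed.

Lemma residue_fieldP (x : residue_field p) :
  exists a s, s \notin p /\ residue p s * x = residue p a.
Proof.
have [a [s [s0 ->]]] := frac_ind x.
exists (repr (a : {ideal_quot p})), (repr (s : {ideal_quot p})).
rewrite -residue_eq0 /= !quot_piK tofrac_eq0; split=> //.
by rewrite mulrC divfK // tofrac_eq0.
Qed.

Lemma reduces_surj w : exists b, reduces b w.
Proof.
have /choice [a /choice [s sP]] : forall i, exists a s,
    s \notin p /\ residue p s * w 0 i = residue p a.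
  by move=> i; exact: residue_fieldP.
pose t := \prod_i s i.
have tp : t \notin p.
  rewrite /t; elim/big_ind: _ => [|x y xp yp|i _]; last by case: (sP i).
    by rewrite idealr1.
  by rewrite prime_idealrM negb_or xp.
pose c i := (\prod_(j | j != i) s j) * a i.
have cE i : residue p t * w 0 i = residue p (c i).
  rewrite /t (bigD1 i) // /c !(rmorphM (residue p)) -(sP i).2.
  by rewrite mulrAC [LHS]mulrC.
pose x := \sum_i alg_scalar A (c i) * free_basis A i.
have wE : alg_scalar Ap (residue p t) * w = top x.
  rewrite -[w](@free_coordK _ Ap) mulr_sumr [top x]to_scext_sum.
  apply: eq_bigr => i _; rewrite mulrA -rmorphM to_scextZ -cE.
  exact: scext_scaleE.
exists (alg_scalar AK (toFrac R t)^-1 * toK x), x, t; split=> //.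
by rewrite mulrA -rmorphM divff ?toFrac_notin // rmorph1 mul1r.
Qed.

Lemma toK_inj : injective toK.
Proof.
move=> x y /matrixP E; rewrite -(free_coordK x) -(free_coordK y).
apply: eq_bigr => i _; congr (alg_scalar A _ * _).
by apply: (@tofrac_inj R); have := E 0 i; rewrite !mxE.
Qed.

Lemma toK_scale r x : toK (alg_scalar A r * x) = alg_scalar AK (toFrac R r) *
  toK x.
Proof. by rewrite [LHS]to_scextZ [RHS]scext_scaleE. Qed.

Lemma top_scale r x : top (alg_scalar A r * x) = alg_scalar Ap (residue p r) *
  top x.
Proof. by rewrite [LHS]to_scextZ [RHS]scext_scaleE. Qed.

Lemma residue_mulI s : s \notin p -> injective (fun x : Ap =>
  alg_scalar Ap (residue p s) * x).
Proof.
move=> sp x y /(congr1 (fun u => alg_scalar Ap (residue p s)^-1 * u)).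
by rewrite !residue_VK.
Qed.

Lemma toK_common b a s t : alg_scalar AK (toFrac R s) * b = toK a ->
  alg_scalar AK (toFrac R (t * s)) * b = toK (alg_scalar A t * a).
Proof. by move=> E; rewrite toK_scale -E -alg_scalar_mulA -(rmorphM (toFrac R)).
  Qed.

Lemma top_common w a s t : alg_scalar Ap (residue p s) * w = top a ->
  alg_scalar Ap (residue p (t * s)) * w = top (alg_scalar A t * a).
Proof. by move=> E; rewrite top_scale -E -alg_scalar_mulA -(rmorphM (residue
  p)). Qed.

(** Over a common denominator the numerators agree, as A embeds into A^K, and the denominator is
    invertible in k(p). Hence reduction is a well-defined map on A_p. *)
Lemma reduces_fun b w w' : reduces b w -> reduces b w' -> w = w'.
Proof.
move=> [a [s [sp sb sw]]] [a' [s' [s'p s'b s'w]]].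
have ssp : s * s' \notin p by rewrite prime_idealrM negb_or sp.
apply: (residue_mulI ssp);
  rewrite /= (top_common s s'w) [s * s']mulrC (top_common s' sw).
congr (to_scext _ _ _); apply: toK_inj.
by rewrite -(toK_common s' sb) [s' * s]mulrC -(toK_common s s'b).
Qed.

Lemma reduces_to a : reduces (toK a) (top a).
Proof. by exists a, 1; rewrite idealr1 !rmorph1 !mul1r. Qed.

Lemma reduces1 : reduces 1 1. Proof. exact: reduces_to. Qed.

Lemma reduces0 : reduces 0 0.
Proof.
by have := reduces_to 0; rewrite -[toK 0]/(to_scext _ _ 0) -[top 0]/(to_scext _
  _ 0) !to_scext0.
Qed.

Lemma reducesB b b' w w' : reduces b w -> reduces b' w' ->
  reduces (b - b') (w - w').
Proof.
move=> [a [s [sp sb sw]]] [a' [s' [s'p s'b s'w]]].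
exists (alg_scalar A s' * a - alg_scalar A s * a'), (s * s'); split.
- by rewrite prime_idealrM negb_or sp.
- rewrite mulrBr [RHS](to_scext_is_zmod_morphism (toFrac R)) (toK_common s s'b).
  by rewrite [s * s']mulrC (toK_common s' sb).
- rewrite mulrBr [RHS](to_scext_is_zmod_morphism (residue p)) (top_common s
    s'w).
  by rewrite [s * s']mulrC (top_common s' sw).
Qed.

Lemma reducesM b b' w w' : reduces b w -> reduces b' w' ->
  reduces (b * b') (w * w').
Proof.
move=> [a [s [sp sb sw]]] [a' [s' [s'p s'b s'w]]].
exists (a * a'), (s * s'); split.
- by rewrite prime_idealrM negb_or sp.
- by rewrite [RHS]to_scextM (rmorphM (toFrac R)) alg_scalar_mulACA sb s'b.
- by rewrite [RHS]to_scextM (rmorphM (residue p)) alg_scalar_mulACA sw s'w.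
Qed.

(** The denominator has non-zero residue, hence is a unit of O, so the fraction already makes sense
    in A^O. *)
Lemma reduces_place b w : reduces b w -> exists x, sK x = b /\ sk x = sf w.
Proof.
move=> [a [s [sp sb sw]]].
have [|t st] := @place_unit _ _ _ P (incl s).
  by rewrite place_resE; apply/eqP; rewrite psi_eq0.
exists (alg_scalar AO t * toO a); split.
- rewrite -[LHS](toFrac_VK _ sp) -[RHS](toFrac_VK _ sp) sb; congr (_ * _).
  rewrite -(@place_inclE _ _ _ P) -[alg_scalar AK _](scext_map_scalar A
    (@place_inclE _ _ _ P)).
  rewrite -scext_mapM mulrA -rmorphM st.
  by rewrite rmorph1 mul1r scext_map_to_scext.
- have s0 : psi s != 0 by rewrite psi_eq0.
  have VK (x : scext A psi) :
    alg_scalar (scext A psi) (psi s)^-1 * (alg_scalar (scext A psi) (psi s) * x)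
    = x.
    by rewrite mulrA -rmorphM mulVf // rmorph1 mul1r.
  rewrite -[LHS]VK -[RHS]VK; congr (_ * _).
  rewrite -{1}(@place_resE _ _ _ P) -[in RHS]f_res.
  rewrite -[in LHS](scext_map_scalar A (@place_resE _ _ _ P)).
  rewrite -scext_mapM mulrA -rmorphM st.
  rewrite -[in RHS](scext_map_scalar A f_res).
  rewrite -scext_mapM sw.
  by rewrite rmorph1 mul1r !scext_map_to_scext.
Qed.

Lemma special_reduces0 (V : rep AK) (L : rep AO) b w : rep_iso (generic L) V ->
  reduces b w -> V b = 0 -> special L (sf w) = 0.
Proof.
move=> LV /reduces_place [x [<- <-]] /(lattice_act0 _ LV) Lx.
by rewrite rep_change_map Lx map_mx0.
Qed.

Lemma core_rank_reduces0 (V : rep AK) b w u : reduces b w -> V b = 0 ->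
  G0_core_rank (w * u) (d (G0_class V)) = 0.
Proof.
move=> bw Vb; have [L LV] := lattice_exists P V.
rewrite (core_rank_special _ LV) scext_mapM.
by rewrite rep_actM (special_reduces0 LV bw Vb) mul0mx core_rank_0.
Qed.

(** On a lattice, b is an idempotent matrix M with zero reduction. Then 1 - M has unit determinant,
    and (1 - M)M = 0 gives M = 0. *)
Lemma core_rank_reduces_idem (V : rep AK) b w : reduces b w -> b * b = b ->
  w * w = w ->
  G0_core_rank w (d (G0_class V)) = 0 -> V b = 0.
Proof.
move=> bw bb ww; have [L LV] := lattice_exists P V.
have [x [xb xw]] := reduces_place bw.
rewrite (core_rank_special _ LV) -xw -xb => -[cr]; apply/(lattice_act0 _ LV).
have Lx0 : map_mx res (L x) = 0.
  rewrite -(rep_change_map (@place_resE _ _ _ P)).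
  apply: core_rank0_idem; last by rewrite -cr xw.
  by rewrite -(rep_actM (special L)) xw -scext_mapM ww.
have LxLx : L x *m L x = L x.
  apply/eqP; rewrite -subr_eq0 -rep_actM -rep_actB; apply/eqP.
  apply/(lattice_act0 _ LV).
  by rewrite scext_mapB scext_mapM xb bb subrr rep_act0.
have [|t tP] := @place_unit _ _ _ P (\det (1%:M - L x)).
  by rewrite -det_map_mx map_mxB map_mx1 Lx0 subr0 det1; apply/eqP/oner_neq0.
have U : 1%:M - L x \in unitmx by rewrite unitmxE; apply/unitrPr; exists t.
rewrite -[L x]mul1mx -(mulVmx U) -mulmxA mulmxBl mul1mx LxLx subrr.
by rewrite mulmx0.
Qed.

Lemma reduces0_idem b : reduces b 0 -> b * b = b -> b = 0.
Proof.
move=> b0 bb; apply: regular_rep_inj.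
apply: (core_rank_reduces_idem b0 bb); first by rewrite mulr0.
by have := @core_rank_reduces0 (regular_rep AK) 0 0 0 reduces0;
  rewrite rep_act0 mulr0; exact.
Qed.

Lemma reduces_central b w : reduces b w -> (forall x, b * x = x * b) ->
  forall y, w * y = y * w.
Proof.
move=> bw bC y; have [x xy] := reduces_surj y.
apply: reduces_fun (reducesM bw xy) _; rewrite bC; exact: reducesM.
Qed.

Lemma reduces_idem b w : reduces b w -> b * b = b -> w * w = w.
Proof. by move=> bw bb; have := reducesM bw bw; rewrite bb => /reduces_fun;
  apply. Qed.

(** If w were zero on a constituent U, then 1 - w times the element separating U would have non-zero
    core rank on d[V], although 1 - c kills [V]. *)
Lemma constituent_belongs (V : rep AK) c w : reduces c w -> w * w = w ->
  (forall y, w * y = y * w) -> V c = 1%:M ->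
  forall U, constituent U (d (G0_class V)) -> U w = 1%:M.
Proof.
move=> cw ww wC Vc U cU; have [sU _] := cU.
have [Uw|//] := simple_central_idem sU ww wC.
have [u Uu] := constituent_core_rank_sep cU.
move=> /(_ (1 - w)); rewrite rep_actB Uw subr0 rep_act1 => /(_ erefl) [].
apply: core_rank_reduces0 (reducesB reduces1 cw) _.
by rewrite rep_actB Vc rep_act1 subrr.
Qed.

(** As 1 - w kills all constituents, its core rank on d[V] is 0, so 1 - c kills [V]. *)
Lemma belongs_constituent (V : rep AK) c w : reduces c w -> c * c = c ->
  w * w = w ->
  (forall U, constituent U (d (G0_class V)) -> U w = 1%:M) -> V c = 1%:M.
Proof.
move=> cw cc ww H; apply/eqP; rewrite eq_sym -subr_eq0 -rep_act1 -rep_actB;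
  apply/eqP.
apply: (core_rank_reduces_idem (reducesB reduces1 cw)); try exact: idem_compl.
apply: contrapT => /constituent_core_rank [U /H Uw []].
by rewrite rep_actB Uw rep_act1 subrr core_rank_0.
Qed.

Lemma regular_rep_change (S T : comNzRingType) (phi : {rmorphism R -> S})
    (chi : {rmorphism R -> T}) (g : {rmorphism S -> T}) (g_phi : forall r,
      g (phi r) = chi r) x :
  rep_change g_phi (regular_rep (scext A phi)) x = regular_rep (scext A chi) x.
Proof.
suff : rep_hom (V := rep_change g_phi (regular_rep (scext A phi)))
  (W := regular_rep (scext A chi)) 1%:M by move=> /(_ x); rewrite mul1mx mulmx1.
apply: rep_hom_basis => i; rewrite mul1mx mulmx1 -(scext_map_to_scext g_phi).
rewrite rep_change_map; apply/matrixP => r c.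
rewrite [LHS]mxE [in LHS]mxE [RHS]mxE.
set x1 := to_scext A phi (free_basis A i).
transitivity (scext_map A g_phi (x1 * to_scext A phi (free_basis A c)) 0 r).
  by rewrite [RHS]mxE.
by rewrite scext_mapM !scext_map_to_scext.
Qed.

(** The regular module of A^O is a lattice in that of A^K, and its reduction is the regular module
    over [k]. *)
Lemma core_rank_regular w :
  G0_core_rank w (d (G0_class (regular_rep AK))) = (core_rank (regular_rep Ap
    w))%:Z.
Proof.
rewrite (@core_rank_special _ (regular_rep AO)); last first.
  exists 1%:M, 1%:M; split; rewrite ?mulmx1 // => b.
  by rewrite mul1mx mulmx1 regular_rep_change.
rewrite [special _ _]regular_rep_change -(regular_rep_change f_res).
by rewrite rep_change_map core_rank_map.
Qed.

(** * A criterion for idempotents of A^K to lie in A_p *)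

Hypothesis R_normal : normal R.

(** The element [a] is a root of the characteristic polynomial of its action on A, which is monic
    over R. *)
Lemma normal_rep_char_poly (V : rep AK) a :
  exists2 q : {poly R}, q \is monic & map_poly (toFrac R) q = char_poly (V (toK
    a)).
Proof.
apply: (normal_char_poly (h := char_poly (regular_rep A a))) => //.
  exact: char_poly_monic.
rewrite -rep_to_scext_peval; suff -> : peval a (char_poly (regular_rep A a)) = 0
  by rewrite !raddf0.
apply: regular_rep_inj; rewrite rep_peval; exact: peval_char_poly.
Qed.

(* The characteristic polynomials [q0], [q1] of [a] on V0 and V1 have
   coefficients in R, and their resultant does not lie in p. A Bezout relation
   for them yields a polynomial in [a] that acts on V0 and V1 as a multiple of
   [c] does. *)
Lemma idempotent_A_loc (V0 V1 : rep AK) (c : AK) (a : A) (s : R) :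
  s \notin p -> V0 c = 0 -> V1 c = 1%:M ->
  (forall b, V0 b = 0 -> V1 b = 0 -> b = 0) ->
  G0_core_rank (top a) (d (G0_class V0)) = 0 ->
  G0_core_rank (top (alg_scalar A s - a)) (d (G0_class V1)) = 0 ->
  A_loc A p c.
Proof.
move=> sp V0c V1c faith cr0 cr1.
have [L0 LV0] := lattice_exists P V0; have [L1 LV1] := lattice_exists P V1.
have [q0 mq0 q0E] := normal_rep_char_poly V0 a.
have [q1 mq1 q1E] := normal_rep_char_poly V1 a.
have iotaE (q : {poly R}) :
  map_poly (toFrac R) q = map_poly iota (map_poly incl q).
  by rewrite -map_poly_comp; apply: eq_map_poly => r /=; rewrite place_inclE.
have psiE (q : {poly R}) : map_poly psi q = map_poly res (map_poly incl q).
  by rewrite -map_poly_comp; apply: eq_map_poly => r /=; rewrite place_resE.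
have q0k : map_poly psi q0 = 'X^(rep_dim L0).
  rewrite psiE (special_char_poly (x := toO a) LV0); last first.
    by rewrite -iotaE q0E scext_map_to_scext.
  rewrite scext_map_to_scext; apply: core_rank0_char_poly.
  move: cr0; rewrite (core_rank_special _ LV0) scext_map_to_scext.
  by case.
(* An eigenvector of [a] for 0 would be one of the nilpotent s - a for the non-zero eigenvalue
   [psi s]. *)
have q1k : ~~ root (map_poly psi q1) 0.
  rewrite psiE (special_char_poly (x := toO a) LV1); last first.
    by rewrite -iotaE q1E scext_map_to_scext.
  rewrite scext_map_to_scext -eigenvalue_root_char.
  apply/eigenvalueP => -[v va v0].
  move: cr1; rewrite (core_rank_special _ LV1) scext_map_to_scext => -[cr1].
  have nil := core_rank0_nilp cr1.
  have vs : v *m special L1 (tok (alg_scalar A s - a)) = psi s *: v.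
    rewrite (to_scext_is_zmod_morphism psi) rep_actB to_scext_scalar rep_scalar
      mulmxBr.
    by rewrite va scale0r subr0 mul_mx_scalar.
  have vsn n : v *m (special L1 (tok (alg_scalar A s - a)) ^+ n :
    'M_(rep_dim (special L1))) = psi s ^+ n *: v.
    elim: n => [|n IH]; first by rewrite !expr0 mulmx1 scale1r.
    by rewrite exprSr mulmxA IH -scalemxAl vs scalerA exprSr.
  have := vsn (rep_dim (special L1)); rewrite nil mulmx0 => /esym/eqP.
  by rewrite scaler_eq0 (negPf v0) orbF expf_eq0 psi_eq0 (negPf sp) andbF.
(* The extra factors make the degrees positive even if [V0] or [V1] is zero, as the resultant
   identity requires. Coprimality modulo p persists because s is not in p. *)
pose Q0 := 'X * q0; pose Q1 := ('X - s%:P) * q1.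
have mQ0 : Q0 \is monic by rewrite monicMr ?monicX.
have mQ1 : Q1 \is monic by rewrite monicMr ?monicXsubC.
have sQ0 : (1 < size Q0)%N.
  by rewrite size_monicM ?monicX ?monic_neq0 // size_polyX /= ltnS lt0n
    size_poly_eq0 monic_neq0.
have sQ1 : (1 < size Q1)%N.
  by rewrite size_monicM ?monicXsubC ?monic_neq0 // size_XsubC /= ltnS lt0n
    size_poly_eq0 monic_neq0.
have [[u v] _ /= uv] := resultant_in_ideal sQ0 sQ1.
set rho := resultant Q0 Q1 in uv.
have rho_p : rho \notin p.
  rewrite -psi_eq0 map_resultant_monic // resultant_eq0 -leqNgt.
  suff : coprimep (map_poly psi Q0) (map_poly psi Q1) by rewrite coprimep_def =>
    /eqP ->.
  rewrite rmorphM /= map_polyX q0k -exprS rmorphM /= map_polyXsubC.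
  rewrite coprimep_sym coprimep_expr // -[X in coprimep _ X]subr0 -polyC0.
  rewrite coprimep_XsubC rootM negb_or q1k andbT.
  by rewrite root_XsubC eq_sym psi_eq0.
(* This polynomial in [a] is 0 on [V0] and [rho] on [V1], so by joint faithfulness it equals [rho]
   times c. *)
pose y := peval a (u * Q0).
have V0y : V0 (toK y) = 0.
  by rewrite rep_to_scext_peval !rmorphM /= q0E !pevalM peval_char_poly !mulr0.
have V1y : V1 (toK y) = (toFrac R rho)%:M.
  rewrite /y; have -> : u * Q0 = rho%:P - v * Q1 by rewrite uv addrK.
  rewrite rep_to_scext_peval rmorphB rmorphM /= map_polyC /= pevalB pevalC.
  by rewrite !rmorphM /= q1E !pevalM peval_char_poly !mulr0 subr0.
exists y, rho; split=> //.
have rho0 : toFrac R rho != 0.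
  by rewrite tofrac_eq0; apply: contraNneq rho_p => ->; exact: idealr0.
apply/eqP; rewrite -subr_eq0; apply/eqP; apply: faith;
  rewrite rep_actB rep_actM rep_scalar.
  by rewrite V0c V0y mulmx0 subr0.
by rewrite V1c V1y mul_scalar_mx scale_scalar_mx mulVf ?subrr.
Qed.

(** * Lifting central idempotents from A(p) to A_p *)

Hypothesis AK_split : is_split AK.

Lemma place_common_denom (T : finType) (F : T -> K) :
  exists2 r : O, r != 0 & forall t, exists y, iota r * F t = iota y.
Proof.
have /choice [a /choice [s sP]] : forall t, exists a s : O,
    s != 0 /\ F t = iota a / iota s.
  by move=> t; have [a [s [s0 E]]] := place_fracP P (F t); exists a, s.
exists (\prod_t s t) => [|t]; first by apply/prodf_neq0 => t _; case: (sP t).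
exists ((\prod_(t' | t' != t) s t') * a t); case: (sP t) => st ->.
rewrite (bigD1 t) //= !rmorphM [iota (s t) * _]mulrC -mulrA; congr (_ * _).
by rewrite mulrC divfK // -(rmorph0 iota) (inj_eq (@place_frac_inj _ _ _ P)).
Qed.

Definition pi_dvd j (x : AO) := exists y,
  x = alg_scalar AO (place_pi P ^+ j) * y.

Lemma pi_dvdD j x y : pi_dvd j x -> pi_dvd j y -> pi_dvd j (x + y).
Proof. by move=> [u ->] [v ->]; exists (u + v); rewrite mulrDr. Qed.

Lemma pi_dvdN j x : pi_dvd j x -> pi_dvd j (- x).
Proof. by move=> [u ->]; exists (- u); rewrite mulrN. Qed.

Lemma pi_dvdB j x y : pi_dvd j x -> pi_dvd j y -> pi_dvd j (x - y).
Proof. by move=> Hx Hy; apply: pi_dvdD => //; exact: pi_dvdN. Qed.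

Lemma pi_dvd_mulr j x y : pi_dvd j x -> pi_dvd j (x * y).
Proof. by move=> [u ->]; exists (u * y); rewrite mulrA. Qed.

Lemma pi_dvd_mull j x y : pi_dvd j x -> pi_dvd j (y * x).
Proof. by move=> [u ->]; exists (y * u); rewrite !mulrA alg_central. Qed.

Lemma pi_dvdM i j x y : pi_dvd i x -> pi_dvd j y -> pi_dvd (i + j) (x * y).
Proof.
move=> [u ->] [v ->]; exists (u * v).
by rewrite exprD alg_scalar_mulACA.
Qed.

Lemma pi_dvd_le i j x : (i <= j)%N -> pi_dvd j x -> pi_dvd i x.
Proof.
move=> ij [u ->]; exists (alg_scalar AO (place_pi P ^+ (j - i)) * u).
by rewrite mulrA -rmorphM -exprD subnKC.
Qed.

Lemma pi_dvd1 x : sk x = 0 -> pi_dvd 1 x.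
Proof.
move=> /matrixP x0.
have /choice [y yE] : forall i, exists y, (x : 'rV_ _) 0 i = place_pi P * y.
  by move=> i; apply/place_res_pi; have := x0 0 i; rewrite !mxE.
exists (\row_i y i : scext_car A incl); rewrite scext_scaleE.
by apply/matrixP => i j; rewrite ord1 !mxE yE.
Qed.

Lemma res_pi : res (place_pi P) = 0.
Proof. by apply/place_res_pi; exists 1; rewrite mulr1. Qed.

(* Newton iteration for X^2 - X. *)
Lemma lift_idem_mod (w : scext A psi) (x0 : AO) j : w * w = w -> sk x0 = w ->
  exists2 x, sk x = w & pi_dvd j.+1 (x * x - x).
Proof.
move=> ww x0w; elim: j => [|j [x xw xj]].
  by exists x0 => //; apply: pi_dvd1;
    rewrite scext_mapB scext_mapM x0w ww subrr.
pose q : {poly O} := 'X ^+ 2 *+ 3 - 'X ^+ 3 *+ 2.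
have qX : peval x q = x - (x * x - x) * peval x ('X *+ 2 - 1).
  have -> : q = 'X - ('X * 'X - 'X) * ('X *+ 2 - 1) by rewrite /q; ring.
  by rewrite pevalB pevalM pevalX pevalB pevalM pevalX.
exists (peval x q).
  by rewrite qX scext_mapB scext_mapM scext_mapB scext_mapM xw ww subrr mul0r
    subr0.
(* The new defect of idempotency is a multiple of the square of the old one. *)
have -> : peval x q * peval x q - peval x q =
    (x * x - x) * (x * x - x) * peval x ('X ^+ 2 *+ 4 - 'X *+ 4 - 3%:R).
  rewrite -pevalM -pevalB.
  have -> : q * q - q = (('X * 'X - 'X) * ('X * 'X - 'X)) * ('X ^+ 2 *+ 4 - 'X
    *+ 4 - 3%:R).
    by rewrite /q; ring.
  by rewrite pevalM; congr (_ * _); rewrite pevalM pevalB pevalM pevalX.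
apply/pi_dvd_mulr/(@pi_dvd_le _ (j.+1 + j.+1)); last exact: pi_dvdM.
by rewrite addSn ltnS leq_addl.
Qed.

(** The commutator is the difference of xy(1 - x) and (1 - x)yx. Up to multiples of the defect [e],
    multiplying such a term again by x and 1 - x on its two sides reproduces it. If it is pi^i u,
    this multiplication gains a factor pi, since w is a central idempotent and so kills the
    corresponding component of u modulo pi. *)
Lemma idem_mod_central (w : scext A psi) x j : w * w = w -> (forall y,
  w * y = y * w) ->
  sk x = w -> pi_dvd j (x * x - x) -> forall y, pi_dvd j (x * y - y * x).
Proof.
move=> ww wC xw xj y; pose e := x * x - x.
have ee : x * x = x + e by rewrite /e addrC subrK.
have ce : (1 - x) * (1 - x) = 1 - x + e.
  by rewrite mulrBl mul1r mulrBr mulr1 opprB.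
have H i : (i <= j)%N -> pi_dvd i (x * y * (1 - x)) /\
  pi_dvd i ((1 - x) * y * x).
  elim: i => [|i IH] ij.
    by split; [exists (x * y * (1 - x)) | exists ((1 - x) * y * x)];
      rewrite expr0 rmorph1 mul1r.
  have [[u uE] [v vE]] := IH (ltnW ij); have xi := pi_dvd_le ij xj.
  split.
  - have -> : x * y * (1 - x) = x * (x * y * (1 - x)) * (1 - x)
        - (e * y * ((1 - x) * (1 - x)) + x * y * e).
      have -> : x * (x * y * (1 - x)) * (1 - x) = x * x * y * ((1 - x) * (1 -
        x)).
        by rewrite !mulrA.
      rewrite ee [(x + e) * y]mulrDl [(_ + _) * (_ * _)]mulrDl opprD addrA
        addrK.
      by rewrite -mulrBr ce addrK.
    apply: pi_dvdB; last by apply: pi_dvdD; [do 2!apply: pi_dvd_mulr | apply: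
      pi_dvd_mull].
    rewrite uE mulrA -alg_central -!mulrA -addn1; apply: pi_dvdM.
      by exists 1; rewrite mulr1.
    apply: pi_dvd1; rewrite !scext_mapM scext_mapB scext_map1 xw.
    by rewrite mulrA wC -mulrA mulrBr mulr1 ww subrr mulr0.
  - have -> : (1 - x) * y * x = (1 - x) * ((1 - x) * y * x) * x
        - (e * y * (x * x) + (1 - x) * y * e).
      have -> : (1 - x) * ((1 - x) * y * x) * x = (1 - x) * (1 - x) * y * (x *
        x).
        by rewrite !mulrA.
      rewrite ce [(1 - x + e) * y]mulrDl [(_ + _) * (x * x)]mulrDl opprD addrA
        addrK.
      by rewrite -mulrBr ee addrK.
    apply: pi_dvdB; last by apply: pi_dvdD; [do 2!apply: pi_dvd_mulr | apply:
      pi_dvd_mull].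
    rewrite vE mulrA -alg_central -!mulrA -addn1; apply: pi_dvdM.
      by exists 1; rewrite mulr1.
    apply: pi_dvd1; rewrite !scext_mapM scext_mapB scext_map1 xw.
    by rewrite -wC mulrA mulrBl mul1r ww subrr mul0r.
have [H1 H2] := H j (leqnn j).
have -> : x * y - y * x = x * y * (1 - x) - (1 - x) * y * x.
  rewrite mulrBr mulr1 !mulrBl mul1r opprB addrA addrNK //.
exact: pi_dvdB.
Qed.

(* The generalized inverse N of the commutator map M over K has denominators
   dividing pi^m, so an element commuting with AO modulo pi^(m+1) is congruent
   to a central one modulo pi. *)
Lemma lift_central (w : scext A psi) (x0 : AO) : w * w = w -> (forall y,
  w * y = y * w) ->
  sk x0 = w -> exists2 z, sk z = w & forall y, sK z * y = y * sK z.
Proof.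
move=> ww wC x0w; pose n := free_rank A; pose I := ('I_n * 'I_n)%type.
pose b i := toK (free_basis A i).
pose comm (u : AK) : 'rV[K]_#|{: I}| :=
  \row_c (u * b (enum_val c).1 - b (enum_val c).1 * u : 'rV_n) 0 (enum_val c).2.
pose M : 'M[K]_(n, #|{: I}|) := \matrix_r comm (b r).
have commE (u : AK) : (u : 'rV[K]_n) *m M = comm u.
  apply/rowP => c; rewrite mxE [RHS]mxE; set bi := b _.
  have -> : u * bi - bi * u =
      \sum_r alg_scalar AK ((u : 'rV_n) 0 r) * (b r * bi - bi * b r).
    rewrite -[u in LHS](@free_coordK _ AK) mulr_suml mulr_sumr -sumrB.
    by apply: eq_bigr => r _; exact: alg_scalar_commutator.
  rewrite summxE; apply: eq_bigr => r _.
  by rewrite scext_scaleE !mxE.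
pose N := pinvmx M.
have [r r0 rN] := place_common_denom (fun cs : 'I_#|{: I}| * 'I_n =>
  N cs.1 cs.2).
(* Some power of pi is a multiple of the common denominator [r] of [N], so this power clears
   denominators too. *)
have [m [y yE]] := @place_pow _ _ _ P r (elimN eqP r0).
have /choice [N' N'E] : forall cs : 'I_#|{: I}| * 'I_n, exists t,
    iota (place_pi P ^+ m) * N cs.1 cs.2 = iota t.
  move=> cs; have [t tE] := rN cs; exists (y * t).
  by rewrite yE mulrC rmorphM mulrA [_ * iota r]mulrC tE -rmorphM mulrC.
have [x xw xm] := lift_idem_mod m ww x0w.
have xC := idem_mod_central ww wC xw xm.
have /choice [t tE] : forall c, exists t,
  comm (sK x) 0 c = iota (place_pi P ^+ m.+1) * iota t.
  move=> c; have [y0 y0E] := xC (toO (free_basis A (enum_val c).1)).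
  exists ((y0 : 'rV_n) 0 (enum_val c).2).
  rewrite mxE -/(b _) /b -!(scext_map_to_scext (@place_inclE _ _ _ P)).
  rewrite -!scext_mapM -scext_mapB y0E scext_scaleE.
  by rewrite mxE mxE rmorphM.
(* Chosen so that pi times [v] is [comm (sK x) *m N]. Subtracting it from x cancels all commutators,
   as [comm (sK x)] lies in the row space of [M]. *)
pose v : 'rV[O]_n := \row_s \sum_c t c * N' (c, s).
exists (x - alg_scalar AO (place_pi P) * (v : scext_car A incl)).
  by rewrite scext_mapB scext_mapM scext_map_scalar res_pi rmorph0 mul0r subr0.
set z := x - _.
have zM : (sK z : 'rV[K]_n) *m M = 0.
  have -> : (sK z : 'rV[K]_n) = (sK x : 'rV[K]_n) - iota (place_pi P) *:
    map_mx iota v.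
    by rewrite /z scext_mapB scext_map_scale scext_scaleE.
  rewrite mulmxBl; apply/eqP; rewrite subr_eq0; apply/eqP.
  have -> : iota (place_pi P) *: map_mx iota v = comm (sK x) *m N.
    apply/rowP => s; rewrite !mxE rmorph_sum mulr_sumr; apply: eq_bigr => c _.
    rewrite tE rmorphM -N'E exprS !rmorphM /= -!mulrA; congr (_ * _).
    by rewrite mulrCA.
  by rewrite -commE mulmxKpV // submxMl.
have zb i : sK z * b i = b i * sK z.
  apply/eqP; rewrite -subr_eq0; apply/eqP/rowP => j.
  have /rowP/(_ (enum_rank (i, j))) := commE (sK z).
  by rewrite zM [X in _ = X]mxE enum_rankK /= => <-; rewrite !mxE.
move=> u; rewrite -[u](@free_coordK _ AK) mulr_sumr mulr_suml.
apply: eq_bigr => i _; rewrite mulrA -alg_central -!mulrA; congr (_ * _).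
exact: zb.
Qed.

(** By splitness z acts as a scalar, which lies in O since it is a diagonal entry on a lattice. Its
    residue is idempotent because w is. *)
Lemma central_eigenvalue (w : Ap) (z : AO) (S : rep AK) : w * w = w ->
  sk z = sf w ->
  (forall y, sK z * y = y * sK z) -> rep_simple S ->
  exists a : O, S (sK z) = (iota a)%:M /\ (res a = 0 \/ res a = 1).
Proof.
move=> ww zw zC sS; have [L LV] := lattice_exists P S.
have [a aE] := central_scalar AK_split sS zC.
have [g [h [gH gh hg]]] := LV.
have LzE : map_mx iota (L z) = a%:M.
  rewrite -(rep_change_map (@place_inclE _ _ _ P)) -[LHS]mul1mx -hg -mulmxA gH.
  by rewrite aE mul_scalar_mx -scalemxAr hg scalemx1.
have [i _] : exists i : 'I_(rep_dim L), true.
  have dE : rep_dim L = rep_dim S.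
    by apply/eqP; rewrite eqn_leq (mulmx1_min hg) (mulmx1_min gh).
  by case: sS => + _; rewrite /rep_nonzero -dE => L0; exists (Ordinal L0).
exists (L z i i); have aL : iota (L z i i) = a.
  by have /matrixP/(_ i i) := LzE; rewrite !mxE eqxx.
split; first by rewrite aL.
have spE : special L (sf w) = (res (L z i i))%:M.
  rewrite -zw rep_change_map; apply/matrixP => j l; rewrite !mxE.
  have -> : L z j l = L z i i *+ (j == l).
    apply: (@place_frac_inj _ _ _ P); rewrite rmorphMn aL.
    by have /matrixP/(_ j l) := LzE; rewrite !mxE.
  by rewrite rmorphMn.
have : special L (sf w) *m special L (sf w) = special L (sf w).
  by rewrite -rep_actM -scext_mapM ww.
rewrite spE mul_scalar_mx scale_scalar_mx => /matrixP/(_ i i).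
rewrite !mxE eqxx => /eqP;
  rewrite -subr_eq0 -{3}[res _]mulr1 -mulrBr mulf_eq0 subr_eq0.
by move=> /orP [/eqP|/eqP]; [left|right].
Qed.

(** [r0] and [r1] collect the linear factors for the scalars with residue 0 and 1. Their product at
    z kills all composition factors of the regular module, hence is nilpotent, and suitable powers
    give [q0] and [q1]. Roots with different residues differ, whence coprimality. *)
Lemma central_annihilator (w : Ap) (z : AO) : w * w = w -> sk z = sf w ->
  (forall y, sK z * y = y * sK z) ->
  exists q0 q1 : {poly O}, exists m0 m1,
  [/\ map_poly res q0 = 'X^m0, map_poly res q1 = ('X - 1) ^+ m1,
    coprimep (map_poly iota q0) (map_poly iota q1)
    & peval (sK z) (map_poly iota (q0 * q1)) = 0].
Proof.
move=> ww zw zC; have [s sS regE] := G0_class_simples (regular_rep AK).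
have /choice [a aP] : forall S : rep AK, exists a : O, rep_simple S ->
    S (sK z) = (iota a)%:M /\ (res a = 0 \/ res a = 1).
  (* The value 0 at modules that are not simple is a dummy. *)
  move=> S; have [sS'|nS] := pselect (rep_simple S); last by exists 0.
  by have [a aE] := central_eigenvalue ww zw zC sS'; exists a.
pose r0 := \prod_(S <- s | res (a S) == 0) ('X - (a S)%:P).
pose r1 := \prod_(S <- s | res (a S) != 0) ('X - (a S)%:P).
have r01 : r0 * r1 = \prod_(S <- s) ('X - (a S)%:P)
  by rewrite [RHS](bigID (fun S => res (a S) == 0)).
pose b := peval (sK z) (map_poly iota (r0 * r1)).
have Sb S : S \in s -> S b = 0.
  move=> Ss; rewrite /b r01 (big_rem S Ss) /= rmorphM /= map_polyXsubC pevalM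
    rep_actM.
  rewrite pevalB pevalX pevalC rep_actB rep_scalar.
  by have [-> _] := aP S (sS S Ss); rewrite subrr mul0mx.
have breg : (regular_rep AK b) ^+ free_rank A = 0 :> 'M_(free_rank A).
  apply: core_rank0_nilp; have := congr1 (G0_core_rank b) regE.
  rewrite G0_core_rank_class G0_core_rank_sum big_seq big1 => [[]//|S Ss].
  by rewrite G0_core_rank_class Sb // core_rank_0.
set n := free_rank A in breg.
exists (r0 ^+ n), (r1 ^+ n).
exists (size [seq S <- s | res (a S) == 0%R] * n)%N.
exists (size [seq S <- s | res (a S) != 0%R] * n)%N.
have r0k : map_poly res r0 = 'X^(size [seq S <- s | res (a S) == 0]).
  rewrite rmorph_prod /= -big_filter; elim:
    [seq _ <- _ | _] (filter_all (fun S => res (a S) == 0) s) => [|S t IH].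
    by rewrite big_nil.
  by move=> /= /andP [/eqP aS /IH E];
    rewrite big_cons E map_polyXsubC aS subr0 exprS.
have r1k : map_poly res r1 = ('X - 1) ^+ (size [seq S <- s | res (a S) != 0]).
  rewrite rmorph_prod /= -big_filter.
  have : all (fun S => res (a S) == 1) [seq S <- s | res (a S) != 0].
    apply/allP => S; rewrite mem_filter => /andP [aS /sS sS'].
    by have [_ [aS0|->//]] := aP S sS'; rewrite aS0 eqxx in aS.
  elim: [seq _ <- _ | _] => [|S t IH]; first by rewrite big_nil.
  by move=> /= /andP [/eqP aS /IH E]; rewrite big_cons E map_polyXsubC aS exprS.
split.
- by rewrite rmorphXn /= r0k -exprM.
- by rewrite rmorphXn /= r1k -exprM.
- rewrite !rmorphXn /= coprimep_expl // coprimep_expr // !rmorph_prod /=.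
  apply: (big_ind (fun q => coprimep q _)) => [|x y|S aS]; first exact:
    coprime1p.
    by rewrite coprimepMl => -> ->.
  apply: (big_ind (coprimep _)) => [|x y|T aT]; first exact: coprimep1.
    by rewrite coprimepMr => -> ->.
  rewrite !map_polyXsubC coprimep_XsubC root_XsubC (inj_eq (@place_frac_inj _ _
    _ P)).
  by apply: contraNneq aT => ->.
- rewrite -exprMn rmorphXn /= peval_exp.
  by apply: (@regular_rep_inj _ AK); rewrite rmorphXn.
Qed.

(** A Bezout relation for [q0] and [q1] gives a polynomial c in z that is a central idempotent,
    separating the scalars with residue 0 from those with residue 1. On the reductions of the
    corresponding modules [V0] and [V1], w is 0 and 1, so c lies in A_p. It remains to see that c
    reduces to w itself. *)
Lemma central_idem_lift (w : Ap) : w * w = w -> (forall y, w * y = y * w) ->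
  exists c, [/\ reduces c w, c * c = c & forall y, c * y = y * c].
Proof.
move=> ww wC.
have [b bw] := reduces_surj w; have [x0 [_ x0w]] := reduces_place bw.
have [a [s [sp _ sw]]] := bw.
have fww : sf w * sf w = sf w by rewrite -scext_mapM ww.
have fwC y : sf w * y = y * sf w.
  rewrite -[y](@free_coordK _ (scext A psi)) mulr_sumr mulr_suml.
  apply: eq_bigr => i _; rewrite mulrA -alg_central -!mulrA; congr (_ * _).
  by rewrite -[free_basis _ i](scext_map_to_scext f_res) -!scext_mapM wC.
have [z zw zC] := lift_central fww fwC x0w.
have [q0 [q1 [m0 [m1 [q0k q1k cop q01]]]]] := central_annihilator ww zw zC.
have /Bezout_eq1_coprimepP [[u v] /= uv] := cop.
pose h0 := map_poly iota q0; pose h1 := map_poly iota q1.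
have h01 : peval (sK z) (h0 * h1) = 0 by rewrite -rmorphM.
pose c := peval (sK z) (u * h0).
have c1 : 1 - c = peval (sK z) (v * h1).
  by rewrite -(peval1 (sK z)) -pevalB -uv addrC addKr.
have ch1 : c * peval (sK z) h1 = 0 by rewrite -pevalM -mulrA pevalM h01 mulr0.
have ch0 : (1 - c) * peval (sK z) h0 = 0.
  by rewrite c1 -pevalM -mulrA [h1 * _]mulrC pevalM h01 mulr0.
have cc : c * c = c.
  apply/eqP; rewrite eq_sym -subr_eq0 -{1}[c]mulr1 -mulrBr c1 -pevalM.
  by rewrite mulrACA [h0 * h1]mulrC [h1 * _]mulrC pevalM h01 mulr0.
have cC y : c * y = y * c by rewrite (peval_comm _ (esym (zC y))).
have [V0 [V1 [V0c V1c faith regE]]] := central_idem_split cc cC.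
(* A polynomial relation over O for z on [V] holds on the lattice, and therefore for w on its
   reduction. *)
have sp_w (V : rep AK) (L : rep AO) (q : {poly O}) : rep_iso (generic L) V ->
    V (peval (sK z) (map_poly iota q)) = 0 ->
    peval (special L (sf w) : mx_algebra k _) (map_poly res q) = 0.
  move=> LV Vq; have : L (peval z q) = 0.
    apply/(lattice_act0 _ LV); rewrite -Vq; congr (V _).
    by apply: (@peval_morph _ _ AO AK iota sK) => r;
      rewrite [LHS](scext_map_scalar A (@place_inclE _ _ _ P)).
  move=> Lq; rewrite -zw -rep_peval.
  have <- : sk (peval z q) = peval (sk z) (map_poly res q).
    by apply: (@peval_morph _ _ AO (scext A psi) res sk) => r;
      rewrite [LHS](scext_map_scalar A (@place_resE _ _ _ P)).
  by rewrite rep_change_map Lq map_mx0.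
have special_idem (L : rep AO) : (special L (sf w) :
  mx_algebra k _) * special L (sf w) = special L (sf w).
  by rewrite -[LHS](rep_actM (special L)) -scext_mapM ww.
have sp0 (L : rep AO) : rep_iso (generic L) V0 -> special L (sf w) = 0.
  move=> LV; have := sp_w _ _ q0 LV.
  rewrite -[peval _ _]mul1r -{1}(subrK c 1) mulrDl ch0 add0r rep_actM V0c mul0mx
    => /(_ erefl).
  by rewrite q0k peval_exp pevalX => /(mx_idem_nilp (special_idem L)).
have sp1 (L : rep AO) : rep_iso (generic L) V1 -> special L (sf w) = 1%:M.
  move=> LV; have := sp_w _ _ q1 LV.
  rewrite -[peval _ _]mul1r -{1}(subrK c 1) mulrDl ch1 addr0 rep_actM rep_actB
    V1c.
  rewrite rep_act1 subrr mul0mx => /(_ erefl);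
    rewrite q1k peval_exp pevalB pevalX peval1 => E.
  apply/eqP; rewrite eq_sym -subr_eq0; apply/eqP.
  apply: (mx_idem_nilp (n := m1) (idem_compl (special_idem L))).
  by rewrite -opprB exprNn [X in _ * X]E mulr0.
have cloc : A_loc A p c.
  apply: (idempotent_A_loc (a := a) sp V0c V1c faith).
    have [L LV] := lattice_exists P V0.
    rewrite (core_rank_special _ LV) -sw scext_mapM rep_actM (sp0 L LV) mulmx0.
    by rewrite core_rank_0.
  have [L LV] := lattice_exists P V1.
  have -> : top (alg_scalar A s - a) = alg_scalar Ap (residue p s) * (1 - w).
    rewrite mulrBr mulr1 sw -(to_scext_scalar A (residue p)).
    exact: to_scext_is_zmod_morphism.
  rewrite (core_rank_special _ LV) scext_mapM rep_actM scext_mapB scext_map1.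
  by rewrite rep_actB rep_act1 (sp1 L LV) subrr mulmx0 core_rank_0.
have [w' cw'] := A_loc_reduces cloc.
have w'w' := reduces_idem cw' cc.
have w'C := reduces_central cw' cC.
(* The classes of [V0] and [V1] add up to the regular class, so an idempotent vanishing on both
   reductions is zero. This applies to w(1 - w') and w'(1 - w) and yields w = w'. *)
have g0 (g : Ap) : g * g = g ->
    (forall L, rep_iso (generic L) V0 -> special L (sf g) = 0) ->
    (forall L, rep_iso (generic L) V1 -> special L (sf g) = 0) -> g = 0.
  move=> gg g0 g1; apply: regular_rep_inj; apply: core_rank0_idem.
    by rewrite -rep_actM gg.
  have [L0 LV0] := lattice_exists P V0; have [L1 LV1] := lattice_exists P V1.
  have := core_rank_regular g; rewrite regE (raddfD d) G0_core_rank_add.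
  rewrite (core_rank_special _ LV0) (core_rank_special _ LV1) (g0 _ LV0) (g1 _
    LV1).
  by rewrite !core_rank_0 => -[].
have ww'0 : w * (1 - w') = 0.
  apply: g0 => [|L LV|L LV].
  - rewrite -mulrA [(1 - w') * _]mulrA -[(1 - w') * w]wC mulrA mulrA ww -mulrA.
    by rewrite idem_compl.
  - by rewrite scext_mapM rep_actM sp0 // mul0mx.
  - rewrite scext_mapM rep_actM (special_reduces0 LV (reducesB reduces1 cw'))
      ?mulmx0 //.
    by rewrite rep_actB V1c rep_act1 subrr.
have w'w0 : w' * (1 - w) = 0.
  apply: g0 => [|L LV|L LV].
  - rewrite -mulrA [(1 - w) * _]mulrA -[(1 - w) * w']w'C mulrA mulrA w'w'
      -mulrA.
    by rewrite idem_compl.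
  - by rewrite scext_mapM rep_actM (special_reduces0 LV cw') ?mul0mx.
  - rewrite scext_mapM rep_actM scext_mapB scext_map1 rep_actB rep_act1 sp1 //.
    by rewrite subrr mulmx0.
exists c; split=> //; suff -> : w = w' by [].
move: ww'0 w'w0; rewrite !mulrBr !mulr1 => /eqP; rewrite subr_eq0 => /eqP E.
by move=> /eqP; rewrite subr_eq0 => /eqP ->; rewrite -wC -E.
Qed.

(** * Correspondence of blocks and families *)

Lemma A_loc_center c : (forall x, A_loc A p x -> c * x = x * c) -> forall x,
  c * x = x * c.
Proof.
move=> cC x; rewrite -[x](@free_coordK _ AK) mulr_sumr mulr_suml.
apply: eq_bigr => i _; rewrite mulrA -alg_central -!mulrA; congr (_ * _).
by apply: cC; exact: reduces_A_loc (reduces_to _).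
Qed.

Lemma reducesD b b' w w' : reduces b w -> reduces b' w' ->
  reduces (b + b') (w + w').
Proof.
move=> bw bw'; rewrite -[b']opprK -[w']opprK -[- b']sub0r -[- w']sub0r.
exact: reducesB bw (reducesB reduces0 bw').
Qed.

Local Notation locP := (A_loc A p).
Local Notation resP := ([set: Ap]%classic).

Lemma central_idem_reduces c : central_idempotent locP c ->
  exists2 w, reduces c w & central_idempotent resP w.
Proof.
move=> [Pc cc /A_loc_center cC]; have [w cw] := A_loc_reduces Pc.
exists w; first exact: cw.
split; [by [] | exact: reduces_idem cw cc | move=> x _].
exact: reduces_central cw cC x.
Qed.

Lemma central_idem_lifts w : central_idempotent resP w ->
  exists2 c, reduces c w & central_idempotent locP c.
Proof.
move=> [_ ww /setT_center wC]; have [c [cw cc cC]] := central_idem_lift ww wC.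
by exists c => //; split=> //; exact: reduces_A_loc cw.
Qed.

(** The idempotent c(1 - c') reduces to w(1 - w) = 0 and hence vanishes; the same holds with c and
    c' exchanged. *)
Lemma reduces_idem_inj c c' w : central_idempotent locP c ->
  central_idempotent locP c' ->
  reduces c w -> reduces c' w -> c = c'.
Proof.
move=> [_ cc /A_loc_center cC] [_ cc' /A_loc_center cC'] cw cw'.
have key b b' : b * b = b -> b' * b' = b' -> (forall x, b' * x = x * b') ->
    reduces b w -> reduces b' w -> b = b * b'.
  move=> bb bb' bC' bw bw'; have ww := reduces_idem bw bb.
  apply/eqP; rewrite -subr_eq0 -{1}[b]mulr1 -mulrBr; apply/eqP/reduces0_idem.
    have <- : w * (1 - w) = 0 by rewrite mulrBr mulr1 ww subrr.
    exact: reducesM bw (reducesB reduces1 bw').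
  by apply: idemM (idem_compl bb') _ => //;
    rewrite mulrBl mulrBr bC' mul1r mulr1.
by rewrite [LHS](key c c') // [RHS](key c' c) // cC.
Qed.

(** Orthogonal decompositions can be reduced and lifted. Uniqueness of lifts ensures that the lifted
    summands add up to c, and a non-zero idempotent has non-zero reduction. *)
Lemma reduces_block c w : central_idempotent locP c ->
  central_idempotent resP w ->
  reduces c w -> block_idempotent locP c <-> block_idempotent resP w.
Proof.
move=> cic ciw cw; have [_ cc _] := cic; have [_ ww _] := ciw; split=>
  -[_ c0 prim].
- split=> // [w0|w1 w2 ciw1 ciw2 w12 wE].
    by apply: c0; apply: (reduces0_idem _ cc); rewrite w0 in cw; exact: cw.
  have [c1 cw1 cic1] := central_idem_lifts ciw1.
  have [c2 cw2 cic2] := central_idem_lifts ciw2.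
  have [Pc1 cc1 cC1] := cic1; have [Pc2 cc2 cC2] := cic2.
  have c12 : c1 * c2 = 0.
    apply: reduces0_idem; first by rewrite -w12; exact: reducesM.
    by apply: idemM => //; exact: A_loc_center cC2 _.
  have cw3 : reduces (c1 + c2) w by rewrite wE; exact: reducesD.
  have ci3 : central_idempotent locP (c1 + c2).
    split=> [||x Px]; first exact: reduces_A_loc cw3.
      by rewrite mulrDl !mulrDr cc1 cc2 [c2 * c1](A_loc_center cC2) c12 addr0
        add0r.
    by rewrite mulrDl mulrDr (A_loc_center cC1) (A_loc_center cC2).
  have cE := reduces_idem_inj cic ci3 cw cw3.
  have [c10|c20] := prim c1 c2 cic1 cic2 c12 cE.
    by left; rewrite c10 in cw1; exact: reduces_fun cw1 reduces0.
  by right; rewrite c20 in cw2; exact: reduces_fun cw2 reduces0.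
- split=> // [c0'|c1 c2 cic1 cic2 c12 cE].
    by apply: c0; rewrite c0' in cw; exact: reduces_fun cw reduces0.
  have [w1 cw1 ciw1] := central_idem_reduces cic1.
  have [w2 cw2 ciw2] := central_idem_reduces cic2.
  have [_ cc1 _] := cic1; have [_ cc2 _] := cic2.
  have w12 : w1 * w2 = 0.
    by apply: reduces_fun (reducesM cw1 cw2) _; rewrite c12; exact: reduces0.
  have wE : w = w1 + w2.
    by apply: reduces_fun cw _; rewrite cE; exact: reducesD.
  have [w10|w20] := prim w1 w2 ciw1 ciw2 w12 wE.
    by left; apply: (reduces0_idem _ cc1); rewrite w10 in cw1; exact: cw1.
  by right; apply: (reduces0_idem _ cc2); rewrite w20 in cw2; exact: cw2.
Qed.

Lemma belongs_reduces (V : rep AK) c w : central_idempotent locP c ->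
  central_idempotent resP w ->
  reduces c w -> rep_belongs V c <-> class_belongs (d (G0_class V)) w.
Proof.
move=> [_ cc _] [_ ww /setT_center wC] cw; rewrite rep_belongs_idem //; split.
  by move=> Vc U /(constituent_belongs cw ww wC Vc) Uw; apply/rep_belongs_idem.
by move=> H; apply: (belongs_constituent cw cc ww) => U /H /rep_belongs_idem;
  exact.
Qed.

(** Each simple T occurs in d[S] for some composition factor S of the regular module: otherwise an
    element fixing a non-zero vector of T and killing all constituents of these d[S] would be
    nilpotent, as its core rank on the regular module of A(p) is 0. If w is 1 on T, then c cannot be
    0 on S. *)
Lemma decomposition_family_block (c : AK) w : central_idempotent locP c ->
  central_idempotent resP w ->
  reduces c w ->
  decomposition_family d [set S | rep_simple S /\ rep_belongs S c]%classic =
  [set T | rep_simple T /\ rep_belongs T w]%classic.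
Proof.
move=> cic ciw cw; have [_ cc /A_loc_center cC] := cic;
  have [_ ww /setT_center wC] := ciw.
apply/seteqP; split=> [T [S [sS Sc] cT]|T [sT /(rep_belongs_idem _ ww) Tw]].
  have [H _] := belongs_reduces S cic ciw cw.
  by split; [case: cT | exact: H Sc T cT].
have [s sS regE] := G0_class_simples (regular_rep AK).
have /choice [l lP] : forall S : rep AK, exists l : seq (int * rep Ap),
    (forall t, t \in l -> constituent t.2 (d (G0_class S))) /\
    d (G0_class S) = \sum_(t <- l) G0_class t.2 *~ t.1.
  by move=> S; have [l] := constituents_sum (d (G0_class S)); exists l.
have [S Ss cT] : exists2 S, S \in s & constituent T (d (G0_class S)).
  apply: contrapT => H.
  have [U /flattenP [_ /mapP [S Ss ->] /mapP [t tl ->]]|b [v [bU Tbv v0]]] :=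
      simple_sep (s := flatten [seq [seq t.2 | t <- l V] | V <- s]) sT.
    have ct := (lP S).1 _ tl; split; first by case: ct.
    by move=> tT; apply: H; exists S => //; exact: constituent_iso tT ct.
  have : core_rank (regular_rep Ap b) = 0%N.
    have := core_rank_regular b;
      rewrite regE raddf_sum G0_core_rank_sum big_seq.
    rewrite big1 => [[]//|S Ss].
    rewrite (lP S).2 G0_core_rank_sum big_seq big1 // => t tl.
    rewrite raddfMz /= G0_core_rank_class bU ?core_rank_0 ?mul0rz //.
    by apply/flattenP; exists [seq t.2 | t <- l S]; exact: map_f.
  move=> /core_rank0_nilp bn; have bn0 : b ^+ free_rank Ap = 0.
    by apply: (@regular_rep_inj _ Ap); rewrite rmorphXn.
  have := eigenvector_exp (free_rank Ap) Tbv; rewrite -[_ ^+ _](rmorphXn T) bn0.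
  by rewrite rep_act0 mul0mx => v00; rewrite -v00 eqxx in v0.
exists S => //; split; first exact: sS.
have [Sc|Sc] := simple_central_idem (sS S Ss) cc cC;
  last exact/rep_belongs_idem.
have Sc1 : S (1 - c) = 1%:M by rewrite rep_actB Sc rep_act1 subr0.
have Tw1 : T (1 - w) = 1%:M.
  apply: (constituent_belongs (reducesB reduces1 cw) (idem_compl ww) _ Sc1 cT).
  exact: central_compl.
by case: (simple_idem_neq sT); rewrite -Tw1 rep_actB Tw rep_act1 subrr.
Qed.

(** Otherwise 1 would have core rank 0 on d[V], hence act as zero on [V]. *)
Lemma constituent_exists (V : rep AK) : rep_nonzero V ->
  exists U, constituent U (d (G0_class V)).
Proof.
move=> V0; have [|U cU _] := @constituent_core_rank _ _ 1 (d (G0_class V)); last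
  by exists U.
move=> cr; have := core_rank_reduces_idem reduces1 (mulr1 1) (mulr1 1) cr.
rewrite rep_act1 => V1; have := core_rank1 K (rep_dim V);
  rewrite V1 core_rank_0 => V00.
by move: V0; rewrite /rep_nonzero -V00.
Qed.

(** * Connected components of the Brauer graph *)

Lemma same_family_sym (S T : rep AK) : same_family S T -> same_family T S.
Proof. by move=> [X [fX XS XT]]; exists X. Qed.

Lemma same_family_central (S T : rep AK) e : same_family S T -> e * e = e ->
  (forall x, e * x = x * e) -> S e = 1%:M -> T e = 1%:M.
Proof.
move=> [_ [[b bb ->] [sS Sb] [sT Tb]]] ee eC Se.
have [[_ b2 _] _ _] := bb.
move: Sb Tb => /(rep_belongs_idem _ b2) Sb /(rep_belongs_idem _ b2) Tb.
have [be|be] := block_prim bb ee eC (fun _ _ => conj I I).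
  by case: (simple_idem_neq sS);
    rewrite -(rep_act0 S) -be rep_actM Sb Se mulmx1.
by rewrite -[T e]mul1mx -Tb -rep_actM be.
Qed.

Lemma rep_iso_act1 (S T : rep AK) e : rep_iso S T -> S e = 1%:M -> T e = 1%:M.
Proof.
move=> [f0 [g [fH fg gf]]] Se.
by rewrite -[T e]mulmx1 -fg mulmxA -fH Se mulmx1.
Qed.

(** Along an edge, w is the identity on the common constituent because c is on S'. If c were 0 on
    T', then 1 - w would be the identity on it as well. *)
Lemma brauer_connected_loc (S T : rep AK) c : central_idempotent locP c ->
  brauer_connected d S T -> S c = 1%:M -> T c = 1%:M.
Proof.
move=> cic; have [w cw [_ ww /setT_center wC]] := central_idem_reduces cic.
have [_ cc /A_loc_center cC] := cic.
elim=> {S T} [S T [ST|[S' [T' [U [SS' TT' US UT]]]]]| |S T U _ IH1 _ IH2].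
- exact: rep_iso_act1.
- move=> /(same_family_central SS' cc cC) S'c.
  have Uw := constituent_belongs cw ww wC S'c US.
  apply: (same_family_central (same_family_sym TT') cc cC).
  have [X [[b _ ->] _ [sT' _]]] := TT'.
  have [T'c|//] := simple_central_idem sT' cc cC.
  have T'c1 : T' (1 - c) = 1%:M by rewrite rep_actB T'c rep_act1 subr0.
  have Uw1 : U (1 - w) = 1%:M.
    apply: (constituent_belongs (reducesB reduces1 cw) (idem_compl ww) _ T'c1
      UT).
    exact: central_compl.
  have [sU _] := US.
  by case: (simple_idem_neq sU); rewrite -Uw1 rep_actB Uw rep_act1 subrr.
- by [].
- by move=> /IH1/IH2.
Qed.

(* A central idempotent of maximal rank among those acting as zero on all
   simple modules outside of G acts as the identity on those in G. *)
Lemma family_idem (G : rep AK -> Prop) :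
  (forall S T, same_family S T -> G S -> G T) ->
  exists e, [/\ e * e = e, forall x, e * x = x * e
    & forall S, rep_simple S -> (S e = 1%:M <-> G S)].
Proof.
move=> Gfam.
pose good e := [/\ e * e = e, forall x, e * x = x * e
    & forall S, rep_simple S -> S e = 1%:M -> G S].
pose Q m := `[< exists2 e, good e & \rank (regular_rep AK e) = m >].
have exQ : exists m, Q m.
  exists (\rank (regular_rep AK 0)); apply/asboolP; exists 0 => //; split=>
    [|x|S sS].
  - by rewrite mulr0.
  - by rewrite mulr0 mul0r.
  - by rewrite rep_act0 => /(simple_idem_neq sS).
have ubQ m : Q m -> (m <= free_rank AK)%N.
  by move=> /asboolP [e _ <-]; exact: rank_leq_row.
have [_ /asboolP [e [ee eC eG] <-] max] := ex_maxnP exQ ubQ.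
exists e; split=> // S sS; split=> [|GS]; first exact: eG.
have [Se|//] := simple_central_idem sS ee eC; exfalso.
(* If e is zero on S, the block idempotent b of S is orthogonal to e, and e + b contradicts the
   maximality of the rank. *)
have [b bb Sb] := block_of_simple (@setT_center _ AK) sS I.
have [[_ b2 /setT_center bC] b0 _] := bb.
have be : b * e = 0.
  have [//|beb] := block_prim bb ee eC (fun _ _ => conj I I).
  by case: (simple_idem_neq sS); rewrite -Sb -beb rep_actM Se mulmx0.
have eb : e * b = 0 by rewrite eC.
apply: b0; apply: (@rank_orthogonal _ AK e (e + b) b _ _ eb).
- by rewrite mulrDr ee eb addr0.
- by rewrite mulrDl eb b2 add0r.
apply: max; apply/asboolP; exists (e + b) => //; split=> [|x|T sT].
- by rewrite mulrDl !mulrDr ee eb be b2 addr0 add0r.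
- by rewrite mulrDl mulrDr eC bC.
have [Te|Te] := simple_central_idem sT ee eC; last by move=> _; exact: eG.
rewrite rep_actD Te add0r => Tb; apply: Gfam GS.
exists [set U | rep_simple U /\ rep_belongs U b]%classic; split.
- by exists b.
- by split=> //; exact/rep_belongs_idem.
- by split=> //; exact/rep_belongs_idem.
Qed.

Lemma same_family_refl (S : rep AK) : rep_simple S -> same_family S S.
Proof.
move=> sS; have [b bb Sb] := block_of_simple (@setT_center _ AK) sS I.
have [[_ b2 _] _ _] := bb.
exists [set U | rep_simple U /\ rep_belongs U b]%classic.
by split; [exists b | split=> //; exact/rep_belongs_idem..].
Qed.

(** The module T represents both families in the edge from T to U, and its reduction has a
    constituent. *)
Lemma brauer_connected_family (S T U : rep AK) :
  brauer_connected d S T -> same_family T U -> brauer_connected d S U.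
Proof.
move=> ST TU; apply: rt_trans ST _; apply: rt_step; right.
have [X [[b _ ->] [sT _] _]] := TU; have [T0 _] := sT.
have [W cW] := constituent_exists T0.
by exists T, T, W; split=> //; [exact: same_family_refl | exact:
  same_family_sym].
Qed.

(* The union G of the families connected to S is cut out by a central
   idempotent e. The simple constituents of the reductions of G and of its
   complement are disjoint, so some element of A(p) acts as 1 on the former
   and as 0 on the latter, which puts e into A_p. *)
Lemma loc_brauer_connected (S T : rep AK) c : block_idempotent locP c ->
  rep_simple S -> rep_simple T -> S c = 1%:M -> T c = 1%:M ->
    brauer_connected d S T.
Proof.
move=> bc sS sT Sc Tc; apply: contrapT => nST.
have [e [ee eC eG]] := family_idem (fun S' T' fST SS' =>
  brauer_connected_family (S := S) SS' fST).
have [V0 [V1 [V0e V1e faith _]]] := central_idem_split ee eC.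
have /choice [l lP] : forall V : rep AK, exists l : seq (int * rep Ap),
    (forall t, t \in l -> constituent t.2 (d (G0_class V))) /\
    d (G0_class V) = \sum_(t <- l) G0_class t.2 *~ t.1.
  by move=> V; have [l] := constituents_sum (d (G0_class V)); exists l.
pose Y (s : seq (rep AK)) := flatten [seq [seq t.2 | t <- l V] | V <- s].
have YP s U : U \in Y s -> exists2 V, V \in s & constituent U (d (G0_class V)).
  move=> /flattenP [_ /mapP [V Vs ->] /mapP [t tl ->]].
  by exists V => //; exact: (lP V).1.
have Ysimple s U : U \in Y s -> rep_simple U by move=> /YP [V _ []].
have Yrank (V : rep AK) s (u : Ap) : G0_class V = \sum_(S' <- s) G0_class S' ->
    (forall U, U \in Y s -> U u = 0) -> G0_core_rank u (d (G0_class V)) = 0.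
  move=> -> Yu; rewrite raddf_sum G0_core_rank_sum big_seq big1 // => S' Ss.
  rewrite (lP S').2 G0_core_rank_sum big_seq big1 // => t tl.
  rewrite raddfMz /= G0_core_rank_class Yu ?core_rank_0 ?mul0rz //.
  by apply/flattenP; exists [seq t.2 | t <- l S']; exact: map_f.
have [s0 sS0 V0E] := G0_class_simples V0; have [s1 sS1 V1E] :=
  G0_class_simples V1.
have s0e := G0_sum_act0 V0E ee V0e.
have V1e' : V1 (1 - e) = 0 by rewrite rep_actB V1e rep_act1 subrr.
have s1e := G0_sum_act0 V1E (idem_compl ee) V1e'.
have [x [x1 x0]] : exists x : Ap, (forall U, U \in Y s1 -> U x = 1%:M) /\
    (forall U, U \in Y s0 -> U x = 0).
  (* A constituent common to both sides would give an edge from a module in G to one outside of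
     G. *)
  apply: comaximal_constituents => [U|U|U U']; [exact: Ysimple..|].
  move=> /YP [S1 S1s cU] /YP [S0 S0s cU'] UU'.
  have sS1' := sS1 _ S1s; have sS0' := sS0 _ S0s.
  have S1G : brauer_connected d S S1.
    apply/(eG _ sS1')/eqP; rewrite eq_sym -subr_eq0 -rep_act1 -rep_actB.
    by rewrite s1e.
  have : S0 e = 1%:M.
    apply/(eG _ sS0'); apply: rt_trans S1G _; apply: rt_step; right.
    exists S1, S0, U'; split=> //; try exact: same_family_refl.
    exact: constituent_iso UU' cU.
  by rewrite s0e // => /(simple_idem_neq sS0').
have [_ [a [s [sp _ sx]]]] := reduces_surj x.
have eloc : locP e.
  apply: (idempotent_A_loc (a := a) sp V0e V1e faith).
    rewrite -sx; apply: (Yrank _ _ _ V0E) => U /x0 Ux.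
    by rewrite rep_actM Ux mulmx0.
  have -> : top (alg_scalar A s - a) = alg_scalar Ap (residue p s) * (1 - x).
    rewrite mulrBr mulr1 sx -(to_scext_scalar A (residue p)).
    exact: to_scext_is_zmod_morphism.
  apply: (Yrank _ _ _ V1E) => U /x1 Ux.
  by rewrite rep_actM rep_actB Ux rep_act1 subrr mulmx0.
have [[Pc cc cC] _ _] := bc.
have locM b b' : locP b -> locP b' -> locP (b * b').
  move=> /A_loc_reduces [w bw] /A_loc_reduces [w' bw'].
  exact: reduces_A_loc (reducesM bw bw').
have loc1e : locP (1 - e).
  by have [w ew] := A_loc_reduces eloc; exact:
    reduces_A_loc (reducesB reduces1 ew).
have Se : S e = 1%:M by apply/(eG _ sS); exact: rt_refl.
(* Now that e is in A_p, primitivity of c in A_p leaves ce = 0, excluded by S, or ce = c, which puts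
   T into G. *)
have [ce|ce] := block_prim bc ee eC (fun _ _ =>
  conj (locM _ _ Pc eloc) (locM _ _ Pc loc1e)).
  by case: (simple_idem_neq sS);
    rewrite -(rep_act0 S) -ce rep_actM Sc Se mulmx1.
by apply: nST; apply/(eG _ sT); rewrite -[T e]mul1mx -Tc -rep_actM ce.
Qed.

(** Stated for an arbitrary place, so that gates and the zero ideal are covered at once. Everything
    is transported along the correspondence between c and its reduction w. *)
Theorem decomposition_blocks :
  [/\ forall V : rep AK, rep_nonzero V ->
        ((exists2 c, block_idempotent locP c & rep_belongs V c) <->
         (exists2 c, block_idempotent resP c & class_belongs (d (G0_class V))
           c)),
      forall V W : rep AK, rep_nonzero V -> rep_nonzero W ->
        ((exists c, [/\ block_idempotent locP c,
            rep_belongs V c & rep_belongs W c]) <->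
         (exists c, [/\ block_idempotent resP c,
            class_belongs (d (G0_class V)) c &
            class_belongs (d (G0_class W)) c])),
      (forall X : set (rep AK), is_family locP X ->
         is_family resP (decomposition_family d X)) /\
      (forall Y : set (rep Ap), is_family resP Y ->
         exists2 X, is_family locP X & Y = decomposition_family d X)
    & forall X : set (rep AK),
        is_brauer_family d X <-> is_family locP X].
Proof.
have down c : block_idempotent locP c -> exists w,
    [/\ block_idempotent resP w, reduces c w,
      central_idempotent locP c & central_idempotent resP w].
  move=> bc; have [cic _ _] := bc; have [w cw ciw] := central_idem_reduces cic.
  by exists w; split=> //; have [H _] := reduces_block cic ciw cw; exact: H.
have up w : block_idempotent resP w -> exists c,
    [/\ block_idempotent locP c, reduces c w,
      central_idempotent locP c & central_idempotent resP w].
  move=> bw; have [ciw _ _] := bw; have [c cw cic] := central_idem_lifts ciw.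
  by exists c; split=> //; have [_ H] := reduces_block cic ciw cw; exact: H.
split.
- move=> V _; split=> [[c /down [w [bw cw cic ciw]] Vc]|[w /up [c [bc cw cic
    ciw]] Vw]].
    by exists w => //; have [H _] := belongs_reduces V cic ciw cw; exact: H.
  by exists c => //; have [_ H] := belongs_reduces V cic ciw cw; exact: H.
- move=> V W _ _; split=> [[c [/down [w [bw cw cic ciw]] Vc Wc]]|[w [/up [c [bc
    cw cic ciw]] Vw Ww]]].
    have [HV _] := belongs_reduces V cic ciw cw; have [HW _] :=
      belongs_reduces W cic ciw cw.
    by exists w; split=> //; [exact: HV | exact: HW].
  have [_ HV] := belongs_reduces V cic ciw cw; have [_ HW] :=
    belongs_reduces W cic ciw cw.
  by exists c; split=> //; [exact: HV | exact: HW].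
- split=> [_ [c /down [w [bw cw cic ciw]] ->]|_ [w /up [c [bc cw cic ciw]] ->]].
    by exists w => //; exact: decomposition_family_block cic ciw cw.
  exists [set S | rep_simple S /\ rep_belongs S c]%classic; first by exists c.
  by rewrite (decomposition_family_block cic ciw cw).
- have famE S c : block_idempotent locP c -> rep_simple S -> S c = 1%:M ->
      [set T | rep_simple T /\ brauer_connected d S T]%classic =
      [set T | rep_simple T /\ rep_belongs T c]%classic.
    move=> bc sS Sc; have [cic _ _] := bc; have [_ cc _] := cic.
    apply/seteqP; split=> T [sT HT]; split=> //.
      by apply/rep_belongs_idem => //; exact: brauer_connected_loc cic HT Sc.
    by apply: (loc_brauer_connected bc) => //; exact/rep_belongs_idem.
  move=> X; split=> [[S sS ->]|[c bc ->]].
    have [|c bc Sc] := block_of_simple A_loc_center sS.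
      exact: reduces_A_loc reduces1.
    by exists c => //; exact: famE.
  have [[_ cc /A_loc_center cC] c0 _] := bc.
  have [S sS Sc] := simple_of_idem cc cC c0.
  by exists S => //; rewrite (famE S c).
Qed.
End Decomposition.

(** * The place defined by a discrete valuation ring *)

Section DvrPlace.
Variables (R : idomainType) (p : prime_idealr R) (D : dvr_over p).
Local Notation O := (dvr_ring D).
Local Notation m := (dvr_max D).

Lemma dvr_uniformizer : exists g : O, forall x, x \in m <-> exists y, x = g * y.
Proof.
have [pid _ _] := dvrP D; have [g gP] := pid m; exists g => x.
by rewrite gP; split=> -[y ->]; exists y; rewrite mulrC.
Qed.

Variable g : O.
Hypothesis gP : forall x, x \in m <-> exists y, x = g * y.

Lemma dvr_unit x : x \notin m -> x \is a GRing.unit.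
Proof.
have [_ mP _] := dvrP D; move=> xm; apply: contraNT xm => xu; exact/mP.
Qed.

Lemma dvr_uniformizer_neq0 : g != 0.
Proof.
have [_ _ nz] := dvrP D; apply: contra_notN nz => /eqP g0 x /gP [y ->].
by rewrite g0 mul0r.
Qed.

Lemma dvr_uniformizer_nunit : g \isn't a GRing.unit.
Proof. by have [_ mP _] := dvrP D; apply/mP/gP; exists 1; rewrite mulr1. Qed.

(* If g^n divides x for all n, the ascending chain of the ideals generated by
   x / g^n is stationary, which makes g invertible. *)
Lemma dvr_valuation x : x != 0 -> exists n u, u \is a GRing.unit /\
  x = g ^+ n * u.
Proof.
move=> x0; apply: contrapT => H.
have dv n : exists y, x = g ^+ n * y.
  elim: n => [|n [y xy]]; first by exists x; rewrite mul1r.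
  have [/gP [z yz]|/dvr_unit yu] := boolP (y \in m).
    by exists z; rewrite exprSr -mulrA -yz.
  by case: H; exists n, y.
have /choice [y yP] := dv.
have gn0 n : g ^+ n != 0 by rewrite expf_neq0 ?dvr_uniformizer_neq0.
have yS n : y n = g * y n.+1.
  by apply: (mulfI (gn0 n)); rewrite -yP mulrA -exprSr -yP.
have ydv n k : exists z, y n = z * y (n + k)%N.
  elim: k => [|k [z zE]]; first by exists 1; rewrite addn0 mul1r.
  by exists (z * g); rewrite addnS -mulrA -yS.
have y0 n : y n != 0 by apply: contraNneq x0 => yn; rewrite (yP n) yn mulr0.
(* The union of the ascending chain of ideals generated by the y n = x / g^n. *)
pose I : {pred O} := fun w => `[< exists n a, w = a * y n >].
have IP w : w \in I <-> exists n a, w = a * y n by split=> /asboolP.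
have [gI gIP] : exists g0 : O, forall w, w \in I <-> exists z, w = z * g0.
  (* An [idealr] is proper, so the case where the union is all of O is treated separately. *)
  have [/IP [n [a one]]|oneI] := boolP (1 \in I).
    exists 1 => w; split=> [_|[z ->]]; first by exists w; rewrite mulr1.
    by apply/IP; exists n, (z * a); rewrite mulr1 -mulrA -one mulr1.
  have Ic : idealr_closed I.
    split=> //; first by apply/IP; exists 0%N, 0; rewrite mul0r.
    move=> a u v /IP [n [b ->]] /IP [k [c ->]]; apply/IP.
    have [z zE] := ydv n k; have [z' z'E] := ydv k n.
    exists (n + k)%N, (a * b * z + c * z').
    by rewrite mulrDl -!mulrA -zE addnC -z'E.
  pose I1 := GRing.isZmodClosed.Build O I (idealr_closedB Ic).
  pose I2 := isProperIdeal.Build O I (idealr_closed_nontrivial Ic).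
  pose J : idealr O := HB.pack I I1 I2.
  by have [pid _ _] := dvrP D; exact: (pid J).
have /IP [n [a gIE]] : gI \in I by apply/gIP; exists 1; rewrite mul1r.
have [b bE] : exists b, y n.+1 = b * gI by apply/gIP/IP; exists n.+1, 1;
  rewrite mul1r.
have : g \is a GRing.unit.
  apply/unitrPr; exists (b * a); apply: (mulIf (y0 n.+1)); rewrite mul1r.
  by rewrite mulrC mulrA [y _ * g]mulrC -yS mulrC -mulrA -gIE.
by apply/negP; exact: dvr_uniformizer_nunit.
Qed.

Lemma dvr_total (x y : O) : (exists z, x = z * y) \/ (exists z, y = z * x).
Proof.
have [->|x0] := eqVneq x 0; first by left; exists 0; rewrite mul0r.
have [->|y0] := eqVneq y 0; first by right; exists 0; rewrite mul0r.
have [i [u [uu xE]]] := dvr_valuation x0; have [j [v [vu yE]]] :=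
  dvr_valuation y0.
have [ij|/ltnW ji] := leqP i j; [right|left].
  exists (g ^+ (j - i) * v / u).
  by rewrite mulrAC [in RHS]xE mulrA mulrK // mulrAC -exprD subnK.
exists (g ^+ (i - j) * u / v).
by rewrite mulrAC [in RHS]yE mulrA mulrK // mulrAC -exprD subnK.
Qed.

Lemma dvr_residue_eq0 x : dvr_residue D x = 0 <-> x \in m.
Proof. by rewrite -residue_eq0; split=> /eqP. Qed.

(** Kept transparent: the lattices and reductions of this place have to be convertible to those in
    the definition of the decomposition map. *)
Definition dvr_place : place (residue_dvr D).
Proof.
apply: (@Place R _ (residue_dvr D) O (dvr_frac D) (dvr_incl D) (dvr_residue D)
  g).
- exact: dvr_inclE.
- exact: dvr_residueE.
- exact: dvr_frac_inj.
- exact: dvr_frac_field.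
- by move=> x; rewrite dvr_residue_eq0.
- move=> x; rewrite dvr_residue_eq0 => /negP/dvr_unit xu.
  by exists x^-1; rewrite mulrV.
- move=> x /eqP /dvr_valuation [n [u [uu ->]]].
  by exists n, u^-1; rewrite mulrK.
- exact: dvr_total.
Defined.

End DvrPlace.

Definition frac_place (R : idomainType) : place (toFrac R).
Proof.
apply: (@Place R _ (toFrac R) {fraction R} idfun (toFrac R) idfun 0) => //.
- by move=> x; exists x, 1; rewrite oner_eq0 /= divr1.
- by move=> x; split=> [/= ->|[y ->]]; [exists 0;
    rewrite mulr0 | rewrite /= mul0r].
- by move=> x /eqP x0; exists x^-1; rewrite divff.
(* The zeroth power of pi = 0 is 1, a multiple of every non-zero x. *)
- by move=> x /eqP x0; exists 0%N, x^-1; rewrite divff.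
- move=> x y; have [->|y0] := eqVneq y 0; first by right; exists 0;
    rewrite mul0r.
  by left; exists (x / y); rewrite divfK.
Defined.

(** * The theorem for gates and for the zero ideal *)

Unset Implicit Arguments.
Local Open Scope classical_set_scope.

Theorem theorem6p9 (R : idomainType) (A : freeAlgebra R)
  (R_normal : normal R)
  (AK_split : is_split (AK A))
  (gates : forall q : prime_idealr R, ~ zero_ideal q ->
     exists O : dvr_over q, perfect_gate A O)
  (p : prime_idealr R)
  (d : {additive G0 (AK A) -> G0 (Ares A p)})
  (d_dec : is_decomposition_map d) :
  [/\ forall V : rep (AK A), rep_nonzero V ->
        ((exists2 c, block_idempotent (A_loc A p) c & rep_belongs V c) <->
         (exists2 c, block_idempotent [set: Ares A p] c &
            class_belongs (d (G0_class V)) c)),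
      forall V W : rep (AK A), rep_nonzero V -> rep_nonzero W ->
        ((exists c, [/\ block_idempotent (A_loc A p) c,
            rep_belongs V c & rep_belongs W c]) <->
         (exists c, [/\ block_idempotent [set: Ares A p] c,
            class_belongs (d (G0_class V)) c &
            class_belongs (d (G0_class W)) c])),
      (forall X : set (rep (AK A)), is_family (A_loc A p) X ->
         is_family [set: Ares A p] (decomposition_family d X)) /\
      (forall Y : set (rep (Ares A p)), is_family [set: Ares A p] Y ->
         exists2 X, is_family (A_loc A p) X & Y = decomposition_family d X)
    & forall X : set (rep (AK A)),
        is_brauer_family d X <-> is_family (A_loc A p) X].
Proof.
case: d_dec => [[p0 dE]|[_ [O _ dE]]]; last first.
  have [g gP] := dvr_uniformizer O.
  exact: (@decomposition_blocks R A p _ (residue_dvr O) (dvr_place gP)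
    (residue_ext O) (@residue_extE _ _ O) d dE R_normal AK_split).
apply: (@decomposition_blocks R A p _ (toFrac R) (frac_place R)
  (residue_zero p0) (residue_zeroE p0) d _ R_normal AK_split) => V L LV.
(* For O = K the reduction of a lattice is its generic module, so it is isomorphic to V. *)
rewrite dE; apply/esym/G0_class_iso.
by case: LV => f [g [fH fg gf]]; exists f, g; split.
Qed.
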